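(* Let $K\ge1$ be an integer. Let $\eta\in C_c^{4K}([-a,a]^2)$ satisfy $\eta(\mathbf{0})=1$ and $\eta(\mathbf{u})=\eta(-\mathbf{u})$ for all $\mathbf{u}$, and assume in addition that $$\frac{\partial^{\alpha+\beta}}{\partial u^\alpha\partial v^\beta}\eta(\mathbf{0})=0$$ for all non-negative integers $\alpha,\beta$ with $0<\alpha+\beta\le 2K$. Let $P$ be a smooth function and $\tilde P=P\eta$. Then, with $h=a/(N+\frac12)$ and with the constants $C_{2k-1}$ defined in the context, $$\int_{|\mathbf{u}|\le a}\frac{\tilde P(\mathbf{u})}{r(\mathbf{u})}\,d\mathbf{u}=\sum_{|\mathbf{i}|\le N}{}^{'}\frac{\tilde P(\mathbf{i}h)}{r(\mathbf{i}h)}h^2+\sum_{k=1}^{K}C_{2k-1}\,h^{2k-1}+O(h^{2K+1})\qquad (N\to\infty).$$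
   Context: Notation: $\mathbf{u}=(u,v)\in\mathbb{R}^2$, $\mathbf{i}=(i,j)\in\mathbb{Z}^2$, $d\mathbf{u}=du\,dv$; $|\mathbf{u}|=\max(|u|,|v|)$ and $|\mathbf{i}|=\max(|i|,|j|)$, so $\{|\mathbf{u}|\le a\}=[-a,a]^2$. A prime on a sum means $(0,0)$ is omitted. Setting: $a>0$; $\mathbf{r}:[-a,a]^2\to\mathbb{R}^3$ is a smooth regular (injective, with $\mathbf{r}_u,\mathbf{r}_v$ linearly independent) parameterization of a surface patch with $\mathbf{r}(\mathbf{0})=\mathbf{0}$; $r(\mathbf{u})=|\mathbf{r}(\mathbf{u})|$ is the Euclidean norm. $Q(\mathbf{u})=Eu^2+2Fuv+Gv^2$ is the first fundamental form at $\mathbf{0}$: $E=\mathbf{r}_u(\mathbf{0})\cdot\mathbf{r}_u(\mathbf{0})$, $F=\mathbf{r}_u(\mathbf{0})\cdot\mathbf{r}_v(\mathbf{0})$, $G=\mathbf{r}_v(\mathbf{0})\cdot\mathbf{r}_v(\mathbf{0})$. $P$ is a smooth function on $[-a,a]^2$. $\eta$ is regarded as a function on $\mathbb{R}^2$ with compact support contained in $[-a,a]^2$, and $C_c^{4K}$ means $4K$ times continuously differentiable. Taylor terms: for $m\ge0$, $q_k^{(m)}$ denotes the homogeneous polynomial of degree $k$ in the Taylor expansion at $\mathbf{0}$ of $(r(\mathbf{u})^2-Q(\mathbf{u}))^m$, which begins at degree $3m$: $(r^2-Q)^m\sim\sum_{k\ge3m}q_k^{(m)}$ (so $q_k^{(0)}=\delta_{0k}$);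 $p_k$ is the homogeneous polynomial of degree $k$ in the Taylor expansion $P\sim\sum_{k\ge0}p_k$. Coefficients: for $h>0$, $k\ge1$ and $0\le m\le 2k-2$ define $$\tilde C^{(m)}_{2k-1}(h)=\binom{-\frac12}{m}\sum_{\substack{\rho+s=2(m+k-1)\\ \rho\ge3m,\ s\ge0}}\left(\int_{\mathbb{R}^2}\frac{q_\rho^{(m)}(\mathbf{u})p_s(\mathbf{u})}{Q(\mathbf{u})^{m+\frac12}}\eta(\mathbf{u}h)\,d\mathbf{u}-\sum_{\mathbf{i}\in\mathbb{Z}^2}{}^{'}\frac{q_\rho^{(m)}(\mathbf{i})p_s(\mathbf{i})}{Q(\mathbf{i})^{m+\frac12}}\eta(\mathbf{i}h)\right),$$ $$C^{(m)}_{2k-1}:=\lim_{h\to0^+}\tilde C^{(m)}_{2k-1}(h),\qquad C_{2k-1}:=\sum_{m=0}^{2k-2}C^{(m)}_{2k-1}.$$ Here $\binom{x}{m}=x(x-1)\cdots(x-m+1)/m!$. *)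

(* Defs.v *)
From HB Require Import structures.
From mathcomp Require Import all_boot all_order all_algebra.
From mathcomp Require Import all_classical all_reals all_analysis.
Import Order.TTheory GRing.Theory Num.Theory.
Import numFieldNormedType.Exports.

Set Implicit Arguments.
Unset Strict Implicit.
Unset Printing Implicit Defensive.

Local Open Scope classical_set_scope.
Local Open Scope ring_scope.

(* The norm of the normed space R * R is the max norm, so this is [-a, a]^2. *)
Definition square (R : realType) (a : R) : set (R * R) := [set u | `|u| <= a].

Definition Du (R : realType) (V : normedModType R) (f : R * R -> V) : R * R -> V :=
  'D_((1, 0) : R * R) f.

Definition Dv (R : realType) (V : normedModType R) (f : R * R -> V) : R * R -> V :=
  'D_((0, 1) : R * R) f.

Definition partial (R : realType) (V : normedModType R) (alpha beta : nat)
    (f : R * R -> V) : R * R -> V :=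
  iter alpha (@Du R V) (iter beta (@Dv R V) f).

(* Meant for open U: every iterated partial derivative of f of order at most n,
   in any order of differentiation, exists and is continuous on U. *)
Fixpoint Cn_on (R : realType) (V : normedModType R) (n : nat) (U : set (R * R))
    (f : R * R -> V) : Prop :=
  {in U, continuous f} /\
  if n is n'.+1 then
    [/\ forall u, U u ->
          derivable f u ((1, 0) : R * R) /\ derivable f u ((0, 1) : R * R),
        Cn_on n' U (Du f) & Cn_on n' U (Dv f)]
  else True.

(* Smoothness on a set A that need not be open: f is C^oo on some open
   neighbourhood of A, and its values outside that neighbourhood are arbitrary.
   A smooth function given on A alone is represented by any smooth extension. *)
Definition smooth_on (R : realType) (V : normedModType R) (A : set (R * R))
    (f : R * R -> V) : Prop :=
  exists U : set (R * R), [/\ open U, A `<=` U & forall n, Cn_on n U f].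

Definition dot (R : realType) (n : nat) (x y : 'rV[R]_n) : R :=
  \sum_(l < n) x 0 l * y 0 l.

(* The norm `|x| of 'rV[R]_n is the max norm, hence this separate definition. *)
Definition enorm (R : realType) (n : nat) (x : 'rV[R]_n) : R :=
  Num.sqrt (dot x x).

Record regular_patch (R : realType) (a : R) (r : R * R -> 'rV[R]_3) : Prop := {
  patch_smooth : smooth_on (square a) r;
  patch_inj : {in square a &, injective r};
  patch_free : forall u, square a u -> free [:: Du r u; Dv r u];
  patch0 : r (0, 0) = 0 }.

Definition fundamental_form (R : realType) (r : R * R -> 'rV[R]_3) (u : R * R) : R :=
  let E := dot (Du r (0, 0)) (Du r (0, 0)) in
  let F := dot (Du r (0, 0)) (Dv r (0, 0)) in
  let G := dot (Dv r (0, 0)) (Dv r (0, 0)) in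
  E * u.1 ^+ 2 + 2 * F * u.1 * u.2 + G * u.2 ^+ 2.

(* Value at u of the homogeneous part of degree k of the Taylor expansion of f
   at the origin. *)
Definition taylor_term (R : realType) (f : R * R -> R) (k : nat) (u : R * R) : R :=
  \sum_(i < k.+1) partial i (k - i) f (0, 0) / (i`! * (k - i)`!)%:R
                  * u.1 ^+ i * u.2 ^+ (k - i).

Definition q_term (R : realType) (r : R * R -> 'rV[R]_3) (m k : nat) : R * R -> R :=
  taylor_term (fun u => (enorm (r u) ^+ 2 - fundamental_form r u) ^+ m) k.

Definition gbinom (R : realType) (x : R) (m : nat) : R :=
  (\prod_(l < m) (x - l%:R)) / (m`!)%:R.

Definition lebesgue2 (R : realType) :
    {measure set (measurableTypeR R * measurableTypeR R) -> \bar R} :=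
  (@lebesgue_measure R \x @lebesgue_measure R)%E.

Definition lattice_point (R : realType) (i : int * int) : R * R :=
  (i.1%:~R, i.2%:~R).

(* The sum over the punctured lattice is a sum over the finite support of the
   summand: eta has compact support, so for h > 0 it vanishes at i h for all but
   finitely many i. *)
Definition Ctilde (R : realType) (r : R * R -> 'rV[R]_3) (P eta : R * R -> R)
    (m k : nat) (h : R) : R :=
  let d := (2 * (m + k - 1))%N in
  let Q := fundamental_form r in
  let f (rho s : nat) (u : R * R) : R :=
    q_term r m rho u * taylor_term P s u / Q u `^ (m%:R + 2^-1) * eta (h *: u) in
  gbinom (- 2^-1) m *
  \sum_(rho < d.+1) \sum_(s < d.+1 | (rho + s == d)%N && (3 * m <= rho)%N)
    (\int[@lebesgue2 R]_(u in setT) f rho s u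
     - \sum_(i \in [set i : int * int | i <> (0, 0)]) f rho s (lattice_point R i)).

(* Cm r P eta m k and Ccoef r P eta k are the coefficients C_{2k-1}^{(m)} and
   C_{2k-1} of h^(2k-1): the index k is not the power of h. *)
Definition Cm (R : realType) (r : R * R -> 'rV[R]_3) (P eta : R * R -> R)
    (m k : nat) : R :=
  lim (Ctilde r P eta m k h @[h --> 0^'+]).

Definition Ccoef (R : realType) (r : R * R -> 'rV[R]_3) (P eta : R * R -> R)
    (k : nat) : R :=
  \sum_(0 <= m < (2 * k - 2).+1) Cm r P eta m k.

Definition step (R : realType) (a : R) (N : nat) : R := a / (N%:R + 2^-1).

Definition punctured_sum (R : realType) (r : R * R -> 'rV[R]_3)
    (f : R * R -> R) (N : nat) (h : R) : R :=
  \sum_(i \in [set i : int * int |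
                i <> (0, 0) /\ Num.max `|i.1| `|i.2| <= N%:Z])
    f (h *: lattice_point R i) / enorm (r (h *: lattice_point R i)) * h ^+ 2.

(* Main.v *)
(** The expansion of [P / r] in powers of [r^2 - Q] writes the integrand as a sum
    of homogeneous functions of degrees [-1, 0, ..., 2K - 2], each multiplied by
    [eta], plus a remainder which is a symbol of order [2K - 1]: its derivatives
    of order [k] are [O(|u|^(2K - 1 - k))].  By homogeneity the step [h] can be
    rescaled to the step [1].

    The quadrature error of a compactly supported symbol [f] of positive order is
    controlled by its symbol bound.  The integral of [f] is the average over
    [t] in the unit cell of the shifted sums [sum_i f(i + t)].  Interpolating [f] at
    nearby lattice points, with weights depending only on [t] and of sum [1],
    turns a shifted sum into [sum_i f(i)] up to an error
    [sum_i O((1 + |i|)^-3)].  This bounds the contribution of the remainder.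

    For a homogeneous term [T] of odd degree the quadrature error is the
    coefficient [Ctilde], and for even degree it vanishes because [T] is odd as
    a function.  As [eta] is flat at the origin, [T (eta - 1)] is again a symbol of
    order [2K - 1]; comparing its dilates shows that [Ctilde m k h] is Cauchy as
    [h] tends to [0], at the rate [h^(2K - 2k + 2)] needed in the theorem. *)
Require Import Defs.
From HB Require Import structures.
From mathcomp Require Import all_boot all_order all_algebra qpoly.
From mathcomp Require Import all_classical all_reals all_analysis.
From mathcomp Require Import measurable_realfun.
From mathcomp Require Import zify ring lra.
Import Order.TTheory GRing.Theory Num.Theory.
Import numFieldNormedType.Exports.

Set Implicit Arguments.
Unset Strict Implicit.
Unset Printing Implicit Defensive.

Local Open Scope classical_set_scope.
Local Open Scope ring_scope.

(** * Symbols *)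

(** The integrand is singular at the origin, so smooth quadrature does not apply directly.
    Interpolation is local: only boundedly many unit cells see the singularity, and there the size
    bound on the function is enough. In every other cell the interpolation nodes stay away from the
    origin and only the decay of the top derivative counts. Lattice sums in the plane converge for
    decay exponent 3, so a symbol of order [s] is differentiated [s + 3] times; for [s = 2K - 1]
    this is [2K + 2], at most [4K].

    Interpolating in one coordinate and then in the other involves unmixed derivatives only, so the
    calculus follows a single direction [e] at a time.

    Powers of [h]: the remainder contributes [h^2 * h^(2K - 1)]. The coefficient of [h^(2k - 1)]
    comes from terms of degree [2k - 3]; against such a term, [T (eta - 1)] of order [2K - 1] gains
    [h^(2K - 2k + 2)] under dilation. Both errors are thus [O(h^(2K + 1))]. *)

(* f and its iterated derivatives along e, up to order M, are O(|u|^(s - k)) on B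
   off the origin.  Differentiability is required on the open set V, which
   contains B, so that B may be the closed square. *)
Fixpoint symb {R : realType} (B V : set (R * R)) (e : R * R) (M : nat) (s : int)
    (f : R * R -> R) : Prop :=
  (exists A : R, forall u, B u -> u != 0 -> `|f u| <= A * `|u| ^ s) /\
  if M is M'.+1 then
    (forall u, V u -> u != 0 -> derivable f u e) /\ symb B V e M' (s - 1) ('D_e f)
  else True.

Lemma ler_exprz_base {R : realFieldType} (x b : R) (n : int) :
  0 <= x -> x <= b -> 0 <= n -> x ^ n <= b ^ n.
Proof.
move=> x0 xb; case: n => [n _|//]; rewrite -!exprnP.
by rewrite lerXn2r// nnegrE// (le_trans x0 xb).
Qed.

Section symb.
Context {R : realType} (B V : set (R * R)) (e : R * R).
Hypotheses (Vo : open V) (BV : B `<=` V).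
Local Notation S := (symb B V e).
Implicit Types (f g : R * R -> R) (M : nat) (s t : int).

Lemma open_punctured u : V u -> u != 0 -> \forall v \near u, V v /\ v != 0.
Proof.
move=> Vu u0; apply: filterI; first exact: (open_nbhs_nbhs (conj Vo Vu)).
have : open (~` [set (0 : R * R)]) by apply/closed_openC/accessible_closed_set1/hausdorff_accessible/norm_hausdorff.
move=> o; have := open_nbhs_nbhs (conj o (_ : (~` [set (0 : R * R)]) u)).
move=> /(_ (elimN eqP u0)); apply: filterS => v /= /eqP //.
Qed.

(** Derivatives are local and [V] without the origin is open, so ['D_e] inherits the equality. The
    values at the origin stay free, which suits quotients whose value there is a convention. *)
Lemma symb_ext M s f g : (forall u, V u -> u != 0 -> f u = g u) -> S M s f -> S M s g.
Proof.
elim: M s f g => [|M IH] s f g fg /= [[A HA] H]; split.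
- by exists A => u Bu u0; rewrite -fg//; [exact: HA|exact: BV].
- by [].
- by exists A => u Bu u0; rewrite -fg//; [exact: HA|exact: BV].
have nfg u : V u -> u != 0 -> \forall v \near u, f v = g v.
  by move=> Vu u0; apply: filterS (open_punctured Vu u0) => v [Vv v0]; exact: fg.
case: H => df H; split; first by move=> u Vu u0; apply: near_eq_derivable (nfg _ _ _) (df u Vu u0).
by apply: IH H => u Vu u0; apply: near_eq_derive; exact: nfg.
Qed.

Lemma symbW M M' s f : (M' <= M)%N -> S M s f -> S M' s f.
Proof.
elim: M M' s f => [|M IH] [|M'] s f//= MM [H1 H2]; split => //.
by case: H2 => ? ?; split=> //; apply: IH => //.
Qed.

Lemma symb0 M s : S M s (cst 0).
Proof.
elim: M s => [|M IH] s /=.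
  by split=> //; exists 0 => u; rewrite mul0r normr0.
split; first by exists 0 => u; rewrite mul0r normr0.
split; first by move=> *; exact: derivable_cst.
by apply: symb_ext (IH _) => u _ _; rewrite derive_cst.
Qed.

Lemma symb_cst M c : S M 0 (cst c).
Proof.
case: M => [|M] /=; (split; first by exists `|c| => u _ _; rewrite expr0z mulr1) => //.
split; first by move=> *; exact: derivable_cst.
by apply: symb_ext (symb0 _ _) => u _ _; rewrite derive_cst.
Qed.

Lemma symbD M s f g : S M s f -> S M s g -> S M s (f + g).
Proof.
elim: M s f g => [|M IH] s f g /= [[A HA] Hf] [[A' HA'] Hg].
all: have ? : exists A0 : R, forall u, B u -> u != 0 -> `|(f + g) u| <= A0 * `|u| ^ s
  by exists (A + A') => u Bu u0; rewrite mulrDl (le_trans (ler_normD _ _))// lerD// ?HA ?HA'.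
by [].
split=> //; case: Hf Hg => df Hf [dg Hg]; split.
  by move=> u Vu u0; apply: derivableD; [exact: df|exact: dg].
apply: symb_ext (IH _ _ _ Hf Hg) => u Vu u0.
by rewrite deriveD//; [exact: df|exact: dg].
Qed.

Lemma symb_le M s t f (b : R) : (forall u, B u -> `|u| <= b) ->
  t <= s -> S M s f -> S M t f.
Proof.
move=> Bb; elim: M s t f => [|M IH] s t f ts /= [[A HA] Hf].
all: have ? : exists A0 : R, forall u, B u -> u != 0 -> `|f u| <= A0 * `|u| ^ t.
1,3: exists (`|A| * (b ^ (s - t))) => u Bu u0; rewrite (le_trans (HA _ Bu u0))//.
1,2: rewrite (_ : s = (s - t) + t); last by rewrite subrK.
1,2: rewrite expfzDr ?normr_eq0// mulrA ler_wpM2r ?exprz_ge0// addrK.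
1,2: rewrite (le_trans (ler_norm _))// normrM ler_wpM2l//.
1,2: rewrite ger0_norm ?exprz_ge0//.
1,2: by rewrite ler_exprz_base ?subr_ge0// Bb.
by [].
split=> //; case: Hf => df Hf; split => //.
by apply: IH Hf; rewrite lerD2r.
Qed.

(** Both halves of the Leibniz rule have total order [s + t - 1], so the induction needs each factor
    at order [M] as well as its derivative. *)
Lemma symbM M s t f g : S M s f -> S M t g -> S M (s + t) (f * g).
Proof.
elim: M s t f g => [|M IH] s t f g /=.
all: move=> SF SG; have [[A HA] Hf] := SF; have [[A' HA'] Hg] := SG.
all: have ? : exists A0 : R, forall u, B u -> u != 0 -> `|(f * g) u| <= A0 * `|u| ^ (s + t).
1,3: exists (A * A') => u Bu u0; rewrite expfzDr ?normr_eq0// normrM mulrACA.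
1,2: by rewrite ler_pM// ?HA ?HA'.
by [].
split=> //; case: Hf Hg => df Hf [dg Hg]; split.
  by move=> u Vu u0; apply: derivableM; [exact: df|exact: dg].
have SF' : S M s f by apply: symbW (leqnSn M) SF.
have SG' : S M t g by apply: symbW (leqnSn M) SG.
have H1 := IH _ _ _ _ SF' Hg; have H2 := IH _ _ _ _ SG' Hf.
rewrite (_ : t + (s - 1) = s + (t - 1)) in H2; last by ring.
rewrite (_ : s + t - 1 = s + (t - 1)); last by ring.
apply: symb_ext (symbD H1 H2) => u Vu u0.
by rewrite deriveM//; [exact: df|exact: dg].
Qed.

Lemma symbZ M s c f : S M s f -> S M s (c \*o f).
Proof.
by move=> Sf; have := symbM (symb_cst M c) Sf; rewrite add0r.
Qed.

Lemma symbX M s f n : S M s f -> S M (s * n%:Z) (f ^+ n).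
Proof.
move=> Sf; elim: n => [|n IH]; first by rewrite expr0 mulr0; exact: symb_cst.
by rewrite exprS -add1n PoszD mulrDr mulr1; exact: symbM.
Qed.

Lemma symb_sum (I : Type) (r : seq I) (P : pred I) M s (F : I -> R * R -> R) :
  (forall i, P i -> S M s (F i)) -> S M s (\sum_(i <- r | P i) F i).
Proof.
by move=> HF; elim/big_ind : _ => //; [exact: symb0|exact: symbD].
Qed.

End symb.

(** * Taylor expansion at the origin *)

Section lines.
Context {R : realType}.
Implicit Types (f g : R * R -> R) (e p : R * R) (x t h : R).

Lemma norm_pairE (u : R * R) : `|u| = Num.max `|u.1| `|u.2|.
Proof. by []. Qed.

Lemma is_derive_line f e p t : derivable f (t *: e + p) e ->
  is_derive t 1 (fun x => f (x *: e + p)) ('D_e f (t *: e + p)).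
Proof.
move=> df.
have E : (fun h => h^-1 *: (f (h *: e + (t *: e + p)) - f (t *: e + p))) =
    (fun h => h^-1 *: (f ((h *: (1:R) + t) *: e + p) - f (t *: e + p))).
  by apply/funext => h; rewrite -[h *: 1]/(h * 1) mulr1 scalerDl addrA.
by split; [move: df; rewrite /derivable/= E | rewrite /derive/= E].
Qed.

Lemma line_continuous f e p t : derivable f (t *: e + p) e ->
  {for t, continuous (fun x => f (x *: e + p))}.
Proof.
by move=> /is_derive_line H; apply/differentiable_continuous/derivable1_diffP; exact: ex_derive.
Qed.

Lemma line_MVT f e p h : 0 < h ->
  (forall x, 0 <= x <= h -> derivable f (x *: e + p) e) ->
  exists2 c, 0 <= c <= h & f (h *: e + p) - f p = h * 'D_e f (c *: e + p).
Proof.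
move=> h0 df.
have [] := @MVT R (fun x => f (x *: e + p)) (fun x => 'D_e f (x *: e + p)) 0 h h0.
- move=> x; rewrite in_itv/= => /andP[x0 xh].
  by apply: is_derive_line; apply: df; rewrite !ltW.
- apply: continuous_in_subspaceT => x; rewrite inE/= in_itv/= => xh.
  by apply: line_continuous; exact: df.
move=> c; rewrite in_itv/= => /andP[c0 ch]; rewrite scale0r add0r subr0 => ->.
by exists c; rewrite ?(ltW c0) ?(ltW ch)// mulrC.
Qed.

(** The conditions on [x] say that it lies between 0 and [t], whatever the sign of [t]. *)
Lemma line_bound f e p t A :
  (forall x, `|x| <= `|t| -> 0 <= x * t -> derivable f (x *: e + p) e /\ `|'D_e f (x *: e + p)| <= A) ->
  `|f (t *: e + p) - f p| <= A * `|t|.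
Proof.
move=> H; have [->|t0] := eqVneq t 0.
  by rewrite scale0r add0r subrr normr0 mulr0.
pose F x := f (x *: e + p).
have dF x : `|x| <= `|t| -> 0 <= x * t -> is_derive x 1 F ('D_e f (x *: e + p)).
  by move=> xt /(H _ xt)[/is_derive_line].
have cF x : `|x| <= `|t| -> 0 <= x * t -> {for x, continuous F}.
  by move=> xt /(H _ xt)[/line_continuous].
have [tgt0|tlt0] := ltP 0 t.
- have [] := @MVT R F (fun x => 'D_e f (x *: e + p)) 0 t tgt0.
  + move=> x; rewrite in_itv/= => /andP[x0 xt]; apply: dF.
      by rewrite !gtr0_norm// ltW.
    by rewrite mulr_ge0// ltW.
  + apply: continuous_in_subspaceT => x; rewrite inE/= in_itv/= => /andP[x0 xt].
    by apply: cF; rewrite ?mulr_ge0 ?(ltW tgt0)// !ger0_norm// ltW.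
  move=> c; rewrite in_itv/= => /andP[c0 ct].
  rewrite /F scale0r add0r subr0 => ->; rewrite normrM ler_wpM2r//.
  by case: (H c) => //; rewrite ?mulr_ge0 ?(ltW tgt0) ?(ltW c0)// !gtr0_norm// ltW.
- have {}tlt0 : t < 0 by rewrite lt_neqAle t0.
  have [] := @MVT R F (fun x => 'D_e f (x *: e + p)) t 0 tlt0.
  + move=> x; rewrite in_itv/= => /andP[x0 xt]; apply: dF.
      by rewrite !ltr0_norm// lerN2 ltW.
    by rewrite mulr_le0// ltW.
  + apply: continuous_in_subspaceT => x; rewrite inE/= in_itv/= => /andP[x0 xt].
    by apply: cF; rewrite ?mulr_le0 ?(ltW tlt0)// (ltr0_norm tlt0) ler0_norm// lerN2.
  move=> c; rewrite in_itv/= => /andP[c0 ct].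
  rewrite /F scale0r add0r sub0r distrC => ->; rewrite normrM normrN ler_wpM2r//.
  by case: (H c) => //; rewrite ?mulr_le0 ?(ltW tlt0) ?(ltW ct)// !ltr0_norm// lerN2 ltW.
Qed.

(** The mean value theorem is used twice: along [e] for the increment of [f] over [h *: e'], then
    along [e'] for ['D_e f]. *)
Lemma second_difference f e e' p h : 0 < h ->
  (forall x y, 0 <= x <= h -> 0 <= y <= h ->
     derivable f (x *: e + (y *: e' + p)) e /\
     derivable ('D_e f) (y *: e' + (x *: e + p)) e') ->
  exists c d, [/\ 0 <= c <= h, 0 <= d <= h &
    f (h *: e + (h *: e' + p)) - f (h *: e' + p) - (f (h *: e + p) - f p) =
    h ^+ 2 * 'D_e' ('D_e f) (d *: e' + (c *: e + p))].
Proof.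
move=> h0 H.
have hh : 0 <= h <= h by rewrite lexx andbT ltW.
have h0h : (0 : R) <= 0 <= h by rewrite lexx/= ltW.
have D (x : R) : 0 <= x <= h -> is_derive x 1
   (fun x => f (x *: e + (h *: e' + p)) - f (x *: e + p))
   ('D_e f (x *: e + (h *: e' + p)) - 'D_e f (x *: e + p)).
  move=> hx; have [H1 _] := H x h hx hh; have [H2 _] := H x 0 hx h0h.
  rewrite scale0r add0r in H2.
  exact: (is_deriveB (is_derive_line H1) (is_derive_line H2)).
have [||] := @MVT R (fun x => f (x *: e + (h *: e' + p)) - f (x *: e + p))
  (fun x => 'D_e f (x *: e + (h *: e' + p)) - 'D_e f (x *: e + p)) 0 h h0.
- by move=> x xh; apply: D; move: xh; rewrite in_itv/= => /andP[x0 xh]; rewrite !ltW.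
- apply: continuous_in_subspaceT => x; rewrite inE/= in_itv/= => /D Dx.
  exact/differentiable_continuous/derivable1_diffP/ex_derive.
move=> c; rewrite in_itv/= => /andP[c0 ch].
rewrite !scale0r !add0r subr0 => E.
have hc : 0 <= c <= h by rewrite !ltW.
have [|d hd Ed] := @line_MVT ('D_e f) e' (c *: e + p) h h0.
  by move=> y hy; case: (H c y hc hy).
exists c, d; split => //.
rewrite expr2 -mulrA -Ed [h *: e' + (c *: e + p)]addrCA mulrC -E.
by move: (f _) (f _) (f _) (f _) => a b c' d'; ring.
Qed.

End lines.

(** * Continuous differentiability and symmetry of mixed partial derivatives *)

Section Cn_on.
Context {R : realType}.
Implicit Types (f g : R * R -> R) (U : set (R * R)).

Lemma Cn_on_continuous (V : normedModType R) n U (f : R * R -> V) u : Cn_on n U f -> U u -> {for u, continuous f}.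
Proof. by case: n => [|n] [H _] Uu; apply: H; rewrite inE. Qed.

Lemma Cn_onW (V : normedModType R) n m U (f : R * R -> V) : (m <= n)%N -> Cn_on n U f -> Cn_on m U f.
Proof.
elim: n m f => [|n IH] [|m] f//= mn [cf H]; split => //.
by case: H => H1 H2 H3; split => //; exact: IH.
Qed.

Lemma Cn_onS (V : normedModType R) n U U' (f : R * R -> V) : U `<=` U' -> Cn_on n U' f -> Cn_on n U f.
Proof.
move=> UU; elim: n f => [|n IH] f /= [cf H]; split.
- by move=> u; rewrite inE => /UU uU; apply: cf; rewrite inE.
- by [].
- by move=> u; rewrite inE => /UU uU; apply: cf; rewrite inE.
by case: H => H1 H2 H3; split; [move=> u /UU /H1|exact: IH|exact: IH].
Qed.

(** The points [q] and [q'] are allowed to differ because each application of the mean value theorem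
    produces its own intermediate point. *)
Lemma eq_continuous_at f g p : {for p, continuous f} -> {for p, continuous g} ->
  (forall d : R, 0 < d -> exists q q', [/\ ball p d q, ball p d q' & f q = g q']) ->
  f p = g p.
Proof.
move=> cf cg H; apply: contrapT => /eqP; rewrite -subr_eq0 -normr_gt0 => d0.
pose eps := `|f p - g p| / 2.
have eps0 : 0 < eps by rewrite divr_gt0.
have /cvgrPdist_lt/(_ _ eps0) n1 := cf; have /cvgrPdist_lt/(_ _ eps0) n2 := cg.
have : nbhs p (fun t => `|f p - f t| < eps /\ `|g p - g t| < eps) by exact: filterI n1 n2.
move=> /nbhs_ballP[d /= dgt0 Hd].
have [q [q' [Bq Bq' E]]] := H d dgt0.
have [B1 _] := Hd _ Bq; have [_ B2] := Hd _ Bq'; rewrite /= E in B1; rewrite /= in B2.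
have := ler_distD (g q') (f p) (g p).
by rewrite leNgt => /negP; apply; rewrite [ltRHS](splitr) ltrD// distrC.
Qed.

(** The second difference over a small square is symmetric in the two directions, and equals its
    area times either mixed derivative at some point of the square. It is needed because [partial]
    fixes one order of differentiation. *)
Lemma clairaut U f p : open U -> Cn_on 2 U f -> U p -> Du (Dv f) p = Dv (Du f) p.
Proof.
move=> oU Cf Up; have [_ [df [_ [ddu cuu cvu] ] [_ [ddv cuv cvv] ] ] ] := Cf.
have /nbhs_ballP[d0 /= d0gt0 Hd0] : nbhs p U by exact: open_nbhs_nbhs.
apply: eq_continuous_at.
- by case: cuv => H _; apply: H; rewrite inE.
- by case: cvu => H _; apply: H; rewrite inE.
move=> d1 d1gt0; pose d := Num.min d0 d1.
have dgt0 : 0 < d by rewrite lt_min d0gt0.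
have dd0 : ball p d `<=` ball p d0 by apply: le_ball; rewrite ge_min lexx.
have dd1 : ball p d `<=` ball p d1 by apply: le_ball; rewrite ge_min lexx orbT.
have h0 : 0 < d / 2 by rewrite divr_gt0.
have Hball x y : 0 <= x <= d / 2 -> 0 <= y <= d / 2 -> ball p d (x *: ((1, 0) : R * R) + (y *: ((0, 1) : R * R) + p)).
  move=> /andP[x0 xd] /andP[y0 yd]; rewrite -ball_normE /= norm_pairE /=.
  rewrite /GRing.scale /= !mulr0 !mulr1 !add0r.
  have K (z q : R) : 0 <= z -> `|q - (z + q)| = z.
    by move=> z0; rewrite opprD addrCA subrr addr0 normrN ger0_norm.
  rewrite gt_max !K//.
  by rewrite (le_lt_trans xd) ?(le_lt_trans yd)// ltr_pdivrMr// ltr_pMr// ltr1n.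
have HU x y : 0 <= x <= d / 2 -> 0 <= y <= d / 2 -> U (x *: ((1, 0) : R * R) + (y *: ((0, 1) : R * R) + p)).
  by move=> hx hy; apply/Hd0/dd0/Hball.
have [|c [d' [hc hd' E1]]] := @second_difference R f (1, 0) (0, 1) p _ h0.
  move=> x y hx hy; have Uq := HU x y hx hy; split; first exact: (proj1 (df _ Uq)).
  by rewrite addrCA; exact: (proj2 (ddu _ Uq)).
have [|c2 [d2 [hc2 hd2 E2]]] := @second_difference R f (0, 1) (1, 0) p _ h0.
  move=> x y hx hy; have Uq := HU y x hy hx; split; last exact: (proj1 (ddv _ Uq)).
  by rewrite addrCA; exact: (proj2 (df _ Uq)).
exists (d2 *: ((1, 0) : R * R) + (c2 *: ((0, 1) : R * R) + p)).
exists (d' *: ((0, 1) : R * R) + (c *: ((1, 0) : R * R) + p)).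
split; first exact/dd1/Hball.
  by rewrite addrCA; exact/dd1/Hball.
apply: (mulfI (_ : (d / 2) ^+ 2 != 0)); first by rewrite sqrf_eq0 gt_eqF.
rewrite -[LHS]E2 -[RHS]E1.
rewrite (_ : (d / 2) *: (1, 0) + ((d / 2) *: (0, 1) + p) = (d / 2) *: (0, 1) + ((d / 2) *: (1, 0) + p)); last exact: addrCA.
by move: (f _) (f _) (f _) (f _) => x y z t; ring.
Qed.

Lemma eq_derive_on U f g e : open U -> {in U, f =1 g} -> {in U, 'D_e f =1 'D_e g}.
Proof.
move=> oU fg u; rewrite inE => Uu; apply: near_eq_derive.
by apply: filterS (open_nbhs_nbhs (conj oU Uu)) => v Uv; apply: fg; rewrite inE.
Qed.

Lemma eq_iter_derive_on U f g e n : open U -> {in U, f =1 g} ->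
  {in U, iter n (fun f => 'D_e f) f =1 iter n (fun f => 'D_e f) g}.
Proof. by move=> oU fg; elim: n => //= n IH; exact: eq_derive_on. Qed.

Lemma Dv_iter_Du U f n : open U -> Cn_on n.+1 U f ->
  {in U, iter n (@Dv R R) (Du f) =1 Du (iter n (@Dv R R) f)}.
Proof.
move=> oU; elim: n f => [|n IH] f Cf u Uu //.
have CDv : Cn_on n.+1 U (Dv f) by case: Cf => _ [].
rewrite !iterSr; transitivity (iter n (@Dv R R) (Du (Dv f)) u); last exact: IH.
apply: (@eq_iter_derive_on U (Dv (Du f)) (Du (Dv f)) (0, 1) n oU _ u Uu).
clear u Uu => u Uu'.
apply/esym; apply: (clairaut oU _ (set_mem Uu')).
exact: Cn_onW Cf.
Qed.

Lemma partial_Du U f i j : open U -> Cn_on j.+1 U f ->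
  {in U, partial i j (Du f) =1 partial i.+1 j f}.
Proof.
move=> oU Cf u Uu; rewrite /partial iterSr.
exact: (@eq_iter_derive_on U _ _ (1, 0) i oU (Dv_iter_Du oU Cf) u Uu).
Qed.

End Cn_on.

Section taylor.
Context {R : realType}.
Implicit Types (f g : R * R -> R) (U : set (R * R)).
Local Notation e1 := ((1, 0) : R * R).
Local Notation e2 := ((0, 1) : R * R).

Lemma norm_pair0 (x : R) : `|(x, 0) : R * R| = `|x|.
Proof. by rewrite norm_pairE /= normr0; apply: max_l. Qed.

Lemma shift_e1 (x : R) (p : R * R) : x *: e1 + p = (x + p.1, p.2).
Proof. by apply/pair_eqP; rewrite /= -[x *: 1]/(x * 1) -[x *: 0]/(x * 0) mulr1 mulr0 add0r !eqxx. Qed.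

Lemma shift_e2 (x : R) (p : R * R) : x *: e2 + p = (p.1, x + p.2).
Proof. by apply/pair_eqP; rewrite /= -[x *: 1]/(x * 1) -[x *: 0]/(x * 0) mulr1 mulr0 add0r !eqxx. Qed.

Lemma is_derive_fst (u e : R * R) : is_derive u e (fst : R * R -> R) e.1.
Proof.
have H (x : R) : derivable (fst : R * R -> R) u e /\ 'D_e (fst : R * R -> R) u = e.1.
  have C : (fun h : R => h^-1 *: (fst (h *: e + u) - fst u)) @ 0^' --> e.1.
    apply: (@cvg_trans _ ((fun=> e.1) @ (0 : R)^')); last exact: cvg_cst.
    apply: near_eq_cvg; near=> h.
    have h0 : h != 0 by near: h; exact: nbhs_dnbhs_neq.
    by rewrite /= addrK scalerA mulVf// scale1r.
  by split; [apply/cvg_ex; exists e.1 | apply: cvg_lim C].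
by case: (H 0) => H1 H2; split.
Unshelve. all: by end_near. Qed.

Lemma is_derive_snd (u e : R * R) : is_derive u e (snd : R * R -> R) e.2.
Proof.
have H (x : R) : derivable (snd : R * R -> R) u e /\ 'D_e (snd : R * R -> R) u = e.2.
  have C : (fun h : R => h^-1 *: (snd (h *: e + u) - snd u)) @ 0^' --> e.2.
    apply: (@cvg_trans _ ((fun=> e.2) @ (0 : R)^')); last exact: cvg_cst.
    apply: near_eq_cvg; near=> h.
    have h0 : h != 0 by near: h; exact: nbhs_dnbhs_neq.
    by rewrite /= addrK scalerA mulVf// scale1r.
  by split; [apply/cvg_ex; exists e.2 | apply: cvg_lim C].
by case: (H 0) => H1 H2; split.
Unshelve. all: by end_near. Qed.

Lemma is_derive_monomial (c : R) i j (u e : R * R) :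
  is_derive u e (fun u : R * R => c * u.1 ^+ i * u.2 ^+ j)
    (c * (u.1 ^+ i * (j%:R * u.2 ^+ j.-1 * e.2) + u.2 ^+ j * (i%:R * u.1 ^+ i.-1 * e.1))).
Proof.
have H1 := is_deriveX i (is_derive_fst u e).
have H2 := is_deriveX j (is_derive_snd u e).
have H := is_deriveZ c (is_deriveM H1 H2).
have -> : (fun u : R * R => c * u.1 ^+ i * u.2 ^+ j) =
    (c \*: ((fst : R * R -> R) ^+ i * (snd : R * R -> R) ^+ j)).
  by rewrite !exprfctE; apply/funext => v; rewrite /= -mulrA.
by apply: (is_derive_eq H); rewrite /GRing.scale/= !exprfctE.
Qed.

Definition taylor_poly (f : R * R -> R) (s : nat) : R * R -> R :=
  fun u => \sum_(k < s) taylor_term f k u.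

Lemma is_derive_taylor_term f k (u e : R * R) :
  is_derive u e (taylor_term f k)
  (\sum_(i < k.+1) partial i (k - i) f (0, 0) / (i`! * (k - i)`!)%:R *
     (u.1 ^+ i * ((k - i)%:R * u.2 ^+ (k - i).-1 * e.2)
      + u.2 ^+ (k - i) * (i%:R * u.1 ^+ i.-1 * e.1))).
Proof.
have -> : taylor_term f k = \sum_(i < k.+1) (fun u : R * R =>
   partial i (k - i) f (0, 0) / (i`! * (k - i)`!)%:R * u.1 ^+ i * u.2 ^+ (k - i)).
  by apply/funext => v; rewrite /taylor_term fct_sumE.
by apply: is_derive_sum => i; exact: is_derive_monomial.
Qed.

(** In [partial] the derivatives [Dv] act first, so [Du f] enters at the wrong end and has to be
    commuted outwards by [clairaut]. For [Dv] unfolding the iteration is enough. *)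
Lemma Du_taylor_term U f k u : open U -> Cn_on k.+1 U f -> U 0 ->
  is_derive u e1 (taylor_term f k.+1) (taylor_term (Du f) k u).
Proof.
move=> oU Cf U0; apply: (is_derive_eq (is_derive_taylor_term f k.+1 u e1)).
rewrite big_ord_recl [X in X + _](_ : _ = 0); last by rewrite /= !mul0r !mulr0 addr0 mulr0.
rewrite add0r.
apply: eq_bigr => i _; rewrite lift0 subSS /= !mulr0 add0r mulr1.
have EP : partial i (k - i) (Du f) (0, 0) = Du (partial i (k - i) f) (0, 0).
  apply: (partial_Du i oU _ (mem_set U0)).
  by apply: Cn_onW Cf; rewrite ltnS leq_subr.
rewrite /taylor_term EP.
rewrite factS -mulnA natrM invfM.
have i0 : (i.+1%:R : R) != 0 by rewrite pnatr_eq0.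
move: i0; move: (_.+1%:R : R) ((i`! * (k - i)`!)%:R^-1) (u.1 ^+ i) (u.2 ^+ (k - i)) => z x y t z0.
by move: (Du _ _) => p; field.
Qed.

Lemma Dv_taylor_term f k u :
  is_derive u e2 (taylor_term f k.+1) (taylor_term (Dv f) k u).
Proof.
apply: (is_derive_eq (is_derive_taylor_term f k.+1 u e2)).
rewrite big_ord_recr /= subnn !mul0r !mulr0 !addr0 mulr0 addr0.
apply: eq_bigr => i _; rewrite subSn ?leq_ord//= !mulr0 addr0 mulr1.
have -> : partial i (k - i).+1 f = partial i (k - i) (Dv f) by rewrite /partial iterSr.
rewrite factS mulnCA natrM invfM.
have i0 : ((k - i).+1%:R : R) != 0 by rewrite pnatr_eq0.
move: i0; move: (_.+1%:R : R) ((i`! * (k - i)`!)%:R^-1) (u.1 ^+ i) (u.2 ^+ (k - i)) => z x y t z0.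
by move: (partial _ _ _ _) => p; field.
Qed.

Lemma D_taylor_term0 f u e : is_derive u e (taylor_term f 0) 0.
Proof.
by apply: (is_derive_eq (is_derive_taylor_term f 0 u e)); rewrite big_ord1 !mul0r !mulr0 addr0 mulr0.
Qed.

Lemma taylor_polyE f s : taylor_poly f s = \sum_(k < s) taylor_term f k.
Proof. by apply/funext => v; rewrite fct_sumE. Qed.

Lemma D_taylor_poly U f s u e : e = e1 \/ e = e2 -> open U -> Cn_on s U f -> U 0 ->
  is_derive u e (taylor_poly f s.+1) (taylor_poly ('D_e f) s u).
Proof.
move=> he oU Cf U0; rewrite taylor_polyE.
have H (k : 'I_s.+1) : is_derive u e (taylor_term f k)
    (if (k : nat) is k'.+1 then taylor_term ('D_e f) k' u else 0).
  case: k => -[|k] /= ks; first exact: D_taylor_term0.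
  case: he => ->; last exact: Dv_taylor_term.
  by apply: (Du_taylor_term _ oU) => //; apply: Cn_onW Cf.
apply: (is_derive_eq (is_derive_sum H)).
by rewrite big_ord_recl /= add0r.
Qed.

Lemma compact_square (a : R) : compact (square a).
Proof.
have -> : square a = `[- a, a]%classic `*` `[- a, a]%classic.
  apply/seteqP; split => -[x y]; rewrite /square /= norm_pairE /= ge_max !in_itv /= !ler_norml.
    by move=> /andP[-> ->].
  by move=> [-> ->].
by apply: compact_setX; exact: segment_compact.
Qed.

Lemma square_bounded (a : R) U f : 0 < a -> square a `<=` U -> Cn_on 0 U f ->
  exists A, forall u, square a u -> `|f u| <= A.
Proof.
move=> a0 aU [cf _].
have s0 : square a !=set0 by exists 0; rewrite /square/= normr0 ltW.
have [|c _ Hc] := @compact_EVT_max _ R (fun u => `|f u|) _ s0 (@compact_square a).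
  apply: continuous_in_subspaceT => u; rewrite inE => su.
  apply: continuous_comp; last exact: norm_continuous.
  by apply: cf; rewrite inE; exact: aU.
by exists `|f c| => u su; apply: Hc; rewrite inE.
Qed.

Lemma taylor_term_at0 f k : taylor_term f k (0, 0) = if k is 0%N then f (0, 0) else 0.
Proof.
case: k => [|k]; rewrite /taylor_term.
  by rewrite big_ord1 /= !expr0 !mulr1 divr1.
rewrite big1// => -[i ik] _ /=; rewrite !expr0n.
by case: i ik => [|i] ik; rewrite ?mulr0 ?mul0r// subn0/= mulr0.
Qed.

(** The partial derivatives of the remainder of [f] are the remainders, one degree lower, of the
    partial derivatives of [f]. Their bounds are integrated from the origin along the path through
    [(x, 0)] to [(x, y)], which stays in the square. *)
Lemma taylor_bound (a : R) U s f : 0 < a -> open U -> square a `<=` U -> Cn_on s U f ->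
  exists A, forall u, square a u -> `|f u - taylor_poly f s u| <= A * `|u| ^+ s.
Proof.
move=> a0 oU aU; elim: s f => [|s IH] f Cf.
  have [A HA] := square_bounded a0 aU Cf; exists A => u su.
  by rewrite /taylor_poly big_ord0 subr0 mulr1; exact: HA.
have [_ [df Cu Cv]] := Cf.
have U0 : U 0 by apply: aU; rewrite /square/= normr0 ltW.
have Cs : Cn_on s U f by apply: Cn_onW Cf.
pose g := f - taylor_poly f s.+1.
have dg u e : e = e1 \/ e = e2 -> U u ->
    is_derive u e g ('D_e f u - taylor_poly ('D_e f) s u).
  move=> he Uu; apply: is_deriveB; last exact: D_taylor_poly Cs U0.
  apply: derivableP; case: he => ->; [exact: (proj1 (df u Uu))|exact: (proj2 (df u Uu))].
have [A1 HA1] := IH _ Cu; have [A2 HA2] := IH _ Cv.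
have g0 : g (0, 0) = 0.
  rewrite /g /taylor_poly !fctE big_ord_recl big1 ?addr0 ?taylor_term_at0 ?subrr//.
  by move=> i _; rewrite taylor_term_at0.
have sa : square a (a, 0).
  by rewrite /square /= norm_pair0 gtr0_norm.
have na : 0 < `|(a, 0) : R * R|.
  by rewrite norm_pair0 gtr0_norm.
have posA (A : R) (B : R * R -> R) : (forall u, square a u -> `|B u| <= A * `|u| ^+ s) -> 0 <= A.
  move=> H; have := le_trans (normr_ge0 _) (H _ sa).
  by rewrite pmulr_lge0// exprn_gt0.
have A10 := posA _ _ HA1; have A20 := posA _ _ HA2.
exists (A1 + A2) => -[x y] su.
have [xu yu] : `|x| <= `|(x, y)| /\ `|y| <= `|(x, y)|.
  by rewrite norm_pairE /= !le_max !lexx orbT.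
have L1 : `|g (x *: e1 + 0) - g 0| <= A1 * `|(x, y)| ^+ s * `|x|.
  apply: line_bound => z zx _.
  have nz : `|z *: e1 + (0 : R * R)| <= `|(x, y)|.
    by rewrite shift_e1 /= addr0 norm_pair0 (le_trans zx).
  have sz : square a (z *: e1 + 0) by apply: le_trans nz su.
  have D := dg _ e1 (or_introl erefl) (aU _ sz).
  split; first exact: ex_derive.
  by rewrite derive_val (le_trans (HA1 _ sz))// ler_wpM2l// lerXn2r// nnegrE.
have L2 : `|g (y *: e2 + (x, 0)) - g (x, 0)| <= A2 * `|(x, y)| ^+ s * `|y|.
  apply: line_bound => z zy _.
  have nz : `|z *: e2 + ((x, 0) : R * R)| <= `|(x, y)|.
    rewrite shift_e2 /= addr0 norm_pairE /= ge_max xu.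
    exact: le_trans zy yu.
  have sz : square a (z *: e2 + (x, 0)) by apply: le_trans nz su.
  have D := dg _ e2 (or_intror erefl) (aU _ sz).
  split; first exact: ex_derive.
  by rewrite derive_val (le_trans (HA2 _ sz))// ler_wpM2l// lerXn2r// nnegrE.
have E1 : x *: e1 + 0 = (x, 0) by rewrite shift_e1 /= addr0.
have E2 : y *: e2 + (x, 0) = (x, y) by rewrite shift_e2 /= addr0.
rewrite E1 in L1; rewrite E2 in L2.
rewrite -[_ - _]/(g (x, y)) (_ : g (x, y) = (g (x, y) - g (x, 0)) + (g (x, 0) - g 0)); last first.
  by rewrite [g 0]g0 subr0 subrK.
rewrite (le_trans (ler_normD _ _))// mulrDl [leRHS]addrC lerD//.
  by rewrite (le_trans L2)// exprSr mulrA ler_wpM2l// mulr_ge0// exprn_ge0.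
by rewrite (le_trans L1)// exprSr mulrA ler_wpM2l// mulr_ge0// exprn_ge0.
Qed.

(** Differentiating a Taylor remainder gives the remainder of the derivative, of order one less,
    which is exactly the loss a symbol may have. *)
Lemma symb_taylor (a : R) U e M n s f : e = e1 \/ e = e2 -> 0 < a -> open U -> square a `<=` U ->
  (M <= n)%N -> (s <= n)%N -> Cn_on n U f ->
  symb (square a) U e M s%:Z (f - taylor_poly f s).
Proof.
move=> he a0 oU aU.
have U0 : U 0 by apply: aU; rewrite /square/= normr0 ltW.
have B0 n' s' f' : (s' <= n')%N -> Cn_on n' U f' ->
   exists A : R, forall u, square a u -> u != 0 -> `|(f' - taylor_poly f' s') u| <= A * `|u| ^ s'%:Z.
  move=> sn Cf; have [A HA] := taylor_bound a0 oU aU (Cn_onW sn Cf).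
  by exists A => u su _; exact: HA.
elim: M n s f => [|M IH] n s f Mn sn Cf /=; split.
- exact: B0 sn Cf.
- by [].
- exact: B0 sn Cf.
case: n Mn sn Cf => // n Mn sn Cf; have [_ [df Cu Cv]] := Cf.
have De : Cn_on n U ('D_e f) by case: he => ->; [exact: Cu|exact: Cv].
have dfe u : U u -> derivable f u e.
  by move=> Uu; case: he => ->; [exact: (proj1 (df u Uu))|exact: (proj2 (df u Uu))].
(* For [s = 0] the remainder is [f] itself and its derivative still has order 0; on the bounded
   square this is weakened to order -1. *)
case: s sn => [|s] sn.
  have T0 f' : taylor_poly f' 0 = cst 0 by apply/funext => u; rewrite /taylor_poly big_ord0.
  have E f' : f' - taylor_poly f' 0 = f' by apply/funext => u; rewrite T0 !fctE subr0.
  split; first by rewrite E => u Vu _; exact: dfe.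
  have := IH n 0%N _ Mn isT De; rewrite !E; apply: symb_le => //; exact: (fun u (su : square a u) => su).
have dg u : U u -> is_derive u e (f - taylor_poly f s.+1) ('D_e f u - taylor_poly ('D_e f) s u).
  move=> Uu; apply: is_deriveB; last first.
    by apply: D_taylor_poly U0 => //; apply: Cn_onW Cf; exact: ltnW.
  by apply: derivableP; exact: dfe.
split; first by move=> u Vu _; have := dg u Vu => ?; exact: ex_derive.
have -> : s.+1%:Z - 1 = s%:Z by rewrite -addn1 PoszD addrK.
apply: symb_ext (IH n s _ Mn sn De) => // u Uu _.
by have := dg u Uu => ?; rewrite derive_val.
Qed.

End taylor.

(** * Composition and cutoff of symbols *)

Section composition.
Context {R : realType}.
Implicit Types (f g : R * R -> R).

(** A directional derivative is the derivative at 0 of the restriction to a line; this brings in the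
    one-variable chain rule. *)
Lemma is_derive_along_line f (e u : R * R) (d : R) :
  is_derive (0 : R) 1 (fun h : R => f (h *: e + u)) d -> is_derive u e f d.
Proof.
have E : (fun h : R => h^-1 *: (f ((h *: (1 : R) + 0) *: e + u) - f ((0 : R) *: e + u))) =
    (fun h => h^-1 *: (f (h *: e + u) - f u)).
  by apply/funext => h; rewrite -[h *: 1]/(h * 1) mulr1 addr0 scale0r add0r.
by case; rewrite /derivable /derive /= E => H1 H2; split.
Qed.

Lemma is_derive_comp1 (F : R -> R) f (u e : R * R) (dF : R) :
  is_derive (f u) 1 F dF -> derivable f u e ->
  is_derive u e (fun v => F (f v)) (dF * 'D_e f u).
Proof.
move=> HF df; apply: is_derive_along_line.
have df0 : derivable f (0 *: e + u) e by rewrite scale0r add0r.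
have Hl := is_derive_line df0.
have HF' : is_derive (f (0 *: e + u)) 1 F dF by rewrite scale0r add0r.
rewrite -[in 'D_e f u](add0r u) -(scale0r e).
split.
  apply/derivable1_diffP; apply: (@differentiable_comp _ _ _ _ (fun h : R => f (h *: e + u)) F).
    by apply/derivable1_diffP; exact: ex_derive.
  by apply/derivable1_diffP; exact: ex_derive.
rewrite -derive1E (@derive1_comp R (fun h : R => f (h *: e + u)) F); [|exact: ex_derive|exact: ex_derive].
by rewrite !derive1E !derive_val.
Qed.

Lemma is_derive_powR_comp f (u e : R * R) (p : R) : 0 < f u -> derivable f u e ->
  is_derive u e (fun v => f v `^ p) (p * f u `^ (p - 1) * 'D_e f u).
Proof. by move=> fu df; exact: (is_derive_comp1 (is_derive1_powR p fu) df). Qed.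

End composition.

(** * The remainder of the binomial series *)

Section binomial_series.
Context {R : realType}.
Implicit Types (p x : R) (N : nat).

Lemma gbinomS p m : gbinom p m.+1 * m.+1%:R = p * gbinom (p - 1) m.
Proof.
rewrite /gbinom big_ord_recl /= subr0 factS natrM invfM.
have m0 : (m.+1%:R : R) != 0 by rewrite pnatr_eq0.
have -> : \prod_(i < m) (p - (lift ord0 i)%:R) = \prod_(i < m) (p - 1 - i%:R).
  by apply: eq_bigr => i _; rewrite lift0 -natr1; ring.
by move: m0; move: (_.+1%:R : R) (_^-1 : R) (\prod_(_ < _) _) => z x y z0; field.
Qed.

Lemma gbinom0 p : gbinom p 0 = 1.
Proof. by rewrite /gbinom big_ord0 divr1. Qed.

Definition binom_rem p N x := (1 + x) `^ p - \sum_(m < N) gbinom p m * x ^+ m.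

(** The absorption identity [gbinomS] makes the family of remainders closed under differentiation.
    For [N = 0] the truncated predecessor is right too, since nothing has been subtracted. *)
Lemma is_derive_binom_rem p N x : 0 < 1 + x ->
  is_derive x 1 (binom_rem p N) (p * binom_rem (p - 1) N.-1 x).
Proof.
move=> x0.
have D1 : is_derive x 1 (fun y : R => (1 + y) `^ p) (p * (1 + x) `^ (p - 1)).
  have Ds : is_derive x 1 (fun y : R => 1 + y) 1.
    have := is_deriveD (is_derive_cst (1 : R) x (1 : R)) (is_derive_id x (1 : R)).
    by rewrite add0r.
  split.
    apply/derivable1_diffP; apply: (@differentiable_comp _ _ _ _ (fun y : R => 1 + y) (fun y => y `^ p)).
      by apply/derivable1_diffP; exact: ex_derive.
    by apply/derivable1_diffP; apply: ex_derive; exact: is_derive1_powR.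
  rewrite -derive1E (@derive1_comp R (fun y : R => 1 + y) (fun y => y `^ p)).
  - rewrite !derive1E (@derive_val _ _ _ _ _ _ _ Ds) mulr1.
    by rewrite (@derive_val _ _ _ _ _ _ _ (is_derive1_powR p x0)).
  - exact: ex_derive.
  - by apply: ex_derive; exact: is_derive1_powR.
have D2 : is_derive x 1 (\sum_(m < N) (gbinom p m \*: (id ^+ m : R -> R)))
    (\sum_(m < N) gbinom p m *: ((m%:R * x ^+ m.-1) *: (1 : R))).
  by apply: is_derive_sum => i; apply: is_deriveZ; exact: (@is_deriveX _ _ id _ _ _ _ (is_derive_id _ _)).
have -> : binom_rem p N = (fun y : R => (1 + y) `^ p) - \sum_(m < N) (gbinom p m \*: (id ^+ m : R -> R)).
  apply/funext => y; rewrite /binom_rem !fctE fct_sumE; congr (_ - _).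
  by apply: eq_bigr => i _; rewrite exprfctE.
apply: (is_derive_eq (is_deriveB D1 D2)); rewrite /binom_rem mulrBr; congr (_ - _).
case: N {D2} => [|N] /=; first by rewrite !big_ord0 mulr0.
rewrite big_ord_recl [X in X + _](_ : _ = 0); last by rewrite /= mul0r scale0r scaler0.
rewrite add0r mulr_sumr; apply: eq_bigr => i _.
rewrite lift0 /=; transitivity (gbinom p i.+1 * i.+1%:R * x ^+ i); last by rewrite gbinomS -mulrA.
by rewrite -mulrA -[LHS]/(gbinom p i.+1 * (i.+1%:R * x ^+ i * 1)) mulr1.
Qed.

Lemma binom_rem0 p N : binom_rem p N.+1 0 = 0.
Proof.
rewrite /binom_rem addr0 powR1 big_ord_recl gbinom0 expr0 mulr1 big1 ?addr0 ?subrr//.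
by move=> i _; rewrite lift0 expr0n mulr0.
Qed.

(** Each derivative lowers [N] and shifts [p], so the induction keeps [p] general. As [c <= 1 <= C],
    the segment from 0 to [x] stays in the admissible range. *)
Lemma binom_rem_bound p N (c C : R) : 0 < c -> c <= 1 -> 1 <= C ->
  exists A, forall x, c <= 1 + x <= C -> `|binom_rem p N x| <= A * `|x| ^+ N.
Proof.
move=> c0 c1 C1; elim: N p => [|N IH] p.
  (* The sum covers both signs of [p]: the power is largest at [C] when [p >= 0] and at [c] when
     [p < 0]. *)
  exists (c `^ p + C `^ p) => x /andP[cx xC]; rewrite /binom_rem big_ord0 subr0 expr0 mulr1.
  have x0 : 0 < 1 + x by apply: lt_le_trans cx.
  rewrite ger0_norm ?powR_ge0//.
  have [p0|p0] := leP 0 p.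
    rewrite (@le_trans _ _ (C `^ p))// ?lerDr ?powR_ge0//.
    by apply: ge0_ler_powR; rewrite ?nnegrE// ?(ltW x0)// (le_trans _ C1).
  rewrite (@le_trans _ _ (c `^ p))// ?lerDl ?powR_ge0//.
  rewrite -(opprK p) !(powRN _ (- p)) lef_pV2 ?posrE ?powR_gt0//.
  by apply: ge0_ler_powR; rewrite ?nnegrE ?oppr_ge0 ?(ltW p0) ?(ltW x0) ?(ltW c0).
have [A HA] := IH (p - 1).
exists (`|p| * `|A|) => x /andP[cx xC].
(* The one-variable remainder is viewed as a function of the first coordinate, so that [line_bound]
   applies. *)
have := @line_bound R (fun u => binom_rem p N.+1 u.1) (1, 0) (0, 0) x (`|p| * `|A| * `|x| ^+ N).
rewrite (_ : x *: (1, 0) + (0, 0) = (x, 0) :> R * R); last by rewrite shift_e1 /= addr0.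
rewrite /= binom_rem0 subr0 exprSr mulrA; apply => z zx zx0.
rewrite shift_e1 /= addr0.
have /andP[cz zC] : c <= 1 + z <= C.
  have [x0|x0] := leP 0 x.
    have z0 : 0 <= z.
      move: x0; rewrite le_eqVlt => /orP[/eqP x0|x0]; last by rewrite -(pmulr_lge0 _ x0).
      by move: zx; rewrite -x0 normr0 normr_le0 => /eqP ->.
    by move: zx; rewrite !ger0_norm// => zx; lra.
  have z0 : z <= 0 by rewrite -(nmulr_lge0 _ x0).
  by move: zx; rewrite (ltr0_norm x0) (ler0_norm z0) => zx; lra.
have z0 : 0 < 1 + z by apply: lt_le_trans cz.
have D : is_derive ((z, 0) : R * R) (1, 0) (fun u => binom_rem p N.+1 u.1) (p * binom_rem (p - 1) N z * 1).
  have /= := @is_derive_comp1 R (binom_rem p N.+1) (fst : R * R -> R) (z, 0) (1, 0) _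
    (is_derive_binom_rem p N.+1 z0) (@ex_derive _ _ _ _ _ _ _ (is_derive_fst (z, 0) (1, 0))).
  by rewrite (@derive_val _ _ _ _ _ _ _ (is_derive_fst (z, 0) (1, 0))).
split; first exact: ex_derive.
rewrite (@derive_val _ _ _ _ _ _ _ D) mulr1 normrM -mulrA ler_wpM2l//.
rewrite (le_trans (HA z _)) ?cz//.
rewrite (le_trans (ler_norm _))// normrM normrX normr_id ler_wpM2l//.
by rewrite lerXn2r// nnegrE.
Qed.

End binomial_series.

Section symb_functions.
Context {R : realType} (B V : set (R * R)) (e : R * R).
Hypotheses (Vo : open V) (BV : B `<=` V).
Local Notation S := (symb B V e).
Implicit Types (f g : R * R -> R) (M : nat) (s t : int).

Lemma symb_fst M : S M 1 (fst : R * R -> R).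
Proof.
have Hb : exists A : R, forall u : R * R, B u -> u != 0 -> `|u.1| <= A * `|u| ^ 1%:Z.
  by exists 1 => u _ _; rewrite mul1r expr1z norm_pairE le_max lexx.
case: M => [|M] //=; split => //; split.
  by move=> u _ _; exact: (@ex_derive _ _ _ _ _ _ _ (is_derive_fst u e)).
apply: (@symb_ext _ _ _ _ Vo BV M _ (cst e.1)); last first.
  by rewrite (_ : 1%:Z - 1 = 0) ?subrr//; exact: symb_cst.
by move=> u _ _; rewrite (@derive_val _ _ _ _ _ _ _ (is_derive_fst u e)).
Qed.

Lemma symb_snd M : S M 1 (snd : R * R -> R).
Proof.
have Hb : exists A : R, forall u : R * R, B u -> u != 0 -> `|u.2| <= A * `|u| ^ 1%:Z.
  by exists 1 => u _ _; rewrite mul1r expr1z norm_pairE le_max lexx orbT.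
case: M => [|M] //=; split => //; split.
  by move=> u _ _; exact: (@ex_derive _ _ _ _ _ _ _ (is_derive_snd u e)).
apply: (@symb_ext _ _ _ _ Vo BV M _ (cst e.2)); last first.
  by rewrite (_ : 1%:Z - 1 = 0) ?subrr//; exact: symb_cst.
by move=> u _ _; rewrite (@derive_val _ _ _ _ _ _ _ (is_derive_snd u e)).
Qed.

Lemma symb_monomial M c i j : S M (i + j)%N%:Z (fun u => c * u.1 ^+ i * u.2 ^+ j).
Proof.
have -> : (fun u : R * R => c * u.1 ^+ i * u.2 ^+ j) =
    (c \*o ((fst : R * R -> R) ^+ i * (snd : R * R -> R) ^+ j)).
  by rewrite !exprfctE; apply/funext => v; rewrite /= -mulrA.
apply: symbZ => //; rewrite PoszD -[i%:Z]mul1r -[j%:Z]mul1r.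
by apply: symbM => //; apply: symbX => //; [exact: symb_fst|exact: symb_snd].
Qed.

Lemma symb_taylor_term M f k : S M k%:Z (taylor_term f k).
Proof.
have -> : taylor_term f k = \sum_(i < k.+1) (fun u : R * R =>
   partial i (k - i) f (0, 0) / (i`! * (k - i)`!)%:R * u.1 ^+ i * u.2 ^+ (k - i)).
  by apply/funext => v; rewrite /taylor_term fct_sumE.
apply: symb_sum => // i _; have := symb_monomial M (partial i (k - i) f (0, 0) / (i`! * (k - i)`!)%:R) i (k - i).
by rewrite subnKC// -ltnS.
Qed.

(* With w = g^(-1/2) one has D w = - w^3 (D g) / 2. *)
Lemma symb_invsqrt M g (c : R) : 0 < c ->
  (forall u, V u -> u != 0 -> 0 < g u) ->
  (forall u, B u -> u != 0 -> c * `|u| ^+ 2 <= g u) ->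
  S M 2 g -> S M (-1) (fun u => g u `^ (- 2^-1)).
Proof.
move=> c0 g0 gc.
have Hb : exists A : R, forall u : R * R, B u -> u != 0 -> `|g u `^ (- 2^-1)| <= A * `|u| ^ (-1).
  exists (c `^ (- 2^-1)) => u Bu u0; have gu := gc u Bu u0.
  have nu : 0 < `|u| by rewrite normr_gt0.
  have -> : `|u| ^ (-1) = (`|u| ^+ 2) `^ (- 2^-1).
    rewrite -powR_mulrn// -powRrM mulrN divff ?pnatr_eq0//.
    by rewrite powRN powRr1 // exprN1.
  rewrite -powRM; [|exact: ltW|by rewrite exprn_ge0].
  rewrite ger0_norm ?powR_ge0//.
  rewrite !(powRN _ 2^-1) lef_pV2 ?posrE ?powR_gt0 ?mulr_gt0 ?exprn_gt0 ?g0//; last exact: BV.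
  apply: ge0_ler_powR; rewrite ?nnegrE ?invr_ge0// ?mulr_ge0 ?exprn_ge0 ?(ltW c0)//.
  by rewrite ltW// g0//; exact: BV.
elim: M => [|M IH] //= Sg; split => //.
have [_ [dg Sdg]] := Sg.
have D u : V u -> u != 0 -> is_derive u e (fun u => g u `^ (- 2^-1)) (- 2^-1 * g u `^ (- 2^-1 - 1) * 'D_e g u).
  by move=> Vu u0; apply: is_derive_powR_comp; [exact: g0|exact: dg].
split; first by move=> u Vu u0; exact: (@ex_derive _ _ _ _ _ _ _ (D u Vu u0)).
have Sw : S M (-1) (fun u => g u `^ (- 2^-1)) by apply: IH; exact: symbW (leqnSn M) (Sg : S M.+1 2 g).
have := symbZ Vo BV (- 2^-1) (symbM Vo BV (symbX Vo BV 3 Sw) Sdg).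
rewrite (_ : -1 * 3%:Z + (2 - 1) = -1 - 1)//.
apply: symb_ext => // u Vu u0; rewrite (@derive_val _ _ _ _ _ _ _ (D u Vu u0)) /=.
rewrite -[LHS]/(- 2^-1 * ((((fun u => g u `^ (- 2^-1)) ^+ 3) u) * 'D_e g u)) exprfctE.
rewrite -powR_mulrn ?powR_ge0// -powRrM mulrA; by congr (_ * _ `^ _ * _); field.
Qed.

Lemma symb_binom_rem M N p x (c C : R) : 0 < c -> c <= 1 -> 1 <= C ->
  (exists b, forall u, B u -> `|u| <= b) ->
  (forall u, V u -> u != 0 -> 0 < 1 + x u) ->
  (forall u, B u -> u != 0 -> c <= 1 + x u <= C) ->
  S M 1 x -> S M N%:Z (fun u => binom_rem p N (x u)).
Proof.
move=> c0 c1 C1 [b Bb] Vx Bx; elim: M N p => [|M IH] N p Sx /=.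
all: have [[A0 HA0] Sx'] := Sx.
all: have Hb : exists A : R, forall u : R * R, B u -> u != 0 -> `|binom_rem p N (x u)| <= A * `|u| ^ N%:Z.
1,3: have [A HA] := binom_rem_bound p N c0 c1 C1.
1,2: exists (`|A| * `|A0| ^+ N) => u Bu u0; rewrite (le_trans (HA _ (Bx _ Bu u0)))//.
1,2: rewrite (le_trans (ler_norm _))// normrM normrX normr_id -mulrA ler_wpM2l//.
1,2: rewrite -exprnP -exprMn lerXn2r// ?nnegrE ?mulr_ge0//.
1,2: by rewrite (le_trans (HA0 _ Bu u0))// expr1z ler_wpM2r// ler_norm.
by [].
split=> //; case: Sx' => dx Sdx.
have D u : V u -> u != 0 -> is_derive u e (fun u => binom_rem p N (x u)) (p * binom_rem (p - 1) N.-1 (x u) * 'D_e x u).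
  by move=> Vu u0; apply: is_derive_comp1; [exact/is_derive_binom_rem/Vx|exact: dx].
split; first by move=> u Vu u0; exact: (@ex_derive _ _ _ _ _ _ _ (D u Vu u0)).
have := symbZ Vo BV p (symbM Vo BV (IH N.-1 (p - 1) (symbW (leqnSn M) Sx)) Sdx).
rewrite subrr addr0 => H.
apply: (@symb_ext _ _ _ _ Vo BV M _ (p \*o ((fun u => binom_rem (p - 1) N.-1 (x u)) * 'D_e x))).
  by move=> u Vu u0; rewrite (@derive_val _ _ _ _ _ _ _ (D u Vu u0)) /= -mulrA.
(* For [N = 0] the chain rule gives order 0, which boundedness of [B] weakens to -1. *)
case: N H {Hb D} => [|N] /= H; last by rewrite -addn1 PoszD addrK.
by apply: (symb_le Bb _ H).
Qed.

End symb_functions.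

(** * Extension by zero of functions supported in the square *)

Section support.
Context {R : realType} (a : R) (e : R * R).
Implicit Types (f g eta : R * R -> R) (M : nat) (s t : int).

Lemma open_squareC : open (~` square a).
Proof.
by apply: closed_openC; apply: compact_closed; [exact: norm_hausdorff|exact: compact_square].
Qed.

Lemma near_squareC u : ~ square a u -> \forall v \near u, ~ square a v.
Proof. by move=> nu; exact: (open_nbhs_nbhs (conj open_squareC nu)). Qed.

Lemma scaled_support f h : (forall v, ~ square a v -> f v = 0) -> 0 < h ->
  exists n : nat, forall u : R * R, n%:R < `|u| -> f (h *: u) = 0.
Proof.
move=> f0 h0; exists (Num.bound `|a / h|) => u nu; apply: f0.
rewrite /square /= normrZ gtr0_norm// => H.
have := lt_trans (le_lt_trans (ler_norm _) (archi_boundP (normr_ge0 (a / h)))) nu.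
by rewrite ltr_pdivrMr// mulrC ltNge H.
Qed.

Lemma derive_outside f u : (forall v, ~ square a v -> f v = 0) -> ~ square a u ->
  is_derive u e f 0.
Proof.
move=> f0 nu; apply: (near_eq_is_derive _ (is_derive_cst (0 : R) u e)).
by apply: filterS (near_squareC nu) => v nv; rewrite f0.
Qed.

Lemma symb_extend M s f : (forall v, ~ square a v -> f v = 0) ->
  symb (square a) setT e M s f -> symb setT setT e M s f.
Proof.
elim: M s f => [|M IH] s f f0 /= [[A HA] Hf].
all: have ? : exists A : R, forall u : R * R, True -> u != 0 -> `|f u| <= A * `|u| ^ s.
1,3: exists `|A| => u _ u0; have [su|nsu] := pselect (square a u).
1,3: by rewrite (le_trans (HA u su u0))// ler_wpM2r ?exprz_ge0// ler_norm.
1,2: by rewrite f0// normr0 mulr_ge0// exprz_ge0.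
by split.
split=> //; case: Hf => df Hf; split => //; apply: IH Hf => v nv.
by rewrite (@derive_val _ _ _ _ _ _ _ (derive_outside f0 nv)).
Qed.

(** Outside [U] the values of [g] are arbitrary, but there [eta] kills them: [U] and the complement
    of the closed square form an open cover of the plane, and on the second set the product is
    identically 0. *)
Lemma symbM_support (U : set (R * R)) M s t g eta : open U -> square a `<=` U ->
  (forall v, ~ square a v -> eta v = 0) ->
  symb (square a) U e M s g -> symb setT setT e M t eta ->
  symb setT setT e M (s + t) (g * eta).
Proof.
move=> Uo aU; elim: M s t g eta => [|M IH] s t g eta eta0 /=.
all: move=> SF SG; have [[A HA] Hf] := SF; have [[A' HA'] Hg] := SG.
all: have ? : exists A0 : R, forall u : R * R, True -> u != 0 -> `|(g * eta) u| <= A0 * `|u| ^ (s + t).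
1,3: exists (`|A| * `|A'|) => u _ u0; rewrite expfzDr ?normr_eq0// normrM mulrACA.
1,2: have [su|nsu] := pselect (square a u).
1,3: rewrite ler_pM// ?(le_trans (HA _ su u0))// ?(le_trans (HA' _ Logic.I u0))//.
1,2,3,4: by rewrite ler_wpM2r ?exprz_ge0// ler_norm.
1,2: by rewrite eta0// normr0 mulr0 !mulr_ge0// exprz_ge0.
by [].
have ge0 v : ~ square a v -> (g * eta) v = 0 by move=> nv; rewrite fctE eta0// mulr0.
case: Hf Hg => df Hf [dg Hg].
have D u : u != 0 -> is_derive u e (g * eta) (g u *: 'D_e eta u + eta u *: 'D_e g u).
  move=> u0; have [su|nsu] := pselect (square a u).
    by apply: is_deriveM; apply: derivableP; [apply: df => //; exact: aU|exact: dg].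
  apply: (is_derive_eq (derive_outside ge0 nsu)).
  by rewrite eta0// scale0r addr0 (@derive_val _ _ _ _ _ _ _ (derive_outside eta0 nsu)) scaler0.
split=> //; split; first by move=> u _ u0; exact: (@ex_derive _ _ _ _ _ _ _ (D u u0)).
have deta0 v : ~ square a v -> 'D_e eta v = 0.
  by move=> nv; rewrite (@derive_val _ _ _ _ _ _ _ (derive_outside eta0 nv)).
have H1 := IH _ _ _ _ deta0 (symbW (leqnSn M) SF : symb _ _ _ M _ _) Hg.
have H2 := IH _ _ _ _ eta0 Hf (symbW (leqnSn M) SG : symb _ _ _ M _ _).
rewrite (_ : s - 1 + t = s + t - 1) in H2; last by ring.
rewrite (_ : s + (t - 1) = s + t - 1) in H1; last by ring.
apply: (@symb_ext _ _ _ _ openT (@subsetT _ _) M _ _ _ _ (symbD openT (@subsetT _ _) H1 H2)) => u _ u0.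
rewrite (@derive_val _ _ _ _ _ _ _ (D u u0)) -[LHS]/(g u * 'D_e eta u + 'D_e g u * eta u).
by rewrite -[RHS]/(g u * 'D_e eta u + eta u * 'D_e g u) [eta u * _]mulrC.
Qed.

End support.

(** * Lebesgue measure on the plane *)

Section measurability.
Context {R : realType}.
Local Notation mR2 := (measurableTypeR R * measurableTypeR R)%type.

(** Links the topology of the plane to the product sigma-algebra: an open set is the countable union
    of the rational boxes it contains. *)
Lemma open_measurable_pair (A : set (R * R)) : open A -> measurable (A : set mR2).
Proof.
move=> oA.
pose box (q : (rat * rat) * (rat * rat)) : set (R * R) :=
  `]ratr q.1.1, ratr q.1.2[%classic `*` `]ratr q.2.1, ratr q.2.2[%classic.
pose F q : set mR2 := if `[< box q `<=` A >] then box q else set0.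
have -> : A = \bigcup_q F q.
  apply/seteqP; split => [[x y] Axy|u [q _]]; last by rewrite /F; case: asboolP => // + ?; apply.
  have /nbhs_ballP[d /= d0 dA] : nbhs (x, y) A by exact: open_nbhs_nbhs.
  have lt1 (z : R) : z - d < z by rewrite ltrBlDr ltrDl.
  have lt2 (z : R) : z < z + d by rewrite ltrDl.
  have [p1] := rat_in_itvoo (lt1 x); rewrite in_itv/= => /andP[p1x xp1].
  have [q1] := rat_in_itvoo (lt2 x); rewrite in_itv/= => /andP[xq1 q1x].
  have [p2] := rat_in_itvoo (lt1 y); rewrite in_itv/= => /andP[p2y yp2].
  have [q2] := rat_in_itvoo (lt2 y); rewrite in_itv/= => /andP[yq2 q2y].
  exists ((p1, q1), (p2, q2)) => //; rewrite /F; case: asboolP => [_|[]].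
    by split; rewrite /= in_itv/= ?xp1 ?yp2.
  move=> [x' y'] [/=]; rewrite !in_itv/= => /andP[px xq] /andP[py yq]; apply: dA.
  by split; rewrite /= /ball/= ltr_norml; apply/andP; split; lra.
apply: countable_bigcupT_measurable => // q; rewrite /F; case: asboolP => _ //.
by apply: measurableX; exact: measurable_itv.
Qed.

Lemma measurable_set1_pair (u : R * R) : measurable ([set u] : set mR2).
Proof.
have -> : [set u] = [set u.1] `*` [set u.2].
  by apply/seteqP; split => [_ -> //|[x y] [/= -> ->]]; rewrite -surjective_pairing.
by apply: measurableX; exact: measurable_set1.
Qed.

Lemma measurable_square (a : R) : measurable (square a : set mR2).
Proof.
have -> : square a = `[- a, a]%classic `*` `[- a, a]%classic.
  apply/seteqP; split => -[x y]; rewrite /square /= [`|_|]/(Num.max _ _) /= ge_max !in_itv /= !ler_norml.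
    by move=> /andP[-> ->].
  by move=> [-> ->].
by apply: measurableX; exact: measurable_itv.
Qed.

(** The quotients below are continuous off the origin only; the origin is a measurable singleton, so
    their value there is harmless. *)
Lemma measurable_fun_continuous_off0 (f : R * R -> R) :
  (forall u, u != 0 -> {for u, continuous f}) ->
  measurable_fun [set: mR2] (f : mR2 -> measurableTypeR R).
Proof.
move=> cf; apply: (measurability _ (RGenOInfty.measurableE R)).
move=> _ [_ [x ->] <-]; rewrite setTI.
have -> : f @^-1` `]x, +oo[%classic = (f @^-1` `]x, +oo[%classic `\ 0) `|` (f @^-1` `]x, +oo[%classic `&` [set 0]).
  by rewrite setUC setUIDK.
apply: measurableU; last first.
  have [fx|fx] := pselect ((f @^-1` `]x, +oo[%classic) 0).
    rewrite (_ : _ `&` _ = [set 0]); first exact: measurable_set1_pair.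
    by apply/seteqP; split => [u []//|u ->]; split.
  rewrite (_ : _ `&` _ = set0)//.
  by apply/seteqP; split => [u [+ u0]|//]; rewrite u0.
apply: open_measurable_pair; rewrite openE => u [fu /eqP u0].
have n1 : \forall v \near u, (f @^-1` `]x, +oo[%classic) v.
  apply: (cf u u0); apply: open_nbhs_nbhs; split => //; exact: itv_open.
have n2 : \forall v \near u, v != 0.
  have o : open (~` [set (0 : R * R)]) by apply/closed_openC/accessible_closed_set1/hausdorff_accessible/norm_hausdorff.
  have := open_nbhs_nbhs (conj o (elimN eqP u0 : (~` [set (0 : R * R)]) u)).
  by apply: filterS => v /= /eqP.
by apply: filterS2 n1 n2 => v fv /eqP v0; split.
Qed.

End measurability.

Definition pushforward_measure {d d'} {T1 : measurableType d} {T2 : measurableType d'}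
    {R : realType} (m : {measure set T1 -> \bar R}) (f : T1 -> T2)
    (mf : measurable_fun setT f) : {measure set T2 -> \bar R} :=
  measure_function_pushforward__canonical__measure_function_Measure m mf.

Lemma ge0_integral_mscale_pushforward {d d'} {T1 : measurableType d} {T2 : measurableType d'}
    {R : realType} (m : {measure set T1 -> \bar R}) (f : T1 -> T2)
    (mf : measurable_fun setT f) (k : {nonneg R}) (g : T2 -> \bar R) :
  measurable_fun setT g -> (forall y, 0 <= g y)%E ->
  (\int[mscale k (pushforward_measure m mf)]_y g y = k%:num%:E * \int[m]_x g (f x))%E.
Proof.
move=> mg g0; rewrite ge0_integral_mscale//; congr (_ * _)%E.
exact: (ge0_integral_pushforward mf m measurableT mg (fun y _ => g0 y)).
Qed.

(** * Affine changes of variables *)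

Section affine.
Context {R : realType}.
Local Notation mR2 := (measurableTypeR R * measurableTypeR R)%type.
Local Notation mu := (@lebesgue_measure R).

Lemma measurable_affine (c b : R) : measurable_fun [set: measurableTypeR R] (fun x : measurableTypeR R => c * x + b : measurableTypeR R).
Proof.
apply: continuous_measurable_fun => x; apply: cvgD; last exact: cvg_cst.
by apply: cvgM; [exact: cvg_cst|exact: cvg_id].
Qed.

(** By uniqueness of Lebesgue measure it suffices to compare half-open intervals. For [c < 0] the
    preimage is closed on the other side, which does not change its length. *)
Lemma lebesgue_measure_affine (c b : R) (A : set (measurableTypeR R)) : c != 0 ->
  measurable A -> mu A = (`|c|%:E * mu ((fun x : measurableTypeR R => (c * x + b)%R : measurableTypeR R) @^-1` A))%E.
Proof.
move=> c0 mA.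
pose T (x : measurableTypeR R) : measurableTypeR R := c * x + b.
have mT : measurable_fun setT T by exact: measurable_affine.
pose nu := mscale (NngNum (normr_ge0 c)) (pushforward_measure mu mT).
have := @lebesgue_measure_unique R nu; apply => //.
move=> _ [[x y] _ <-] /=; rewrite /nu /mscale /= /pushforward.
have [xy|yx] := ltP x y; last first.
  by rewrite set_itv_ge ?bnd_simp -?leNgt// preimage_set0 !measure0 mule0.
rewrite lebesgue_measure_itv /= lte_fin xy.
have [cgt0|cle0] := ltP 0 c.
  have -> : T @^-1` `]x, y] = `](x - b) / c, (y - b) / c]%classic.
    apply/seteqP; split => z; rewrite /T /= !in_itv /= ltr_pdivrMr// ler_pdivlMr// ltrBlDr lerBrDr;
    by rewrite [z * c]mulrC.
  rewrite lebesgue_measure_itv /= lte_fin ltr_pM2r ?invr_gt0// ltrD2r xy gtr0_norm//.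
  by rewrite -EFinB -EFinB -EFinM; congr _%:E; field.
have clt0 : c < 0 by rewrite lt_neqAle c0.
have -> : T @^-1` `]x, y] = `[(y - b) / c, (x - b) / c[%classic.
  apply/seteqP; split => z; rewrite /T /= !in_itv /= ltr_ndivlMr// ler_ndivrMr// ltrBlDr lerBrDr;
  by rewrite [z * c]mulrC => /andP[-> ->].
rewrite lebesgue_measure_itv /= lte_fin ltr_nM2r ?invr_lt0// ltrD2r xy ltr0_norm//.
by rewrite -EFinB -EFinB -EFinM; congr _%:E; field.
Qed.

Lemma lebesgue2X (A B : set (measurableTypeR R)) : measurable A -> measurable B ->
  @lebesgue2 R (A `*` B) = (mu A * mu B)%E.
Proof. exact: product_measure1E. Qed.

Definition affine2 (c : R) (b : R * R) (u : mR2) : mR2 := (c * u.1 + b.1, c * u.2 + b.2).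

Lemma measurable_affine2 c b : measurable_fun [set: mR2] (affine2 c b).
Proof.
apply/measurable_fun_pairP; split => /=.
  by apply: (measurableT_comp (measurable_affine c b.1)); exact: measurable_fst.
by apply: (measurableT_comp (measurable_affine c b.2)); exact: measurable_snd.
Qed.

Lemma lebesgue2_affine (c : R) (b : R * R) (A : set mR2) : c != 0 -> measurable A ->
  @lebesgue2 R A = ((c ^+ 2)%:E * @lebesgue2 R (affine2 c b @^-1` A))%E.
Proof.
move=> c0 mA.
have mT := measurable_affine2 c b.
pose nu := mscale (NngNum (sqr_ge0 c)) (pushforward_measure (@lebesgue2 R) mT).
have := @product_measure_unique _ _ _ _ R mu mu nu; apply => //.
move=> X Y mX mY; rewrite -[LHS]/((c ^+ 2)%:E * @lebesgue2 R (affine2 c b @^-1` (X `*` Y)))%E.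
have -> : affine2 c b @^-1` (X `*` Y) = ((fun x => c * x + b.1) @^-1` X) `*` ((fun x => c * x + b.2) @^-1` Y) by [].
have mpre (b0 : R) (Z : set (measurableTypeR R)) : measurable Z -> measurable ((fun x : measurableTypeR R => c * x + b0 : measurableTypeR R) @^-1` Z).
  by move=> mZ; rewrite -[X in measurable X]setTI; exact: measurable_affine.
rewrite lebesgue2X; [|exact: mpre|exact: mpre].
apply/esym/(etrans (f_equal2 mule (lebesgue_measure_affine b.1 c0 mX) (lebesgue_measure_affine b.2 c0 mY))).
by rewrite -real_normK ?num_real// expr2 EFinM; exact: muleACA.
Qed.

Lemma ge0_integral_affine (c : R) (b : R * R) (f : mR2 -> \bar R) : c != 0 ->
  measurable_fun setT f -> (forall u, 0 <= f u)%E ->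
  (\int[@lebesgue2 R]_u f u = (c ^+ 2)%:E * \int[@lebesgue2 R]_u f (affine2 c b u))%E.
Proof.
move=> c0 mf f0.
have mT := measurable_affine2 c b.
pose nu := mscale (NngNum (sqr_ge0 c)) (pushforward_measure (@lebesgue2 R) mT).
rewrite (@eq_measure_integral _ _ _ _ nu); last first.
  by move=> A mA _; exact: lebesgue2_affine.
exact: (ge0_integral_mscale_pushforward (@lebesgue2 R) mT (NngNum (sqr_ge0 c)) mf f0).
Qed.

(** Infinite values are covered because [fine] sends them to 0. Hence [Rintegral_affine] asks for
    measurability and not for integrability. *)
Lemma fine_scaleB (r : R) (x y : \bar R) : 0 < r ->
  fine (r%:E * x - r%:E * y)%E = r * fine (x - y)%E.
Proof.
move=> r0; case: x y => [x| |] [y| |] /=; rewrite ?gt0_muley ?gt0_muleNy ?lte_fin//= ?mulr0//.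
by rewrite mulrBr.
Qed.

Lemma Rintegral_affine (c : R) (b : R * R) (f : mR2 -> R) : c != 0 ->
  measurable_fun setT f ->
  \int[@lebesgue2 R]_u f u = c ^+ 2 * \int[@lebesgue2 R]_u f (affine2 c b u).
Proof.
move=> c0 mf; have mf' : measurable_fun setT (EFin \o f) by exact/measurable_EFinP.
rewrite /Rintegral (integralE _ _ (fun u => (f u)%:E)) (integralE _ _ (fun u => (f (affine2 c b u))%:E)).
rewrite (@ge0_integral_affine c b (fun u => (fun u => (f u)%:E)^\+ u)%E)//; last first.
  exact: measurable_funepos.
rewrite (@ge0_integral_affine c b (fun u => (fun u => (f u)%:E)^\- u)%E)//; last first.
  exact: measurable_funeneg.
have c20 : 0 < c ^+ 2 by rewrite exprn_even_gt0.
rewrite (fine_scaleB _ _ c20).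
congr (_ * fine (_ - _)%E); apply: eq_integral => u _.
  by rewrite !funeposE.
by rewrite !funenegE.
Qed.

End affine.

(** * Integrability of bounded functions and of the singularity [1 / |u|] *)

Section integrability.
Context {R : realType}.
Local Notation mR2 := (measurableTypeR R * measurableTypeR R)%type.
Local Notation mu2 := (@lebesgue2 R).

Lemma lebesgue2_box (x y : R * R) : x.1 <= y.1 -> x.2 <= y.2 ->
  mu2 (`[x.1, y.1[%classic `*` `[x.2, y.2[%classic) = ((y.1 - x.1) * (y.2 - x.2))%:E.
Proof.
move=> h1 h2; rewrite lebesgue2X; [|exact: measurable_itv..].
rewrite !lebesgue_measure_itv /= !lte_fin EFinM; congr (_ * _)%E.
  by move: h1; rewrite le_eqVlt => /predU1P[->|->]; rewrite ?ltxx ?subrr.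
by move: h2; rewrite le_eqVlt => /predU1P[->|->]; rewrite ?ltxx ?subrr.
Qed.

Lemma lebesgue2_square (a : R) : 0 <= a -> mu2 (square a) = ((2 * a) ^+ 2)%:E.
Proof.
move=> a0; have -> : square a = `[- a, a]%classic `*` `[- a, a]%classic.
  apply/seteqP; split => -[x y]; rewrite /square /= [`|_|]/(Num.max _ _) /= ge_max !in_itv /= !ler_norml.
    by move=> /andP[-> ->].
  by move=> [-> ->].
rewrite lebesgue2X; [|exact: measurable_itv..].
rewrite !lebesgue_measure_itv /= !lte_fin.
have [aa|aa] := ltP (- a) a; first by rewrite -EFinB -EFinM; congr _%:E; ring.
have -> : a = 0 by lra.
by rewrite mulr0 expr0n mul0e.
Qed.

Lemma integrable_bounded_support (f : mR2 -> R) (D : set mR2) (A : R) :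
  measurable_fun setT f -> measurable D -> (mu2 D < +oo)%E ->
  (forall u, D u -> `|f u| <= A) -> (forall u, ~ D u -> f u = 0) ->
  mu2.-integrable setT (EFin \o f).
Proof.
move=> mf mD Doo fA f0.
have -> : EFin \o f = (EFin \o f) \_ D.
  apply/funext => u; rewrite patchE; case: ifPn => // /negP nD.
  by rewrite /= f0// => Du; apply: nD; rewrite inE.
apply/(integrable_mkcond _ mD); apply: measurable_bounded_integrable => //.
  exact: measurable_funTS.
exists A; split; first exact: num_real.
by move=> M AM u Du /=; rewrite (le_trans (fA u Du))// ltW.
Qed.

(** Dyadic majorant: for the least [n] with [a / 2^(n+1) < |u|], minimality puts [u] in the square
    of radius [a / 2^n], while [1 / |u| < 2^(n+1) / a]. The areas decrease like [4^-n], faster than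
    the heights grow. *)
Lemma integrable_inv_norm (f : mR2 -> R) (a A : R) : 0 < a ->
  measurable_fun setT f -> f 0 = 0 ->
  (forall u : R * R, square a u -> u != 0 -> `|f u| <= A * `|u|^-1) ->
  (forall u : R * R, ~ square a u -> f u = 0) ->
  mu2.-integrable setT (EFin \o f).
Proof.
move=> a0 mf f00 fA f0.
have A0 : 0 <= A.
  have sa : square a (a, 0) by rewrite /square /= [`|_|]/(Num.max _ _) /= normr0 gtr0_norm// ge_max lexx ltW.
  have na : ((a, 0) : R * R) != 0 by rewrite xpair_eqE gt_eqF.
  have na' : 0 < `|(a, 0) : R * R|^-1 by rewrite invr_gt0 normr_gt0.
  by have := le_trans (normr_ge0 _) (fA _ sa na); rewrite pmulr_lge0.
pose c n : R := A * (2 ^+ n.+1 / a).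
have c0 n : 0 <= c n by rewrite mulr_ge0// divr_ge0 ?exprn_ge0// ltW.
pose S n : set mR2 := square (a / 2 ^+ n).
have mS n : measurable (S n) by exact: measurable_square.
pose g n (u : mR2) : \bar R := ((c n)%:E * (\1_(S n) u)%:E)%E.
have g0 n u : (0 <= g n u)%E by rewrite /g mule_ge0// lee_fin.
have mg n : measurable_fun setT (g n).
  by apply: measurable_funeM; apply/measurable_EFinP; exact: measurable_indic.
have fg u : (`|(f u)%:E| <= \sum_(n <oo) g n u)%E.
  have [->|u0] := eqVneq u 0; first by rewrite f00 abse0; apply: nneseries_ge0 => n _ _; exact: g0.
  have [su|nsu] := pselect (square a u); last first.
    by rewrite f0// abse0; apply: nneseries_ge0 => n _ _; exact: g0.
  have nu : 0 < `|u : R * R| by rewrite normr_gt0.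
  have ex : exists n, a / 2 ^+ n.+1 < `|u : R * R|.
    have [n Hn] : exists n : nat, a / `|u : R * R| < n%:R.
      exists (Num.bound (a / `|u : R * R|)); apply: archi_boundP.
      by rewrite divr_ge0// ltW.
    exists n; rewrite ltr_pdivrMr ?exprn_gt0// mulrC -ltr_pdivrMr//.
    rewrite (lt_trans Hn)// -natrX ltr_nat ltnW// ltn_expl//.
  have [n Hn Hmin] := ex_minnP ex.
  have Sn : S n u.
    rewrite /S /square /=; case: n Hn Hmin => [|n] Hn Hmin; first by rewrite expr0 divr1.
    by rewrite leNgt; apply/negP => /Hmin; rewrite ltnn.
  apply: (@le_trans _ _ (g n u)).
    rewrite /g indicE mem_set// mule1 lee_fin (le_trans (fA _ su u0))// ler_wpM2l//.
    rewrite -[leRHS]invrK lef_pV2 ?posrE ?invr_gt0 ?divr_gt0 ?exprn_gt0//.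
    by rewrite invf_div ltW.
  apply: (@le_trans _ _ (\sum_(0 <= i < n.+1) g i u)%E); last exact: nneseries_lim_ge.
  by rewrite big_nat_recr//= leeDr// sume_ge0.
apply/integrableP; split; first exact/measurable_EFinP.
apply: (@le_lt_trans _ _ (\int[mu2]_u \sum_(n <oo) g n u)%E).
  apply: ge0_le_integral => //.
  - by apply: measurableT_comp => //; exact/measurable_EFinP.
  - by apply: ge0_emeasurable_sum => // n u _ _; exact: g0.
  by move=> u _; exact: fg.
rewrite integral_nneseries//.
(* Height [A * 2^(n+1) / a] times area [4 a^2 / 4^n] equals [16 A a / 2^(n+1)], the shape summed by
   [epsilon_trick0]. *)
apply: (@le_lt_trans _ _ (\sum_(n <oo) ((16 * A * a) / (2 ^ n.+1)%:R)%:E)%E); last first.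
  apply: le_lt_trans (epsilon_trick0 _ _) _; last exact: ltry.
  by rewrite mulr_ge0 ?mulr_ge0// ltW.
apply: lee_nneseries => [n _ _|n _].
  by apply: integral_ge0 => u _; exact: g0.
rewrite /g ge0_integralZl//; last 2 first.
  by apply/measurable_EFinP; exact: measurable_indic.
  by rewrite lee_fin.
rewrite integral_indic// setIT lebesgue2_square ?divr_ge0 ?exprn_ge0 ?(ltW a0)//.
rewrite -EFinM lee_fin /c natrX !exprS.
have p0 : (2 : R) ^+ n != 0 by rewrite expf_neq0.
move: p0; move: (2 ^+ n) => p p0; rewrite le_eqVlt; apply/orP; left; apply/eqP.
by field; rewrite p0 gt_eqF.
Qed.

End integrability.

(** * Sums over shifted lattices *)

Section interpolation.
Context {R : realType}.
Implicit Types (f : R * R -> R) (e p : R * R) (A b x : R) (M : nat).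

Lemma MVT_bound (F dF : R -> R) A b : (forall x, 0 <= x <= b -> is_derive x 1 F (dF x)) ->
  (forall x, 0 <= x <= b -> `|dF x| <= A) ->
  forall x, 0 <= x <= b -> `|F x - F 0| <= A * x.
Proof.
move=> HF HdF x /andP[x0 xb].
have [||c cx ->] := @MVT_segment R F dF 0 x x0.
- move=> c; rewrite in_itv/= => /andP[c0 cx]; apply: HF; rewrite ltW//=.
  exact: le_trans (ltW cx) xb.
- apply: continuous_in_subspaceT => c; rewrite inE/= in_itv/= => /andP[c0 cx].
  apply/differentiable_continuous/derivable1_diffP.
  by apply: (@ex_derive _ _ _ _ _ _ _ (HF c _)); rewrite c0 (le_trans cx xb).
move: cx; rewrite in_itv/= => /andP[c0 cx]; rewrite subr0 normrM (ger0_norm x0) ler_wpM2r//.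
by apply: HdF; rewrite c0 (le_trans cx xb).
Qed.

Lemma poly_antiderivative (q : {poly R}) c :
  exists q', [/\ q'^`() = q, q'.[0] = c & (size q' <= (size q).+1)%N].
Proof.
exists (\poly_(i < (size q).+1) (if i is j.+1 then q`_j / j.+1%:R else c)); split.
- apply/polyP => i; rewrite coef_deriv coef_poly ltnS.
  case: ltnP => [_|/leq_sizeP ->//]; last by rewrite mul0rn.
  by rewrite -[LHS]mulr_natr divfK// pnatr_eq0.
- by rewrite horner_coef0 coef_poly.
- exact: size_poly.
Qed.

(** A polynomial close to the derivative is integrated with initial value [f p]. The induction
    thereby avoids an explicit Taylor formula: only the degree and the error are needed. *)
Lemma poly_approx f e p M A b : 0 <= b ->
  (forall k x, (k < M)%N -> 0 <= x <= b -> derivable (iter k (fun g => 'D_e g) f) (x *: e + p) e) ->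
  (forall x, 0 <= x <= b -> `|iter M (fun g => 'D_e g) f (x *: e + p)| <= A) ->
  exists q : {poly R}, (size q <= M)%N /\
    forall x, 0 <= x <= b -> `|f (x *: e + p) - q.[x]| <= A * b ^+ M.
Proof.
move=> b0; elim: M f => [|M IH] f Hd HM.
  by exists 0; split=> [|x xb]; rewrite ?size_poly0// horner0 subr0 expr0 mulr1; exact: HM.
have [q [sq Hq]] : exists q : {poly R}, (size q <= M)%N /\
    forall x, 0 <= x <= b -> `|'D_e f (x *: e + p) - q.[x]| <= A * b ^+ M.
  apply: (IH ('D_e f)) => [k x kM xb|x xb].
    by rewrite -(iterSr k (fun g => 'D_e g)); exact: Hd.
  by rewrite -(iterSr M (fun g => 'D_e g)); exact: HM.
have [q' [dq' q'0 sq']] := poly_antiderivative q (f p).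
exists q'; split; first exact: leq_trans sq' _.
move=> x xb.
have := @MVT_bound (fun x => f (x *: e + p) - q'.[x]) (fun x => 'D_e f (x *: e + p) - q.[x]) (A * b ^+ M) b _ Hq x xb.
rewrite scale0r add0r q'0 subrr subr0 exprSr mulrA => H.
apply: le_trans (H _) _.
  move=> y yb; apply: is_deriveB; first by apply: is_derive_line; exact: (Hd 0%N).
  by rewrite -dq'; exact: is_derive_poly.
have /andP[x0 xb'] := xb.
rewrite ler_wpM2l// (le_trans (normr_ge0 _) (Hq 0 _))// lexx//.
Qed.

(** Lagrange basis polynomials for the nodes [0, ..., M - 1]. Integer nodes are what makes the
    interpolation use lattice points. *)
Definition lagrange_weight M (l : 'I_M) (x : R) : R :=
  (tnth (lagrange M (fun k : nat => k%:R : R)) l : {poly R}).[x].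

Lemma lagrange_exact M (q : {poly R}) x : (0 < M)%N -> (size q <= M)%N ->
  q.[x] = \sum_(l < M) lagrange_weight l x * q.[l%:R].
Proof.
move=> M0 sq; have inj : injective (fun k : nat => k%:R : R) by move=> i j /eqP; rewrite eqr_nat => /eqP.
rewrite [in LHS](lagrange_gen M0 inj sq).
by rewrite horner_sum; apply: eq_bigr => l _; rewrite hornerM hornerC mulrC.
Qed.

Lemma sum_lagrange_weight M x : (0 < M)%N -> \sum_(l < M) lagrange_weight l x = 1.
Proof.
move=> M0; have := @lagrange_exact M 1 x M0; rewrite size_poly1 hornerC => -> //.
by apply: eq_bigr => l _; rewrite hornerC mulr1.
Qed.

Lemma lagrange_weight_bound M : exists2 C : R, 0 <= C &
  forall x, 0 <= x <= 1 -> \sum_(l < M) `|lagrange_weight l x| <= C.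
Proof.
have [|c _ Hc] := @EVT_max R (fun x => \sum_(l < M) `|@lagrange_weight M l x|) 0 1 ler01.
  apply: continuous_subspaceT => x.
  apply: cvg_big; [exact: add_continuous|] => l _; apply: continuous_comp; last exact: norm_continuous.
  exact: continuous_horner.
exists (\sum_(l < M) `|@lagrange_weight M l c|); first by apply: sumr_ge0.
by move=> x x01; apply: Hc; rewrite in_itv.
Qed.

(** Interpolation reproduces the approximating polynomial [q] exactly, so only [f - q] contributes:
    once at [x] and once through the weights, whence [1 + C]. *)
Lemma lagrange_error f e p M A C x : (0 < M)%N -> 0 <= x <= 1 ->
  \sum_(l < M) `|lagrange_weight l x| <= C ->
  (forall k x, (k < M)%N -> 0 <= x <= M%:R -> derivable (iter k (fun g => 'D_e g) f) (x *: e + p) e) ->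
  (forall x, 0 <= x <= M%:R -> `|iter M (fun g => 'D_e g) f (x *: e + p)| <= A) ->
  `|f (x *: e + p) - \sum_(l < M) lagrange_weight l x * f (l%:R *: e + p)|
    <= (1 + C) * (A * M%:R ^+ M).
Proof.
move=> M0 /andP[x0 x1] HC Hd HM.
have [q [sq Hq]] := poly_approx (ler0n _ _) Hd HM.
set E := A * _ in Hq *.
have M1 : 1 <= M%:R :> R by rewrite ler1n.
have Hx : `|f (x *: e + p) - q.[x]| <= E by apply: Hq; rewrite x0 (le_trans x1 M1).
have -> : f (x *: e + p) - \sum_(l < M) lagrange_weight l x * f (l%:R *: e + p) =
   (f (x *: e + p) - q.[x]) - \sum_(l < M) lagrange_weight l x * (f (l%:R *: e + p) - q.[l%:R]).
  under [in RHS]eq_bigr do rewrite mulrBr.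
  by rewrite sumrB -(lagrange_exact x M0 sq); ring.
rewrite (le_trans (ler_normB _ _))// mulrDl mul1r lerD//.
rewrite (le_trans (ler_norm_sum _ _ _))//.
apply: (@le_trans _ _ (\sum_(l < M) `|lagrange_weight l x| * E)).
  apply: ler_sum => l _; rewrite normrM ler_wpM2l// Hq// ler0n/= ler_nat.
  exact: ltnW.
by rewrite -mulr_suml ler_wpM2r// (le_trans _ Hx).
Qed.

(** The first coordinate is interpolated first and then, at each of its nodes, the second. Only
    unmixed derivatives of [f] occur. *)
Lemma lagrange_error2 f (p t : R * R) M A C : (0 < M)%N -> 0 <= t.1 <= 1 -> 0 <= t.2 <= 1 ->
  (forall x, 0 <= x <= 1 -> \sum_(l < M) `|@lagrange_weight M l x| <= C) ->
  (forall e k (v : R * R), e = (1, 0) \/ e = (0, 1) -> (k < M)%N ->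
     0 <= v.1 <= M%:R -> 0 <= v.2 <= M%:R ->
     derivable (iter k (fun g => 'D_e g) f) (p + v) e) ->
  (forall e (v : R * R), e = (1, 0) \/ e = (0, 1) ->
     0 <= v.1 <= M%:R -> 0 <= v.2 <= M%:R ->
     `|iter M (fun g => 'D_e g) f (p + v)| <= A) ->
  `|f (p + t) - \sum_(l < M) \sum_(k < M) lagrange_weight l t.1 * lagrange_weight k t.2 * f (p + (l%:R, k%:R))|
    <= (1 + C) ^+ 2 * (A * M%:R ^+ M).
Proof.
move=> M0 ht1 ht2 HC Hd HM.
have HC1 := HC _ ht1; have HC2 := HC _ ht2.
have M1 : 1 <= M%:R :> R by rewrite ler1n.
have le1M (z : R) : 0 <= z <= 1 -> 0 <= z <= M%:R by move=> /andP[-> z1]; exact: le_trans z1 M1.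
have E1 (x y : R) : x *: ((1, 0) : R * R) + (p + (0, y)) = p + (x, y).
  by rewrite shift_e1 /= addr0 [x + _]addrC.
have E2 (x y : R) : y *: ((0, 1) : R * R) + (p + (x, 0)) = p + (x, y).
  by rewrite shift_e2 /= addr0 [y + _]addrC.
have B1 := @lagrange_error f (1, 0) (p + (0, t.2)) M A C t.1 M0 ht1 HC1.
have B2 (l : 'I_M) := @lagrange_error f (0, 1) (p + (l%:R, 0)) M A C t.2 M0 ht2 HC2.
have tE : (t.1, t.2) = t by rewrite -surjective_pairing.
rewrite E1 tE in B1.
have {}B1 : `|f (p + t) - \sum_(l < M) lagrange_weight l t.1 * f (p + (l%:R, t.2))| <= (1 + C) * (A * M%:R ^+ M).
  have -> : \sum_(l < M) lagrange_weight l t.1 * f (p + (l%:R, t.2)) =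
     \sum_(l < M) lagrange_weight l t.1 * f (l%:R *: (1, 0) + (p + (0, t.2))).
    by apply: eq_bigr => l _; rewrite E1.
  apply: B1 => [k x kM xM|x xM]; rewrite E1.
    by apply: (Hd _ _ _ (or_introl erefl)) => //=; exact: le1M.
  by apply: (HM _ _ (or_introl erefl)) => //=; exact: le1M.
have {}B2 (l : 'I_M) : `|f (p + (l%:R, t.2)) - \sum_(k < M) lagrange_weight k t.2 * f (p + (l%:R, k%:R))| <= (1 + C) * (A * M%:R ^+ M).
  have lM : 0 <= (l%:R : R) <= M%:R by rewrite ler0n ler_nat ltnW.
  have -> : \sum_(k < M) lagrange_weight k t.2 * f (p + (l%:R, k%:R)) =
     \sum_(k < M) lagrange_weight k t.2 * f (k%:R *: (0, 1) + (p + (l%:R, 0))).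
    by apply: eq_bigr => k _; rewrite E2.
  rewrite -(E2 l%:R t.2); apply: B2 => [k x kM xM|x xM]; rewrite E2.
    by apply: (Hd _ _ _ (or_intror erefl)).
  by apply: (HM _ _ (or_intror erefl)).
set E := (1 + C) * _ in B1 B2 *.
have E0 : 0 <= E by exact: le_trans B1.
have -> : f (p + t) - \sum_(l < M) \sum_(k < M) lagrange_weight l t.1 * lagrange_weight k t.2 * f (p + (l%:R, k%:R)) =
  (f (p + t) - \sum_(l < M) lagrange_weight l t.1 * f (p + (l%:R, t.2))) +
  \sum_(l < M) lagrange_weight l t.1 * (f (p + (l%:R, t.2)) - \sum_(k < M) lagrange_weight k t.2 * f (p + (l%:R, k%:R))).
  under [in X in _ = _ + X]eq_bigr do rewrite mulrBr mulr_sumr.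
  rewrite sumrB addrA subrK; congr (_ - _); apply: eq_bigr => l _; apply: eq_bigr => k _.
  by rewrite mulrA.
(* The first interpolation costs [E] and the second [C * E]; together they give the factor
   [(1 + C)^2]. *)
rewrite (le_trans (ler_normD _ _))// expr2 -mulrA -/E mulrDl mul1r lerD//.
rewrite (le_trans (ler_norm_sum _ _ _))//.
apply: (@le_trans _ _ (\sum_(l < M) `|lagrange_weight l t.1| * E)).
  by apply: ler_sum => l _; rewrite normrM ler_wpM2l// B2.
by rewrite -mulr_suml ler_wpM2r.
Qed.

End interpolation.

(** * Lattice sums over a large finite window *)

Section grid_sums.
Context {R : realType}.
Implicit Types (f : R * R -> R) (m n : nat).

Definition grid (m : nat) (x y : nat) : R * R := (x%:R - m%:R, y%:R - m%:R).

Definition grid_sum f m (t : R * R) : R :=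
  \sum_(0 <= x < m.*2) \sum_(0 <= y < m.*2) f (grid m x y + t).

Lemma sum_shift (g : nat -> R) l n : (forall x, (x < l)%N -> g x = 0) ->
  (forall x, (n <= x)%N -> g x = 0) ->
  \sum_(0 <= x < n) g (x + l)%N = \sum_(0 <= x < n) g x.
Proof.
move=> g0 gn.
have H1 : \sum_(0 <= x < n + l) g x = \sum_(0 <= x < n) g (x + l)%N.
  rewrite (big_cat_nat (n := l)) ?leq_addl//= big_nat_cond big1 ?add0r; last first.
    by move=> i /andP[/andP[_ il] _]; exact: g0.
  by rewrite -{1}[l]add0n big_addn addnK.
rewrite -H1 (big_cat_nat (n := n)) ?leq_addr//= [X in _ + X]big_nat_cond [X in _ + X]big1 ?addr0//.
by move=> i /andP[/andP[ni _] _]; exact: gn.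
Qed.

(** The window reaches beyond the support by more than the shift, so an integer translation only
    moves zeros across its boundary. *)
Lemma grid_sum_shift f m n k l : (forall u, n%:R < `|u| -> f u = 0) ->
  (n + k < m)%N -> (n + l < m)%N -> grid_sum f m (k%:R, l%:R) = grid_sum f m 0.
Proof.
move=> f0 km lm; rewrite /grid_sum.
have E (x y : nat) : grid m x y + (k%:R, l%:R) = grid m (x + k) (y + l).
  by rewrite /grid; congr (_, _); rewrite /= natrD; ring.
have out (x y : nat) : (x < m - n)%N \/ (m.*2 <= x)%N -> n%:R < `|x%:R - m%:R : R|.
  move=> [H|H].
    rewrite distrC ger0_norm; last by rewrite subr_ge0 ler_nat; lia.
    by rewrite ltrBrDr -natrD ltr_nat; lia.
  rewrite ger0_norm; last by rewrite subr_ge0 ler_nat; lia.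
  by rewrite ltrBrDr -natrD ltr_nat; lia.
transitivity (\sum_(0 <= x < m.*2) \sum_(0 <= y < m.*2) f (grid m x (y + l)%N)).
  under eq_bigr do under eq_bigr do rewrite E.
  apply: (@sum_shift (fun x => \sum_(0 <= y < m.*2) f (grid m x (y + l)%N))) => x Hx.
    rewrite big1// => y _; apply: f0; rewrite norm_pairE lt_max out//; left; lia.
  by rewrite big1// => y _; apply: f0; rewrite norm_pairE lt_max out//; right.
apply: eq_bigr => x _; under [RHS]eq_bigr do rewrite addr0.
apply: (@sum_shift (fun y => f (grid m x y))) => y Hy; apply: f0; rewrite norm_pairE lt_max orbC out//.
  left; lia.
by right.
Qed.

(* The product decay x * decay y dominates (1 + max(|x|, |y|))^-3, and its sum over
   the lattice splits into two convergent one-dimensional sums. *)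
Definition decay (z : R) : R := ((1 + `|z|) * Num.sqrt (1 + `|z|))^-1.

Lemma decay_ge0 z : 0 <= decay z.
Proof. by rewrite invr_ge0 mulr_ge0 ?sqrtr_ge0// addr_ge0. Qed.

(** With [a] and [b] the square roots of [k + 1] and [k + 2], [1/a - 1/b = 1 / (a b (a + b))]
    because [b^2 - a^2 = 1], and [a <= b] bounds this below by [1 / (2 b^3)]. It replaces the
    comparison with an integral. *)
Lemma decay_telescope k : decay k.+1%:R <= 2 * ((Num.sqrt k.+1%:R)^-1 - (Num.sqrt k.+2%:R)^-1).
Proof.
rewrite /decay ger0_norm ?ler0n// addrC natr1.
set a := Num.sqrt k.+1%:R; set b := Num.sqrt k.+2%:R.
have a0 : 0 < a by rewrite sqrtr_gt0 ltr0n.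
have b0 : 0 < b by rewrite sqrtr_gt0 ltr0n.
have a2 : a ^+ 2 = k.+1%:R by rewrite sqr_sqrtr ?ler0n.
have b2 : b ^+ 2 = k.+2%:R by rewrite sqr_sqrtr ?ler0n.
have ab : a <= b by rewrite ler_wsqrtr// ler_nat.
have D : b ^+ 2 - a ^+ 2 = 1 by rewrite a2 b2 -[k.+2%:R]natr1; ring.
rewrite -b2.
have -> : a^-1 - b^-1 = (b - a) / (a * b) by field; rewrite !gt_eqF.
have Dab : b - a = (a + b)^-1.
  apply: (mulIf (_ : a + b != 0)); first by rewrite gt_eqF// addr_gt0.
  by rewrite mulVf ?gt_eqF ?addr_gt0// -D; ring.
rewrite Dab -invfM -[2]invrK -invfM lef_pV2 ?posrE; last 2 first.
  by rewrite !mulr_gt0// exprn_gt0.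
  by rewrite !mulr_gt0 ?invr_gt0 ?addr_gt0.
rewrite -subr_ge0.
have -> : b ^+ 2 * b - 2^-1 * ((a + b) * (a * b)) = b / 2 * ((b - a) * (2 * b + a)).
  by field.
by rewrite !mulr_ge0 ?subr_ge0 ?divr_ge0 ?addr_ge0 ?mulr_ge0// ltW.
Qed.

Lemma sum_decay n : \sum_(0 <= k < n) decay k%:R <= 3.
Proof.
have H m : \sum_(0 <= k < m) decay k.+1%:R <= 2 * (1 - (Num.sqrt m.+1%:R)^-1).
  elim: m => [|m IH]; first by rewrite big_nil sqrtr1 invr1 subrr mulr0.
  rewrite big_nat_recr//= (le_trans (lerD IH (decay_telescope m)))//.
  by rewrite -mulrDr ler_wpM2l//; lra.
case: n => [|n]; first by rewrite big_nil.
rewrite big_nat_recl//= {1}/decay normr0 addr0 sqrtr1 mulr1 invr1.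
have := H n; have : 0 <= (Num.sqrt n.+1%:R : R)^-1 by rewrite invr_ge0 sqrtr_ge0.
by move: (_^-1) (\sum_(_ <= _ < _) _) => p q; lra.
Qed.

Lemma sum_decay_grid m : \sum_(0 <= x < m.*2) decay (x%:R - m%:R) <= 6.
Proof.
rewrite (big_cat_nat (n := m)) ?leq0n//=; last by rewrite -addnn leq_addr.
have -> : \sum_(m <= x < m.*2) decay (x%:R - m%:R) = \sum_(0 <= k < m) decay k%:R.
  rewrite -{1}[m]add0n -addnn big_addn addnK; apply: eq_bigr => i _.
  by rewrite natrD addrK.
have -> : \sum_(0 <= x < m) decay (x%:R - m%:R) = \sum_(0 <= k < m) decay k.+1%:R.
  rewrite big_nat_rev /= add0n; apply: eq_big_nat => i /andP[_ im].
  rewrite /decay natrB; last exact: im.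
  by rewrite addrAC subrr sub0r normrN.
have := sum_decay m; have := sum_decay m.+1; rewrite big_nat_recl//=.
have := decay_ge0 0; move: (decay 0) (\sum_(_ <= _ < _) _) (\sum_(_ <= _ < _) _) => p q r; lra.
Qed.

Lemma decay_max (x y : R) : ((1 + Num.max `|x| `|y|) ^+ 3)^-1 <= decay x * decay y.
Proof.
rewrite /decay -invfM.
have H (z : R) : 0 < 1 + `|z| by rewrite ltr_wpDr.
set Z := 1 + Num.max _ _.
have xZ : 1 + `|x| <= Z by rewrite lerD2l le_max lexx.
have yZ : 1 + `|y| <= Z by rewrite lerD2l le_max lexx orbT.
have Z0 : 0 < Z by exact: lt_le_trans (H x) xZ.
rewrite lef_pV2 ?posrE ?exprn_gt0 ?mulr_gt0 ?sqrtr_gt0//.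
rewrite mulrACA (_ : Z ^+ 3 = (Z * Z) * (Num.sqrt Z * Num.sqrt Z)); last first.
  by rewrite -(expr2 (Num.sqrt Z)) sqr_sqrtr ?ltW//; ring.
by rewrite !ler_pM ?mulr_ge0 ?sqrtr_ge0 ?ler_wsqrtr ?(ltW (H _)).
Qed.

Lemma grid_sum_decay f m (B : R) (t : R * R) : 0 <= B ->
  (forall x y, `|f (grid m x y + t)| <= B * decay (x%:R - m%:R) * decay (y%:R - m%:R)) ->
  `|grid_sum f m t| <= 36 * B.
Proof.
move=> B0 H; rewrite /grid_sum (le_trans (ler_norm_sum _ _ _))//.
apply: (@le_trans _ _ (\sum_(0 <= x < m.*2) \sum_(0 <= y < m.*2) (B * decay (x%:R - m%:R) * decay (y%:R - m%:R)))).
  by apply: ler_sum => x _; rewrite (le_trans (ler_norm_sum _ _ _))// ler_sum.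
under eq_bigr do rewrite -mulr_sumr.
rewrite -mulr_suml -mulr_sumr (_ : 36 * B = B * 6 * 6); last by ring.
have S0 : 0 <= \sum_(0 <= x < m.*2) decay (x%:R - m%:R) by apply: sumr_ge0 => i _; exact: decay_ge0.
by rewrite ler_pM ?mulr_ge0// ?ler_wpM2l// sum_decay_grid.
Qed.

End grid_sums.

(** * Interpolation error cell by cell *)

Section local_error.
Context {R : realType}.
Implicit Types (f : R * R -> R).

(** What interpolation consumes from a symbol: its size near the origin and the decay of its top
    derivative, with exponent 3 for summability over a planar lattice. Intermediate derivatives only
    have to exist. *)
Definition symbol_bound (M s : nat) (A : R) f : Prop :=
  [/\ forall u, `|f u| <= A * `|u| ^+ s,
      forall (e : R * R) k u, e = (1, 0) \/ e = (0, 1) -> (k < M)%N -> u != 0 ->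
        derivable (iter k (fun g => 'D_e g) f) u e &
      forall (e : R * R) u, e = (1, 0) \/ e = (0, 1) -> u != 0 ->
        `|iter M (fun g => 'D_e g) f u| <= A * (`|u| ^+ 3)^-1].

Lemma norm_pair_le (v : R * R) (b : R) : 0 <= v.1 <= b -> 0 <= v.2 <= b -> `|v| <= b.
Proof.
move=> /andP[v10 v1b] /andP[v20 v2b].
by rewrite norm_pairE ge_max !ger0_norm// v1b.
Qed.

(** If [2M <= |p|], the nodes stay at distance at least [|p| / 2] from the origin and the derivative
    bound applies. Otherwise the size bound suffices, since [(1 + |p|)^-3] is then bounded below. *)
Lemma cell_error M s : (0 < M)%N -> exists2 C : R, 0 <= C &
  forall f A (p t : R * R),
  symbol_bound M s A f ->
  0 <= t.1 <= 1 -> 0 <= t.2 <= 1 ->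
  `|f (p + t) - \sum_(l < M) \sum_(k < M) lagrange_weight l t.1 * lagrange_weight k t.2 * f (p + (l%:R, k%:R))|
   <= C * A * ((1 + `|p|) ^+ 3)^-1.
Proof.
move=> M0; have [L L0 HL] := @lagrange_weight_bound R M.
have M1 : 1 <= M%:R :> R by rewrite ler1n.
(* [C1] is for [p] far from the origin: there [|p| / 2 >= (1 + |p|) / 4], and [64 = 4^3]. [C2] is
   for [|p| < 2M]: nodes have norm at most [3M], and [(1 + 2M)^3] absorbs the decay factor. *)
pose C1 : R := (1 + L) ^+ 2 * M%:R ^+ M * 64.
pose C2 : R := (1 + L ^+ 2) * (3 * M%:R) ^+ s * (1 + 2 * M%:R) ^+ 3.
have C10 : 0 <= C1 by rewrite !mulr_ge0 ?exprn_ge0 ?addr_ge0.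
have C20 : 0 <= C2 by rewrite !mulr_ge0 ?exprn_ge0 ?addr_ge0 ?mulr_ge0 ?exprn_ge0.
exists (C1 + C2); first exact: addr_ge0.
move=> f A p t [Hf Hd HM] ht1 ht2.
have A0 : 0 <= A.
  by have := le_trans (normr_ge0 _) (Hf (1, 0)); rewrite norm_pair0 normr1 expr1n mulr1.
have le1M (z : R) : 0 <= z <= 1 -> 0 <= z <= M%:R by move=> /andP[-> z1]; exact: le_trans z1 M1.
have p1 : 0 < 1 + `|p| by rewrite ltr_wpDr.
have [pM|pM] := leP (2 * M%:R) `|p|.
  have p0 : 0 < `|p| by rewrite (lt_le_trans _ pM)// mulr_gt0// (lt_le_trans ltr01).
  have Hv (v : R * R) : 0 <= v.1 <= M%:R -> 0 <= v.2 <= M%:R -> `|p| / 2 <= `|p + v|.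
    move=> h1 h2; have vM := norm_pair_le h1 h2.
    have := ler_normB (p + v) v; rewrite addrK; lra.
  have Hn0 (v : R * R) : 0 <= v.1 <= M%:R -> 0 <= v.2 <= M%:R -> p + v != 0.
    by move=> h1 h2; rewrite -normr_gt0 (lt_le_trans _ (Hv v h1 h2))// divr_gt0.
  have := @lagrange_error2 R f p t M (A * (64 * ((1 + `|p|) ^+ 3)^-1)) L M0 ht1 ht2 HL.
  move=> /(_ _ _)/le_trans; apply.
  - by move=> e k v he kM h1 h2; apply: Hd => //; exact: Hn0.
  - move=> e v he h1 h2; apply: le_trans (HM _ _ he (Hn0 _ h1 h2)) _.
    rewrite ler_wpM2l//.
    have -> : 64 * ((1 + `|p|) ^+ 3)^-1 = (((1 + `|p|) / 4) ^+ 3)^-1 :> R.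
      by field; rewrite gt_eqF.
    rewrite lef_pV2 ?posrE ?exprn_gt0 ?divr_gt0 ?normr_gt0 ?Hn0//.
    rewrite lerXn2r// ?nnegrE ?divr_ge0 ?(ltW p1)// (le_trans _ (Hv v h1 h2))//.
    by rewrite ler_pdivrMr// (le_trans (_ : _ <= 2 * `|p|))//; lra.
  rewrite (_ : (1 + L) ^+ 2 * _ = C1 * A * ((1 + `|p|) ^+ 3)^-1); last by rewrite /C1; ring.
  by rewrite ler_wpM2r ?invr_ge0 ?exprn_ge0 ?(ltW p1)// ler_wpM2r// lerDl.
have Hv (v : R * R) : 0 <= v.1 <= M%:R -> 0 <= v.2 <= M%:R -> `|f (p + v)| <= A * (3 * M%:R) ^+ s.
  move=> h1 h2; apply: le_trans (Hf _) _; rewrite ler_wpM2l// lerXn2r// ?nnegrE ?mulr_ge0//.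
  have := ler_normD p v; have := norm_pair_le h1 h2; lra.
set F := A * _ in Hv.
have F0 : 0 <= F by rewrite mulr_ge0// exprn_ge0// mulr_ge0.
apply: (@le_trans _ _ ((1 + L ^+ 2) * F)).
  rewrite (le_trans (ler_normB _ _))// mulrDl mul1r lerD//.
    by apply: Hv; exact: le1M.
  apply: (@le_trans _ _ (\sum_(l < M) \sum_(k < M) `|lagrange_weight l t.1| * `|lagrange_weight k t.2| * F)).
    rewrite (le_trans (ler_norm_sum _ _ _))// ler_sum// => l _.
    rewrite (le_trans (ler_norm_sum _ _ _))// ler_sum// => k _.
    rewrite !normrM ler_wpM2l ?mulr_ge0// Hv//= ler0n ler_nat ltnW//.
  under eq_bigr do rewrite -mulr_suml -mulr_sumr.
  rewrite -mulr_suml -mulr_suml expr2 ler_wpM2r// ler_pM ?sumr_ge0// HL//.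
have -> : (1 + L ^+ 2) * F = C2 * A * ((1 + 2 * M%:R) ^+ 3)^-1.
  rewrite /C2 /F; field; rewrite gt_eqF//; lra.
have p2 : (1 + 2 * M%:R : R) > 0 by lra.
apply: ler_pM; [by rewrite mulr_ge0|by rewrite invr_ge0 exprn_ge0// ltW|by rewrite ler_wpM2r// lerDr|].
rewrite lef_pV2 ?posrE ?exprn_gt0// lerXn2r// ?nnegrE ?(ltW p1) ?(ltW p2)//; lra.
Qed.

(** All integer shifts have the same grid sum and the weights sum to 1, so the unshifted sum equals
    its own interpolation at [t]. The deviation is therefore the grid sum of the cell errors. *)
Lemma grid_sum_deviation M s : (0 < M)%N -> exists2 C : R, 0 <= C &
  forall f A n m (t : R * R),
  symbol_bound M s A f ->
  (forall u, n%:R < `|u| -> f u = 0) -> (n + M < m)%N ->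
  0 <= t.1 <= 1 -> 0 <= t.2 <= 1 ->
  `|grid_sum f m t - grid_sum f m 0| <= C * A.
Proof.
move=> M0; have [C C0 HC] := cell_error s M0.
exists (36 * C); first by rewrite mulr_ge0.
move=> f A n m t Hs f0 nm ht1 ht2; have [Hf _ _] := Hs.
have A0 : 0 <= A.
  by have := le_trans (normr_ge0 _) (Hf (1, 0)); rewrite norm_pair0 normr1 expr1n mulr1.
pose D p := f (p + t) - \sum_(l < M) \sum_(k < M) lagrange_weight l t.1 * lagrange_weight k t.2 * f (p + (l%:R, k%:R)).
have -> : grid_sum f m t - grid_sum f m 0 = grid_sum D m 0.
  have -> : grid_sum f m 0 = \sum_(l < M) \sum_(k < M) lagrange_weight l t.1 * lagrange_weight k t.2 * grid_sum f m (l%:R, k%:R).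
    have E (l k : 'I_M) : grid_sum f m (l%:R, k%:R) = grid_sum f m 0.
      by apply: grid_sum_shift f0 _ _; apply: leq_ltn_trans nm; rewrite leq_add2l ltnW.
    under eq_bigr do under eq_bigr do rewrite E.
    under eq_bigr do rewrite -mulr_suml -mulr_sumr sum_lagrange_weight// mulr1.
    by rewrite -mulr_suml sum_lagrange_weight// mul1r.
  rewrite /grid_sum /D.
  under [in RHS]eq_bigr do rewrite sumrB.
  rewrite sumrB; congr (_ - _).
    by apply: eq_bigr => x _; apply: eq_bigr => y _; rewrite addr0.
  under eq_bigr do under eq_bigr do rewrite mulr_sumr.
  under eq_bigr do rewrite exchange_big /=.
  rewrite exchange_big /=; apply: eq_bigr => x _.
  under eq_bigr do under eq_bigr do rewrite mulr_sumr.
  under eq_bigr do rewrite exchange_big /=.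
  rewrite exchange_big /=; apply: eq_bigr => y _.
  by apply: eq_bigr => l _; apply: eq_bigr => k _; rewrite addr0.
rewrite -mulrA; apply: grid_sum_decay; first by rewrite mulr_ge0.
move=> x y; rewrite addr0 (le_trans (HC f A (grid m x y) t Hs ht1 ht2))//.
by rewrite -[leRHS]mulrA ler_wpM2l ?mulr_ge0 ?decay_max.
Qed.

End local_error.

(** * Tiling the plane by unit boxes *)

Section cells.
Context {R : realType}.
Local Notation mR2 := (measurableTypeR R * measurableTypeR R)%type.
Local Notation mu2 := (@lebesgue2 R).

Lemma Rintegral_sum (I : Type) (r : seq I) (F : I -> mR2 -> R) :
  (forall i, mu2.-integrable setT (EFin \o F i)) ->
  mu2.-integrable setT (EFin \o (fun u => \sum_(i <- r) F i u)) /\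
  \int[mu2]_u (\sum_(i <- r) F i u) = \sum_(i <- r) \int[mu2]_u F i u.
Proof.
move=> iF; elim: r => [|i r [IH1 IH2]].
  split.
    rewrite (_ : _ \o _ = cst 0%E); first exact: integrable0.
    by apply/funext => u; rewrite /= big_nil.
  rewrite big_nil; under eq_Rintegral do rewrite big_nil.
  by rewrite Rintegral_cst// mul0r.
have E : (fun u => \sum_(j <- i :: r) F j u) = (fun u => F i u + \sum_(j <- r) F j u).
  by apply/funext => u; rewrite big_cons.
rewrite E big_cons; split.
  exact: (integrableD measurableT (iF i) IH1).
by rewrite RintegralD// IH2.
Qed.

(** Half open, so that the translates tile without overlap and their indicators add up to exactly
    1. *)
Definition unit_box (g : R * R) : set mR2 :=
  `[g.1, g.1 + 1[%classic `*` `[g.2, g.2 + 1[%classic.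

Lemma measurable_unit_box g : measurable (unit_box g).
Proof. by apply: measurableX; exact: measurable_itv. Qed.

Lemma lebesgue2_unit_box g : mu2 (unit_box g) = 1%E.
Proof.
rewrite /unit_box (@lebesgue2_box R g (g.1 + 1, g.2 + 1)) /= ?lerDl//.
by rewrite ![_ + 1]addrC !addrK mulr1.
Qed.

Lemma sum_unit_intervals (N : nat) (v : R) :
  \sum_(0 <= x < N) ((x%:R <= v) && (v < x%:R + 1))%:R = ((0 <= v) && (v < N%:R))%:R :> R.
Proof.
elim: N => [|N IH].
  by rewrite big_nil; case: (leP 0 v) => // v0; rewrite ltNge v0.
rewrite big_nat_recr//= IH natr1.
have [v0|v0] /= := leP 0 v; last first.
  rewrite [X in _ + X](_ : _ = 0) ?addr0//.
  by rewrite [N%:R <= v]leNgt (lt_le_trans v0).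
have [vN|vN] /= := ltP v N%:R.
  by rewrite addr0 (lt_trans vN)// ltr_nat.
by rewrite add0r.
Qed.

Lemma unit_boxes_cover m (u : R * R) : `|u| < m%:R ->
  \sum_(0 <= x < m.*2) \sum_(0 <= y < m.*2) \1_(unit_box (grid m x y)) u = 1 :> R.
Proof.
rewrite norm_pairE gt_max => /andP[u1 u2].
have E (x y : nat) : \1_(unit_box (grid m x y)) u =
   ((x%:R <= u.1 + m%:R) && (u.1 + m%:R < x%:R + 1))%:R * ((y%:R <= u.2 + m%:R) && (u.2 + m%:R < y%:R + 1))%:R :> R.
  rewrite indicE -natrM mulnb; congr (_%:R).
  rewrite /unit_box /grid in_setX !mem_setE /= !in_itv /=.
  by rewrite !lerBlDr !(addrAC _ _ 1) -!ltrBlDr !opprK.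
under eq_bigr do under eq_bigr do rewrite E.
under eq_bigr do rewrite -mulr_sumr sum_unit_intervals.
rewrite -mulr_suml sum_unit_intervals -natrM mulnb.
have H (z : R) : `|z| < m%:R -> (0 <= z + m%:R) && (z + m%:R < m.*2%:R).
  by rewrite ltr_norml => /andP[z1 z2]; rewrite -addnn natrD ltrD2r z2 andbT; lra.
by rewrite !H.
Qed.

(** The integral is cut into unit boxes, each of which is translated to the box at the origin. *)
Lemma Rintegral_grid_sum (f : R * R -> R) (b : R) n m :
  measurable_fun [set: mR2] (f : mR2 -> R) ->
  (forall u, `|f u| <= b) -> (forall u, n%:R < `|u| -> f u = 0) -> (n < m)%N ->
  mu2.-integrable setT (EFin \o (fun t : mR2 => grid_sum f m t * \1_(unit_box 0) t)) /\
  \int[mu2]_u f u = \int[mu2]_t (grid_sum f m t * \1_(unit_box 0) t).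
Proof.
move=> mf fb f0 nm.
pose F (q : nat * nat) (u : mR2) : R := f u * \1_(unit_box (grid m q.1 q.2 : R * R)) u.
pose G (q : nat * nat) (t : mR2) : R := f (grid m q.1 q.2 + t) * \1_(unit_box 0) t.
have E0 g (t : mR2) : affine2 1 g t = (g : R * R) + t.
  by rewrite /affine2; congr (_, _); rewrite mul1r addrC.
have mshift g : measurable_fun [set: mR2] (fun t : mR2 => f ((g : R * R) + t)).
  have := measurableT_comp mf (measurable_affine2 1 g).
  by apply: eq_measurable_fun => t _ /=; rewrite E0.
have b0 : 0 <= b by exact: le_trans (normr_ge0 _) (fb 0).
have mF q : measurable_fun setT (F q).
  by apply: measurable_funM => //; apply: measurable_indic; exact: measurable_unit_box.
have mG q : measurable_fun setT (G q).
  by apply: measurable_funM => //; apply: measurable_indic; exact: measurable_unit_box.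
have b1 (A : set mR2) (x u : mR2) : `|f x * \1_A u| <= b.
  rewrite normrM (le_trans (ler_pM _ _ (fb _) (_ : _ <= 1)))// ?mulr1//.
  by rewrite indicE; case: (_ \in _); rewrite ?normr1 ?normr0.
have iF q : mu2.-integrable setT (EFin \o F q).
  apply: (@integrable_bounded_support R (F q) (unit_box (grid m q.1 q.2 : R * R)) b) => //.
  - exact: measurable_unit_box.
  - by rewrite lebesgue2_unit_box ltry.
  - by move=> u _; exact: b1.
  - by move=> u nu; rewrite /F indicE memNset// mulr0.
have iG q : mu2.-integrable setT (EFin \o G q).
  apply: (@integrable_bounded_support R (G q) (unit_box 0) b) => //.
  - exact: measurable_unit_box.
  - by rewrite lebesgue2_unit_box ltry.
  - by move=> u _; exact: b1.
  - by move=> u nu; rewrite /G indicE memNset// mulr0.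
have FG q : \int[mu2]_u F q u = \int[mu2]_t G q t.
  rewrite (@Rintegral_affine R 1 (grid m q.1 q.2 : R * R) (F q)) ?oner_neq0// expr1n mul1r.
  apply: eq_Rintegral => t _; rewrite E0 /F /G; congr (_ * _).
  rewrite !indicE; congr (_%:R); congr nat_of_bool.
  rewrite /unit_box !in_setX !mem_setE /= !in_itv /= !lerDl !add0r.
  by rewrite -!addrA !ltrD2l.
pose r := [seq (x, y) | x <- index_iota 0 m.*2, y <- index_iota 0 m.*2].
have [_ SF] := Rintegral_sum r iF; have [SG1 SG] := Rintegral_sum r iG.
have EG : (fun t : mR2 => grid_sum f m t * \1_(unit_box 0) t) = (fun t => \sum_(q <- r) G q t).
  apply/funext => t; rewrite big_allpairs /= /grid_sum mulr_suml.
  by apply: eq_bigr => x _; rewrite mulr_suml.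
rewrite EG SG -(eq_bigr _ (fun q _ => FG q)) -SF; split => //.
apply: eq_Rintegral => u _; rewrite big_allpairs /= /F.
under eq_bigr do rewrite -mulr_sumr.
rewrite -mulr_sumr; have [un|un] := ltP n%:R `|u : R * R|; first by rewrite f0// mul0r.
by rewrite unit_boxes_cover ?mulr1// (le_lt_trans un)// ltr_nat.
Qed.

End cells.

(** * The quadrature error of a symbol *)

(* symb on the whole plane with one explicit constant A for all orders, so that
   the effect of dilations on the constant can be tracked. *)
Fixpoint symbA {R : realType} (e : R * R) (M : nat) (s : int) (A : R)
    (f : R * R -> R) : Prop :=
  (forall u, u != 0 -> `|f u| <= A * `|u| ^ s) /\
  if M is M'.+1 then
    (forall u, u != 0 -> derivable f u e) /\ symbA e M' (s - 1) A ('D_e f)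
  else True.

Section symbA.
Context {R : realType} (e : R * R).
Implicit Types (f g : R * R -> R) (M : nat) (s : int) (A h c : R).

Lemma near_neq0 (u : R * R) : u != 0 -> \forall v \near u, v != 0.
Proof.
move=> u0; have : \forall v \near u, [set: R * R] v /\ v != 0 by apply: open_punctured => //; exact: openT.
by apply: filterS => v [].
Qed.

Lemma symbA_ext M s A f g : (forall u, u != 0 -> f u = g u) -> symbA e M s A f -> symbA e M s A g.
Proof.
elim: M s f g => [|M IH] s f g fg /= [HA H]; split.
- by move=> u u0; rewrite -fg//; exact: HA.
- by [].
- by move=> u u0; rewrite -fg//; exact: HA.
have nfg (u : R * R) : u != 0 -> \forall v \near u, f v = g v.
  by move=> u0; apply: filterS (near_neq0 u0) => v v0; exact: fg.
case: H => df H; split; first by move=> u u0; apply: near_eq_derivable (nfg _ _) (df u u0).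
by apply: IH H => u u0; apply: near_eq_derive; exact: nfg.
Qed.

Lemma symbA_le M s A A' f : A <= A' -> symbA e M s A f -> symbA e M s A' f.
Proof.
move=> AA; elim: M s f => [|M IH] s f /= [HA Hf]; split => //.
- by move=> u u0; rewrite (le_trans (HA u u0))// ler_wpM2r// exprz_ge0.
- by move=> u u0; rewrite (le_trans (HA u u0))// ler_wpM2r// exprz_ge0.
by case: Hf => df Hf; split => //; exact: IH.
Qed.

Lemma symb_symbA M s f : symb setT setT e M s f -> exists A, symbA e M s A f.
Proof.
elim: M s f => [|M IH] s f /= [[A HA] Hf].
  by exists A; split => // u u0; exact: HA.
case: Hf => df /IH[A' HA']; exists (Num.max A A'); split.
  move=> u u0; rewrite (le_trans (HA u _ u0))// ler_wpM2r ?exprz_ge0//.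
  by rewrite le_max lexx.
split; first by move=> u u0; exact: df.
by apply: symbA_le HA'; rewrite le_max lexx orbT.
Qed.

Lemma symbAB M s A A' f g : symbA e M s A f -> symbA e M s A' g -> symbA e M s (A + A') (f - g).
Proof.
elim: M s f g => [|M IH] s f g /= [HA Hf] [HA' Hg].
all: have ? : forall u, u != 0 -> `|(f - g) u| <= (A + A') * `|u| ^ s
  by move=> u u0; rewrite mulrDl (le_trans (ler_normB _ _))// lerD ?HA ?HA'.
by [].
split=> //; case: Hf Hg => df Hf [dg Hg]; split.
  by move=> u u0; apply: derivableB; [exact: df|exact: dg].
apply: symbA_ext (IH _ _ _ Hf Hg) => u u0.
by rewrite deriveB//; [exact: df|exact: dg].
Qed.

Lemma symbAZ M s A c f : symbA e M s A f -> symbA e M s (`|c| * A) (c \*: f).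
Proof.
elim: M s f => [|M IH] s f /= [HA Hf].
all: have ? : forall u, u != 0 -> `|(c \*: f) u| <= `|c| * A * `|u| ^ s
  by move=> u u0; rewrite /= normrM -mulrA ler_wpM2l// HA.
by [].
split=> //; case: Hf => df Hf; split.
  by move=> u u0; apply: derivableZ; exact: df.
apply: symbA_ext (IH _ _ Hf) => u u0.
by rewrite deriveZ//; exact: df.
Qed.

Lemma is_derive_scale f h (u : R * R) : derivable f (h *: u) e ->
  is_derive u e (fun v => f (h *: v)) (h * 'D_e f (h *: u)).
Proof.
move=> df; apply: is_derive_along_line.
have -> : (fun x : R => f (h *: (x *: e + u))) = (fun y : R => f (y *: e + h *: u)) \o (fun x : R => h * x).
  by apply/funext => x; rewrite /= scalerDr scalerA.
have df0 : derivable f ((h * 0) *: e + h *: u) e by rewrite mulr0 scale0r add0r.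
have D1 := is_derive_line df0.
have D2 : is_derive (0 : R) 1 (fun x : R => h * x) h.
  have := is_deriveZ h (is_derive_id (0 : R) (1 : R)).
  by rewrite (_ : h *: 1 = h) // -[LHS]/(h * 1) mulr1.
split.
  apply/derivable1_diffP; apply: differentiable_comp; apply/derivable1_diffP; exact: ex_derive.
rewrite -derive1E (@derive1_comp R (fun x : R => h * x) (fun y : R => f (y *: e + h *: u))); [|exact: ex_derive|exact: ex_derive].
rewrite !derive1E (@derive_val _ _ _ _ _ _ _ D1) (@derive_val _ _ _ _ _ _ _ D2).
by rewrite mulr0 scale0r add0r mulrC.
Qed.

(** Each derivative brings a factor [h] by the chain rule, which compensates the order lost:
    [h * h^(s-1) = h^s]. One constant therefore serves all orders. *)
Lemma symbA_scale M s A f h : 0 < h -> symbA e M s A f ->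
  symbA e M s (A * h ^ s) (fun u => f (h *: u)).
Proof.
move=> h0; have hu (u : R * R) : u != 0 -> h *: u != 0.
  by move=> u0; rewrite scaler_eq0 negb_or gt_eqF.
elim: M s f => [|M IH] s f /= [HA Hf].
all: have ? : forall u : R * R, u != 0 -> `|f (h *: u)| <= A * h ^ s * `|u| ^ s.
1,3: move=> u u0; rewrite (le_trans (HA _ (hu u u0)))// normrZ gtr0_norm//.
1,2: by rewrite expfzMl mulrA.
by [].
split=> //; case: Hf => df Hf.
have D u : u != 0 -> is_derive u e (fun u => f (h *: u)) (h * 'D_e f (h *: u)).
  by move=> u0; apply: is_derive_scale; apply: df; exact: hu.
split; first by move=> u u0; exact: (@ex_derive _ _ _ _ _ _ _ (D u u0)).
have := symbAZ h (IH _ _ Hf).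
rewrite gtr0_norm// mulrCA -{1}[h]expr1z -expfzDr ?gt_eqF// addrCA subrr addr0.
apply: symbA_ext => u u0 /=.
by rewrite (@derive_val _ _ _ _ _ _ _ (D u u0)).
Qed.

Lemma symbA_iter M s A f k : symbA e M s A f -> (k <= M)%N ->
  (forall u, u != 0 -> `|iter k (fun g => 'D_e g) f u| <= A * `|u| ^ (s - k%:Z)) /\
  ((k < M)%N -> forall u, u != 0 -> derivable (iter k (fun g => 'D_e g) f) u e).
Proof.
elim: M s f k => [|M IH] s f [|k]//= [Hb Hf] kM.
- by rewrite subr0.
- by rewrite subr0; split=> // _; case: Hf.
case: Hf => df Hf; have := IH _ _ k Hf kM.
have -> : iter k (fun g => 'D_e g) ('D_e f) = 'D_e (iter k (fun g => 'D_e g) f).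
  exact: esym (iterSr k (fun g => 'D_e g) f).
by rewrite (_ : s - 1 - k%:Z = s - k.+1%:Z)//; rewrite -addn1 PoszD; ring.
Qed.

End symbA.

(** After [s + 3] derivatives the order [s] has become -3. The value at 0 is prescribed separately
    because symbol bounds ignore the origin. *)
Lemma symbA_symbol_bound {R : realType} (s : nat) (A : R) (f : R * R -> R) : (0 < s)%N -> f 0 = 0 ->
  (forall e : R * R, e = (1, 0) \/ e = (0, 1) -> symbA e s.+3 s%:Z A f) -> symbol_bound s.+3 s A f.
Proof.
move=> s0 f0 H; split.
- move=> u; have [->|u0] := eqVneq u 0; first by rewrite f0 !normr0 expr0n eqn0Ngt s0 mulr0.
  by have [Hf _] := H _ (or_introl erefl); exact: Hf.
- by move=> e k u he kM u0; have [_] := symbA_iter (H e he) (ltnW kM); apply.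
- move=> e u he u0; have [Hb _] := symbA_iter (H e he) (leqnn _).
  rewrite (le_trans (Hb u u0))// (_ : s%:Z - s.+3%:Z = - 3%:Z); last by lia.
  by rewrite -exprnN.
Qed.

Section quadrature.
Context {R : realType}.
Local Notation mR2 := (measurableTypeR R * measurableTypeR R)%type.
Local Notation mu2 := (@lebesgue2 R).
Implicit Types f g : R * R -> R.

Definition quad_error f : R :=
  \int[mu2]_u f u - \sum_(i \in [set i : int * int | i <> (0, 0)]) f (lattice_point R i).

(** Turns the sum over a finite support into a double sum over a fixed window, where ordinary
    manipulations of sums are available. *)
Lemma lattice_sumE (F : int * int -> R) (A : set (int * int)) (m : nat) :
  (forall i, ~ A i -> F i = 0) ->
  (forall i : int * int, m%:Z <= Num.max `|i.1| `|i.2| -> F i = 0) ->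
  \sum_(i \in A) F i = \sum_(0 <= x < m.*2) \sum_(0 <= y < m.*2) F (x%:Z - m%:Z, y%:Z - m%:Z).
Proof.
move=> FA Fm; rewrite (@fsbig_widen _ _ _ _ A setT F) //; last first.
  by move=> i [_ nA]; exact: FA.
pose h (m : nat) (x : nat) : int := x%:Z - m%:Z.
pose r := [seq (h m x, h m y) | x <- index_iota 0 m.*2, y <- index_iota 0 m.*2].
have hinj (x y : nat) : h m x = h m y -> x = y by rewrite /h; lia.
have ur : uniq r.
  apply: allpairs_uniq; rewrite ?iota_uniq// => -[x y] [x' y'] _ _ /= [] /hinj -> /hinj -> //.
rewrite (fsbigE r) //; last first.
  move=> [i j] _ nr; apply: Fm; rewrite /= leNgt; apply/negP; rewrite gt_max => /andP[hi hj].
  move/negP: nr; apply.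
  have -> : (i, j) = (h m (absz ((i : int) + m%:Z)), h m (absz ((j : int) + m%:Z))).
    by rewrite /h; congr (_, _); lia.
  by apply: allpairs_f; rewrite mem_index_iota; lia.
rewrite big_mkcond /= (eq_bigr F); last by move=> i _; rewrite in_setT.
by rewrite big_allpairs_dep.
Qed.

Lemma norm_lattice_point (i : int * int) : `|lattice_point R i| = (Num.max `|i.1| `|i.2|)%:~R.
Proof.
rewrite norm_pairE /lattice_point /= -!intr_norm.
by case: (leP `|i.1| `|i.2|) => H; [apply: max_r|apply: max_l]; rewrite ler_int// ltW.
Qed.

Lemma lattice_sum_grid f n m : f 0 = 0 -> (forall u, n%:R < `|u| -> f u = 0) -> (n < m)%N ->
  \sum_(i \in [set i : int * int | i <> (0, 0)]) f (lattice_point R i) = grid_sum f m 0.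
Proof.
move=> f0 fn nm; rewrite (@lattice_sumE _ _ m).
- apply: eq_bigr => x _; apply: eq_bigr => y _; rewrite addr0 /lattice_point /grid /=.
  by rewrite !intrB.
- move=> i /= /contrapT ->; rewrite /lattice_point /= (_ : (_, _) = 0) //.
- move=> i mi; apply: fn; rewrite norm_lattice_point.
  by rewrite (lt_le_trans (_ : _ < (m%:Z)%:~R)) ?ler_int// ltr_nat.
Qed.

(** The constant depends on [s] alone and not on the support radius [n]; this is essential, as the
    support of [f(h u)] grows when [h] tends to 0. Since [s > 0], [f] vanishes at the origin and
    omitting that lattice point costs nothing. *)
Lemma trapezoid (s : nat) : (0 < s)%N -> exists2 C : R, 0 <= C &
  forall f A n, symbol_bound s.+3 s A f -> measurable_fun [set: mR2] (f : mR2 -> R) ->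
    (forall u, n%:R < `|u| -> f u = 0) -> `|quad_error f| <= C * A.
Proof.
move=> s0; have [C C0 HC] := @grid_sum_deviation R s.+3 s isT.
exists C => // f A n Hs mf fn; have [Hf _ _] := Hs.
have A0 : 0 <= A.
  by have := le_trans (normr_ge0 _) (Hf (1, 0)); rewrite norm_pair0 normr1 expr1n mulr1.
have f0 : f 0 = 0.
  by have := Hf 0; rewrite normr0 expr0n eqn0Ngt s0 mulr0 normr_le0 => /eqP.
pose m := (n + s.+3).+1.
have nm : (n < m)%N by rewrite ltnS leq_addr.
have fb u : `|f u| <= A * n%:R ^+ s.
  have [un|un] := ltP n%:R `|u|; first by rewrite fn// normr0 mulr_ge0// exprn_ge0.
  by rewrite (le_trans (Hf u))// ler_wpM2l// lerXn2r// nnegrE.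
have [ig Ei] := Rintegral_grid_sum mf fb fn nm.
have i1 : mu2.-integrable setT (EFin \o (\1_(unit_box 0) : mR2 -> R)).
  apply: (@integrable_bounded_support R (\1_(unit_box 0) : mR2 -> R) (unit_box 0) 1) => //.
  - by apply: measurable_indic; exact: measurable_unit_box.
  - exact: measurable_unit_box.
  - by rewrite lebesgue2_unit_box ltry.
  - by move=> u _; rewrite indicE; case: (_ \in _); rewrite ?normr1 ?normr0.
  - by move=> u nu; rewrite indicE memNset.
have int1 : \int[mu2]_u (\1_(unit_box 0) : mR2 -> R) u = 1.
  rewrite /Rintegral integral_indic//; last exact: measurable_unit_box.
  by rewrite setIT lebesgue2_unit_box.
rewrite /quad_error Ei (lattice_sum_grid f0 fn nm).
have iZ c : mu2.-integrable setT (EFin \o (fun u : mR2 => c * (\1_(unit_box 0) : mR2 -> R) u)).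
  exact: (integrableZl measurableT c i1).
have -> : \int[mu2]_t (grid_sum f m t * \1_(unit_box 0) t) - grid_sum f m 0 =
   \int[mu2]_t ((grid_sum f m t - grid_sum f m 0) * \1_(unit_box 0) t).
  rewrite -[X in _ - X]mulr1 -int1 -RintegralZl// -RintegralB//.
  by apply: eq_Rintegral => t _; rewrite mulrBl.
have iB : mu2.-integrable setT (EFin \o (fun t : mR2 => (grid_sum f m t - grid_sum f m 0) * \1_(unit_box 0) t)).
  have := integrableB measurableT ig (iZ (grid_sum f m 0)).
  by apply: eq_integrable => // t _ /=; rewrite mulrBl EFinB.
rewrite (le_trans (le_normr_Rintegral _ iB))//.
rewrite -[leRHS]mulr1 -int1 -RintegralZl//.
apply: le_Rintegral => //.
  exact: (integrable_norm iB).
move=> t _; rewrite indicE; have [tb|tb] := boolP (t \in unit_box 0); last first.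
  by rewrite !mulr0 normr0.
rewrite !mulr1; move: tb; rewrite inE => -[]; rewrite /= !in_itv /= !add0r => /andP[t0 t1] /andP[t2 t3].
by apply: (HC f A n m t Hs fn) => //; rewrite ?t0 ?t2 ltW.
Qed.

Lemma quad_error_sum (I : Type) (r : seq I) (F : I -> R * R -> R) (n : nat) :
  (forall i, mu2.-integrable setT (EFin \o (F i : mR2 -> R))) -> (forall i, F i 0 = 0) ->
  (forall i u, n%:R < `|u| -> F i u = 0) ->
  quad_error (fun u => \sum_(i <- r) F i u) = \sum_(i <- r) quad_error (F i).
Proof.
move=> iF F0 Fn; have [_ ES] := Rintegral_sum r iF.
rewrite /quad_error ES sumrB; congr (_ - _).
rewrite (@lattice_sum_grid (fun u => \sum_(i <- r) F i u) n n.+1)//; last 2 first.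
- by rewrite big1// => i _; rewrite F0.
- by move=> u un; rewrite big1// => i _; rewrite Fn.
rewrite /grid_sum; under [RHS]eq_bigr do rewrite (@lattice_sum_grid (F _) n n.+1 (F0 _) (Fn _) (ltnSn n)).
rewrite /grid_sum [RHS]exchange_big /=; apply: eq_bigr => x _.
by rewrite [RHS]exchange_big.
Qed.

Lemma quad_errorZ (c : R) f : mu2.-integrable setT (EFin \o (f : mR2 -> R)) ->
  quad_error (fun u => c * f u) = c * quad_error f.
Proof.
by move=> i; rewrite /quad_error mulrBr RintegralZl// mulr_fsumr.
Qed.

(** The reflection through the origin preserves both the measure and the punctured lattice. *)
Lemma quad_error_odd f : mu2.-integrable setT (EFin \o (f : mR2 -> R)) ->
  (forall u, f (- u) = - f u) -> quad_error f = 0.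
Proof.
move=> i fN; rewrite /quad_error.
have mf : measurable_fun [set: mR2] (f : mR2 -> R) by apply/measurable_EFinP; exact: measurable_int i.
have -> : \int[mu2]_u f u = 0.
  have := @Rintegral_affine R (-1) 0 f (_ : -1 != 0) mf; rewrite oppr_eq0 oner_eq0 sqrrN expr1n mul1r => /(_ isT).
  have -> : \int[mu2]_u f (affine2 (-1) 0 u) = - \int[mu2]_u f u.
    rewrite -[RHS]mulN1r -RintegralZl//; apply: eq_Rintegral => u _.
    by rewrite mulN1r -fN; congr f; congr (_, _); rewrite /= mulN1r addr0.
  by move=> H; lra.
have -> : \sum_(i \in [set i : int * int | i <> (0, 0)]) f (lattice_point R i) = 0; last by rewrite subrr.
set S := \sum_(_ \in _) _.
suff : S = - S by lra.
rewrite {1}/S (@reindex_fsbig _ _ _ _ _ (fun i : int * int => - i) [set i | i <> (0, 0)] [set i | i <> (0, 0)]).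
  rewrite -mulN1r mulr_fsumr; apply: eq_fsbigr => j _.
  by rewrite mulN1r -fN /lattice_point; congr f; congr (_, _); rewrite /= rmorphN.
split.
- by move=> j /= j0 /eqP; rewrite oppr_eq0 => /eqP.
- by move=> j k _ _ /oppr_inj.
- by move=> j /= j0; exists (- j); rewrite ?opprK//= => /eqP; rewrite oppr_eq0 => /eqP.
Qed.

End quadrature.

(** * Smooth functions and Taylor terms *)

Section Cn_on_algebra.
Context {R : realType} (U : set (R * R)).
Hypothesis oU : open U.
Implicit Types (f g : R * R -> R) (n : nat).

Lemma Cn_on_ext n f g : {in U, f =1 g} -> Cn_on n U f -> Cn_on n U g.
Proof.
elim: n f g => [|n IH] f g fg /= [cf H].
all: have nfg u : U u -> \forall v \near u, f v = g v
  by move=> Uu; apply: filterS (open_nbhs_nbhs (conj oU Uu)) => v Uv; apply: fg; rewrite inE.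
all: have cg : {in U, continuous g}
  by move=> u Uu; rewrite /continuous_at -(fg u Uu); apply: cvg_trans (cf u Uu); apply: near_eq_cvg; apply: nfg; rewrite inE in Uu.
by split.
case: H => df Cu Cv; split; first exact: cg.
split.
- move=> u Uu; have [d1 d2] := df u Uu; split.
    exact: near_eq_derivable (nfg u Uu) d1.
  exact: near_eq_derivable (nfg u Uu) d2.
- by apply: IH Cu; exact: (eq_derive_on (1, 0) oU fg).
- by apply: IH Cv; exact: (eq_derive_on (0, 1) oU fg).
Qed.

Lemma Cn_onD n f g : Cn_on n U f -> Cn_on n U g -> Cn_on n U (f + g).
Proof.
elim: n f g => [|n IH] f g /= [cf Hf] [cg Hg].
all: have c : {in U, continuous (f + g)}
  by move=> u Uu; apply: cvgD; [exact: cf|exact: cg].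
by split.
case: Hf Hg => df Cu Cv [dg Cu' Cv']; split; first exact: c.
split.
- move=> u Uu; have [d1 d2] := df u Uu; have [d1' d2'] := dg u Uu.
  by split; [exact: derivableD d1 d1'|exact: derivableD d2 d2'].
- apply: Cn_on_ext (IH _ _ Cu Cu') => u; rewrite inE => Uu.
  exact: (esym (deriveD (proj1 (df u Uu)) (proj1 (dg u Uu)))).
- apply: Cn_on_ext (IH _ _ Cv Cv') => u; rewrite inE => Uu.
  exact: (esym (deriveD (proj2 (df u Uu)) (proj2 (dg u Uu)))).
Qed.

Lemma Cn_onM n f g : Cn_on n U f -> Cn_on n U g -> Cn_on n U (f * g).
Proof.
elim: n f g => [|n IH] f g; move=> Cf Cg; have [cf Hf] := Cf; have [cg Hg] := Cg.
all: have c : {in U, continuous (f * g)}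
  by move=> u Uu; apply: cvgM; [exact: cf|exact: cg].
by split.
have Cf' := Cn_onW (leqnSn n) Cf; have Cg' := Cn_onW (leqnSn n) Cg.
case: Hf Hg => df Cu Cv [dg Cu' Cv']; split; first exact: c.
split.
- move=> u Uu; have [d1 d2] := df u Uu; have [d1' d2'] := dg u Uu.
  by split; [exact: derivableM d1 d1'|exact: derivableM d2 d2'].
- apply: Cn_on_ext (Cn_onD (IH _ _ Cf' Cu') (IH _ _ Cg' Cu)) => u; rewrite inE => Uu.
  exact: (esym (deriveM (proj1 (df u Uu)) (proj1 (dg u Uu)))).
- apply: Cn_on_ext (Cn_onD (IH _ _ Cf' Cv') (IH _ _ Cg' Cv)) => u; rewrite inE => Uu.
  exact: (esym (deriveM (proj2 (df u Uu)) (proj2 (dg u Uu)))).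
Qed.

Lemma Cn_on_cst n (c : R) : Cn_on n U (cst c).
Proof.
elim: n c => [|n IH] c; (split; first by move=> u _; exact: cvg_cst) => //.
split.
- by move=> u _; split; exact: derivable_cst.
- by apply: Cn_on_ext (IH 0) => u _; exact: (esym (derive_cst _ _ _)).
- by apply: Cn_on_ext (IH 0) => u _; exact: (esym (derive_cst _ _ _)).
Qed.

Lemma Cn_on_fst n : Cn_on n U (fst : R * R -> R).
Proof.
have c : {in U, continuous (fst : R * R -> R)} by move=> u _; exact: cvg_fst.
have D (u e : R * R) := @derive_val _ _ _ _ _ _ _ (is_derive_fst u e).
case: n => [|n]; split => //; split.
- by move=> u _; split; exact: (@ex_derive _ _ _ _ _ _ _ (is_derive_fst _ _)).
- by apply: Cn_on_ext (Cn_on_cst n 1) => u _; exact: (esym (D u (1, 0))).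
- by apply: Cn_on_ext (Cn_on_cst n 0) => u _; exact: (esym (D u (0, 1))).
Qed.

Lemma Cn_on_snd n : Cn_on n U (snd : R * R -> R).
Proof.
have c : {in U, continuous (snd : R * R -> R)} by move=> u _; exact: cvg_snd.
have D (u e : R * R) := @derive_val _ _ _ _ _ _ _ (is_derive_snd u e).
case: n => [|n]; split => //; split.
- by move=> u _; split; exact: (@ex_derive _ _ _ _ _ _ _ (is_derive_snd _ _)).
- by apply: Cn_on_ext (Cn_on_cst n 0) => u _; exact: (esym (D u (1, 0))).
- by apply: Cn_on_ext (Cn_on_cst n 1) => u _; exact: (esym (D u (0, 1))).
Qed.

Lemma Cn_onX n f m : Cn_on n U f -> Cn_on n U (f ^+ m).
Proof.
move=> Cf; elim: m => [|m IH]; first by rewrite expr0; exact: Cn_on_cst.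
by rewrite exprS; exact: Cn_onM.
Qed.

Lemma Cn_on_sum n (I : Type) (s : seq I) (F : I -> R * R -> R) :
  (forall i, Cn_on n U (F i)) -> Cn_on n U (\sum_(i <- s) F i).
Proof.
by move=> HF; elim/big_ind : _ => //; [exact: Cn_on_cst|exact: Cn_onD].
Qed.

Lemma is_derive_coord d (f : R * R -> 'rV[R]_d) (l : 'I_d) (u e : R * R) : derivable f u e ->
  is_derive u e (fun v => f v 0 l) ('D_e f u 0 l).
Proof.
move=> df.
have C : (fun h : R => h^-1 *: (f (h *: e + u) 0 l - f u 0 l)) @ 0^' --> 'D_e f u 0 l.
  have -> : (fun h : R => h^-1 *: (f (h *: e + u) 0 l - f u 0 l)) =
      (fun M : 'rV[R]_d => M 0 l) \o (fun h : R => h^-1 *: (f (h *: e + u) - f u)).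
    by apply/funext => h; rewrite /= !mxE.
  by apply: continuous_cvg; [exact: coord_continuous|exact: df].
by split; [apply/cvg_ex; exists ('D_e f u 0 l)|exact: cvg_lim C].
Qed.

Lemma Cn_on_coord n d (f : R * R -> 'rV[R]_d) (l : 'I_d) : Cn_on n U f -> Cn_on n U (fun u => f u 0 l).
Proof.
elim: n f => [|n IH] f [cf Hf].
all: have c : {in U, continuous (fun u => f u 0 l)}
  by move=> u Uu; exact: (@continuous_comp _ _ _ f (fun M : 'rV[R]_d => M 0 l) u (cf u Uu) (@coord_continuous _ _ _ _ _ _)).
by split.
case: Hf => df Cu Cv; split; first exact: c.
split.
- move=> u Uu; split.
    exact: (@ex_derive _ _ _ _ _ _ _ (is_derive_coord l (proj1 (df u Uu)))).
  exact: (@ex_derive _ _ _ _ _ _ _ (is_derive_coord l (proj2 (df u Uu)))).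
- apply: Cn_on_ext (IH _ Cu) => u; rewrite inE => Uu.
  exact: (esym (@derive_val _ _ _ _ _ _ _ (is_derive_coord l (proj1 (df u Uu))))).
- apply: Cn_on_ext (IH _ Cv) => u; rewrite inE => Uu.
  exact: (esym (@derive_val _ _ _ _ _ _ _ (is_derive_coord l (proj2 (df u Uu))))).
Qed.

End Cn_on_algebra.

Section taylor_terms.
Context {R : realType}.
Implicit Types (f g : R * R -> R) (n : nat).

Lemma taylor_termZ f k (t : R) (u : R * R) : taylor_term f k (t *: u) = t ^+ k * taylor_term f k u.
Proof.
rewrite /taylor_term mulr_sumr; apply: eq_bigr => i _ /=.
rewrite -[t *: u.1]/(t * u.1) -[t *: u.2]/(t * u.2) !exprMn.
have -> : t ^+ k = t ^+ i * t ^+ (k - i) by rewrite -exprD subnKC// -ltnS.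
by move: (t ^+ i) (t ^+ (k - i)) => p q; ring.
Qed.

(** By strong induction the Taylor polynomial up to degree [k] reduces to its last term. Evaluated
    at [t *: u] and divided by [t^k], the hypothesis bounds that term by a multiple of [t]. *)
Lemma taylor_term_eq0 (a : R) U n N f : 0 < a -> open U -> square a `<=` U -> Cn_on n U f -> (N <= n)%N ->
  (exists A : R, forall u, square a u -> u != 0 -> `|f u| <= A * `|u| ^ N%:Z) ->
  forall k u, (k < N)%N -> taylor_term f k u = 0.
Proof.
move=> a0 oU aU Cf Nn [A HA].
elim/ltn_ind => k IH u kN.
have [u0|u0] := eqVneq u 0.
  rewrite u0; case: k kN {IH} => [|k] kN; last first.
    by rewrite -(scale0r 0) taylor_termZ expr0n mul0r.
  have : forall t : R, 0 < t <= a -> `|f 0| <= 0; last first.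
    move=> /(_ a); rewrite a0 lexx => /(_ isT); rewrite normr_le0 => /eqP f0.
    by rewrite (taylor_term_at0 f 0).
  move=> t _; rewrite leNgt; apply/negP => f0.
  have C0 : {for (0 : R * R), continuous f}.
    by apply: Cn_on_continuous Cf _; apply: aU; rewrite /square /= normr0 ltW.
  have /cvgrPdist_lt/(_ (`|f 0| / 2)) := C0; rewrite divr_gt0// => /(_ isT).
  move=> /nbhs_ballP[d /= d0 Hd].
  (* The bound excludes the origin, so [f 0] is reached by continuity: [b] must stay in the ball and
     the square, satisfy [b^N <= b], and make the bound at most half of [|f 0|]. *)
  pose b := Num.min (Num.min (d / 2) a) (Num.min 1 (`|f 0| / (2 * (`|A| + 1)))).
  have A1 : 0 < `|A| + 1 by rewrite ltr_wpDl.
  have b0 : 0 < b by rewrite !lt_min a0 ltr01 !divr_gt0// mulr_gt0.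
  have nb : `|(b, 0) : R * R| = b by rewrite norm_pair0 gtr0_norm.
  have sb : square a (b, 0) by rewrite /square /= nb /b !ge_min lexx !orbT.
  have bn0 : ((b, 0) : R * R) != 0 by rewrite -normr_gt0 nb.
  have Bb : ball (0 : R * R) d (b, 0).
    rewrite -ball_normE /= sub0r normrN nb (@le_lt_trans _ _ (d / 2))//; last by lra.
    by rewrite /b !ge_min lexx.
  have H1 := Hd _ Bb; have H2 := HA _ sb bn0; rewrite /= in H1.
  have H3 : A * `|(b, 0) : R * R| ^ N%:Z <= `|f 0| / 2.
    rewrite nb -exprnP; apply: (@le_trans _ _ ((`|A| + 1) * b)).
      apply: (@le_trans _ _ ((`|A| + 1) * b ^+ N)).
        rewrite ler_wpM2r ?exprn_ge0 ?ltW//; rewrite (lt_le_trans (_ : _ < `|A| + 1))//.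
        by rewrite (le_lt_trans (ler_norm _))// ltrDl.
      rewrite ler_wpM2l ?(ltW A1)//; case: N kN {HA H2 Nn} => // N _.
      rewrite exprS ler_piMr ?(ltW b0)// exprn_ile1 ?(ltW b0)//.
      by rewrite /b !ge_min lexx !orbT.
    rewrite mulrC -ler_pdivlMr// (le_trans (_ : _ <= `|f 0| / (2 * (`|A| + 1))))//.
      by rewrite /b !ge_min lexx !orbT.
    by rewrite invfM mulrA.
  have := ler_normB (f 0 - f (b, 0)) (- f (b, 0)); rewrite opprK subrK normrN; lra.
have [A' HA'] := taylor_bound a0 oU aU (Cn_onW (leq_trans kN Nn) Cf).
have nu : 0 < `|u| by rewrite normr_gt0.
pose B := `|A| * a ^+ (N - k.+1) + `|A'|.
have B0 : 0 <= B by rewrite addr_ge0// mulr_ge0// exprn_ge0// ltW.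
have H t : 0 < t -> t * `|u| <= a -> `|taylor_term f k u| <= B * t * `|u| ^+ k.+1.
  move=> t0 ta.
  have ntu : `|t *: u| = t * `|u| by rewrite normrZ gtr0_norm.
  have su : square a (t *: u) by rewrite /square /= ntu.
  have tu0 : t *: u != 0 by rewrite scaler_eq0 negb_or u0 gt_eqF.
  have E : taylor_poly f k.+1 (t *: u) = t ^+ k * taylor_term f k u.
    rewrite /taylor_poly big_ord_recr /= big1 ?add0r ?taylor_termZ// => i _.
    by apply: IH => //; exact: ltn_trans kN.
  have := HA' _ su; rewrite E => H2.
  have H1 := HA _ su tu0.
  have H3 : `|t ^+ k * taylor_term f k u| <= B * (t * `|u|) ^+ k.+1.
    have := ler_normB (f (t *: u)) (f (t *: u) - t ^+ k * taylor_term f k u).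
    rewrite opprB addrC subrK => /le_trans; apply.
    rewrite mulrDl lerD//.
      rewrite (le_trans H1)// ntu -exprnP -mulrA.
      rewrite (le_trans (ler_wpM2r _ (ler_norm A))) ?exprn_ge0 ?mulr_ge0 ?(ltW t0)//.
      rewrite ler_wpM2l// -{1}(subnK kN) exprD ler_wpM2r ?exprn_ge0 ?mulr_ge0 ?(ltW t0)//.
      by rewrite lerXn2r// ?nnegrE ?mulr_ge0 ?(ltW t0) ?(ltW a0).
    by rewrite (le_trans H2)// ntu ler_wpM2r ?ler_norm ?exprn_ge0 ?mulr_ge0 ?(ltW t0).
  move: H3; rewrite normrM gtr0_norm ?exprn_gt0// exprMn [t ^+ k.+1]exprS.
  rewrite (_ : B * (t * t ^+ k * `|u| ^+ k.+1) = t ^+ k * (B * t * `|u| ^+ k.+1)); last by ring.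
  by rewrite ler_pM2l// exprn_gt0.
apply/eqP; rewrite -normr_le0 leNgt; apply/negP => T0.
pose D := B * `|u| ^+ k.+1 + 1.
have D0 : 0 < D by rewrite ltr_wpDl// mulr_ge0// exprn_ge0.
(* The second entry makes [t * D] at most half of the Taylor term, contradicting [H]; the first
   keeps [t *: u] in the square. *)
pose t := Num.min (a / `|u|) (`|taylor_term f k u| / (2 * D)).
have t0 : 0 < t by rewrite lt_min !divr_gt0// mulr_gt0.
have ta : t * `|u| <= a by rewrite -ler_pdivlMr// /t ge_min lexx.
have := H t t0 ta.
have : B * t * `|u| ^+ k.+1 <= t * D by rewrite /D mulrDr mulr1 mulrAC mulrC lerDl ltW.
have : t * D <= `|taylor_term f k u| / 2.
  rewrite -ler_pdivlMr// (_ : _ / D = `|taylor_term f k u| / (2 * D)) ?ge_min ?lexx ?orbT//.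
  by rewrite invfM mulrA.
by move: T0; lra.
Qed.

Lemma sum_triangle (F : nat -> nat -> R) D :
  \sum_(0 <= i < D) \sum_(0 <= j < D - i) F i j = \sum_(0 <= d < D) \sum_(0 <= i < d.+1) F i (d - i)%N.
Proof.
elim: D => [|D IH]; first by rewrite !big_nil.
rewrite [RHS]big_nat_recr//= -IH big_nat_recr//= subSnn big_nat1.
rewrite [X in _ = _ + X]big_nat_recr//= subnn addrA; congr (_ + _).
rewrite -big_split; apply: eq_big_nat => i /andP[_ iD].
by rewrite subSn ?(ltnW iD)// big_nat_recr.
Qed.

End taylor_terms.

Lemma symbS {R : realType} (B B' V V' : set (R * R)) e M s (f : R * R -> R) :
  B' `<=` B -> V' `<=` V -> symb B V e M s f -> symb B' V' e M s f.
Proof.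
move=> BB VV; elim: M s f => [|M IH] s f /= [[A HA] Hf].
  by split=> //; exists A => u /BB Bu; exact: HA.
case: Hf => df Hf; split; first by exists A => u /BB Bu; exact: HA.
by split; [move=> u /VV Vu; exact: df|exact: IH].
Qed.

(** * The distance function of the patch *)

Section dot_product.
Context {R : realType} (d : nat).
Implicit Types x y : 'rV[R]_d.

Lemma dot_ge0 x : 0 <= dot x x.
Proof. by apply: sumr_ge0 => l _; rewrite -expr2 sqr_ge0. Qed.

Lemma dot_gt0 x : x != 0 -> 0 < dot x x.
Proof.
move=> x0; rewrite lt_neqAle dot_ge0 andbT eq_sym; apply: contra x0 => /eqP xx.
apply/eqP/rowP => l; rewrite mxE; have /eqP := xx.
rewrite psumr_eq0; last by move=> i _; rewrite -expr2 sqr_ge0.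
by move=> /allP/(_ l); rewrite mem_index_enum => /(_ isT); rewrite mulf_eq0 orbb => /eqP.
Qed.

Lemma enorm2 x : enorm x ^+ 2 = dot x x.
Proof. by rewrite sqr_sqrtr// dot_ge0. Qed.

Lemma dot_comb (s t : R) x y : dot (s *: x + t *: y) (s *: x + t *: y) =
  dot x x * s ^+ 2 + 2 * dot x y * s * t + dot y y * t ^+ 2.
Proof.
rewrite /dot !mulr_suml mulr_sumr !mulr_suml -!big_split /=.
by apply: eq_bigr => l _; rewrite !mxE; ring.
Qed.

End dot_product.

(** * Positive definite binary quadratic forms *)

Section quadratic_form.
Context {R : realType} (E F G : R).

Definition qform (u : R * R) : R := E * u.1 ^+ 2 + 2 * F * u.1 * u.2 + G * u.2 ^+ 2.

Lemma qformZ (t : R) (u : R * R) : qform (t *: u) = t ^+ 2 * qform u.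
Proof. by rewrite /qform /= -[t *: u.1]/(t * u.1) -[t *: u.2]/(t * u.2); ring. Qed.

(** Completing the square in either variable bounds the determinant times [u.1^2] or [u.2^2] by [G]
    or [E] times the form, so determinant over trace is a valid constant. The vector [(- F, E)]
    shows that the determinant is positive. *)
Lemma qform_lower : (forall u, u != 0 -> 0 < qform u) ->
  exists2 c : R, 0 < c & forall u, c * `|u| ^+ 2 <= qform u.
Proof.
move=> Q_gt0.
have n1 : ((1, 0) : R * R) != 0 by rewrite xpair_eqE oner_eq0.
have n2 : ((0, 1) : R * R) != 0 by rewrite xpair_eqE oner_eq0 andbF.
have E0 : 0 < E by have := Q_gt0 _ n1; rewrite /qform /=; lra.
have G0 : 0 < G by have := Q_gt0 _ n2; rewrite /qform /=; lra.
have n3 : ((- F, E) : R * R) != 0 by rewrite xpair_eqE (gt_eqF E0) andbF.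
have D0 : 0 < E * G - F ^+ 2.
  have := Q_gt0 _ n3; rewrite /qform /=.
  rewrite (_ : _ + _ + _ = E * (E * G - F ^+ 2)); last by ring.
  by rewrite pmulr_rgt0.
exists ((E * G - F ^+ 2) / (E + G)); first by rewrite divr_gt0// addr_gt0.
move=> u; rewrite mulrAC ler_pdivrMr ?addr_gt0//.
have H1 : (E * G - F ^+ 2) * u.2 ^+ 2 <= E * qform u.
  rewrite -subr_ge0 (_ : _ - _ = (E * u.1 + F * u.2) ^+ 2) ?sqr_ge0//.
  by rewrite /qform; ring.
have H2 : (E * G - F ^+ 2) * u.1 ^+ 2 <= G * qform u.
  rewrite -subr_ge0 (_ : _ - _ = (G * u.2 + F * u.1) ^+ 2) ?sqr_ge0//.
  by rewrite /qform; ring.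
have Q0 : 0 <= qform u.
  have [->|/Q_gt0/ltW//] := eqVneq u 0; by rewrite /qform /=; lra.
have EQ : 0 <= E * qform u by rewrite mulr_ge0// ltW.
have GQ : 0 <= G * qform u by rewrite mulr_ge0// ltW.
rewrite norm_pairE; case: (leP `|u.1| `|u.2|) => _; rewrite real_normK ?num_real//; lra.
Qed.

Lemma symb_qform (B V : set (R * R)) e M : open V -> B `<=` V -> symb B V e M 2 qform.
Proof.
move=> oV BV.
have := symbD oV BV (symbD oV BV (symb_monomial e oV BV M E 2 0) (symb_monomial e oV BV M (2 * F) 1 1)) (symb_monomial e oV BV M G 0 2).
apply: symb_ext => // u _ _; rewrite /qform !fctE.
by rewrite !expr0 !expr1 !mulr1.
Qed.

Lemma Cn_on_qform n (U : set (R * R)) : open U -> Cn_on n U qform.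
Proof.
move=> oU; have Cc c := Cn_on_cst oU n c.
have := Cn_onD oU (Cn_onD oU (Cn_onM oU (Cc E) (Cn_onX oU 2 (Cn_on_fst oU n)))
  (Cn_onM oU (Cn_onM oU (Cc (2 * F)) (Cn_on_fst oU n)) (Cn_on_snd oU n)))
  (Cn_onM oU (Cc G) (Cn_onX oU 2 (Cn_on_snd oU n))).
by apply: Cn_on_ext => // u _; rewrite /qform !fctE !exprfctE.
Qed.

Lemma continuous_qform : continuous qform.
Proof. by move=> u; exact: (Cn_on_continuous (Cn_on_qform 0 openT) (I : setT u)). Qed.

End quadratic_form.

Section patch.
Context {R : realType} (a : R) (r : R * R -> 'rV[R]_3).
Hypotheses (a0 : 0 < a) (r_patch : regular_patch a r).
Local Notation Q := (fundamental_form r).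

Lemma square0 : square a (0 : R * R).
Proof. by rewrite /square /= normr0 ltW. Qed.

Lemma fundamental_form_qform : Q = qform (dot (Du r (0, 0)) (Du r (0, 0)))
  (dot (Du r (0, 0)) (Dv r (0, 0))) (dot (Dv r (0, 0)) (Dv r (0, 0))).
Proof. by []. Qed.

Lemma fundamental_formE (u : R * R) :
  Q u = dot (u.1 *: Du r (0, 0) + u.2 *: Dv r (0, 0)) (u.1 *: Du r (0, 0) + u.2 *: Dv r (0, 0)).
Proof. by rewrite dot_comb. Qed.

Lemma fundamental_form_gt0 u : u != 0 -> 0 < Q u.
Proof.
move=> u0; rewrite fundamental_formE; apply: dot_gt0; apply: contra u0 => /eqP E.
have := patch_free r_patch square0; move/freeP.
move=> /(_ (fun i : 'I_2 => if i == 0 then u.1 else u.2)).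
rewrite big_ord_recl big_ord1 /= => /(_ E) H.
have u1 := H 0; have u2 := H 1; rewrite /= in u1 u2.
by rewrite [u]surjective_pairing u1 u2.
Qed.

(** [Q] is the sum of the squares of the linear Taylor polynomials of the coordinates of [r]. Each
    difference of squares factors into a remainder of order 2 and a sum of order 1. *)
Lemma symb_sqdist_sub_form : exists U : set (R * R), [/\ open U, square a `<=` U,
  forall n, Cn_on n U (fun u => enorm (r u) ^+ 2 - Q u),
  (forall e M, e = (1, 0) \/ e = (0, 1) -> symb (square a) U e M 3 (fun u => enorm (r u) ^+ 2 - Q u)) &
  {in U, continuous (fun u => enorm (r u) ^+ 2)}].
Proof.
have [U [oU aU CU]] := patch_smooth r_patch.
pose rl (l : 'I_3) (u : R * R) := r u 0 l.
have Crl l n : Cn_on n U (rl l) by exact: Cn_on_coord.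
have dr : derivable r 0 ((1, 0) : R * R) /\ derivable r 0 ((0, 1) : R * R).
  by have [_ [H _ _]] := CU 1%N; apply: H; apply: aU; exact: square0.
have Tl l u : taylor_poly (rl l) 2 u = u.1 * Du r (0, 0) 0 l + u.2 * Dv r (0, 0) 0 l.
  rewrite /taylor_poly !big_ord_recl big_ord0 addr0 /taylor_term !big_ord_recl !big_ord0 /=.
  rewrite /partial /= (_ : Du (rl l) (0, 0) = Du r (0, 0) 0 l); last first.
    exact: (@derive_val _ _ _ _ _ _ _ (is_derive_coord l (proj1 dr))).
  rewrite (_ : Dv (rl l) (0, 0) = Dv r (0, 0) 0 l); last first.
    exact: (@derive_val _ _ _ _ _ _ _ (is_derive_coord l (proj2 dr))).
  have rl0 : rl l (0, 0) = 0 by rewrite /rl (patch0 r_patch) mxE.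
  rewrite rl0; move: (Du r (0, 0) 0 l) (Dv r (0, 0) 0 l) => p q.
  rewrite (_ : bump 0 0 = 1%N) // !subnn subn0 fact0 (_ : 1`! = 1%N) // !muln1 !divr1.
  by rewrite !expr0 !expr1; ring.
have QE u : Q u = \sum_(l < 3) taylor_poly (rl l) 2 u ^+ 2.
  rewrite fundamental_formE /dot; apply: eq_bigr => l _.
  rewrite -expr2; congr (_ ^+ 2); rewrite {}(Tl l u).
  by move: (Du r (0, 0)) (Dv r (0, 0)) => p q; rewrite !mxE.
have rE u : enorm (r u) ^+ 2 = \sum_(l < 3) rl l u ^+ 2.
  by rewrite enorm2 /dot; apply: eq_bigr => l _; rewrite expr2.
have CrE n : Cn_on n U (fun u => enorm (r u) ^+ 2).
  have := Cn_on_sum oU (index_enum 'I_3) (fun l => Cn_onX oU 2 (Crl l n)).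
  apply: Cn_on_ext => // u _; rewrite rE fct_sumE; apply: eq_bigr => l _.
  by rewrite exprfctE.
have CQ n : Cn_on n U Q by rewrite fundamental_form_qform; exact: Cn_on_qform.
exists U; split => //.
- move=> n; have := Cn_onD oU (CrE n) (Cn_onM oU (Cn_on_cst oU n (-1)) (CQ n)).
  by apply: Cn_on_ext => // u _; rewrite !fctE mulN1r.
- move=> e M he.
  have H l : symb (square a) U e M 3 ((rl l - taylor_poly (rl l) 2) * (rl l + taylor_poly (rl l) 2)).
    have Sd : symb (square a) U e M 2 (rl l - taylor_poly (rl l) 2).
      by apply: (symb_taylor (n := (maxn M 2)) he a0 oU aU) => //; rewrite ?leq_maxl ?leq_maxr.
    have Sd1 : symb (square a) U e M 1 (rl l - taylor_poly (rl l) 2).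
      by apply: (symb_le (b := a)) Sd => //; exact: (fun u (su : square a u) => su).
    have ST : symb (square a) U e M 1 (taylor_poly (rl l) 2).
      rewrite taylor_polyE !big_ord_recl big_ord0 addr0 /=.
      rewrite (_ : taylor_term (rl l) 0 = cst 0); last first.
        apply/funext => u; rewrite /taylor_term big_ord1 /partial /= /rl (patch0 r_patch) mxE.
        by rewrite !mul0r.
      by rewrite add0r; exact: symb_taylor_term.
    (* The sum is written as the remainder, weakened to order 1, plus twice the linear part. *)
    have SS : symb (square a) U e M 1 (rl l + taylor_poly (rl l) 2).
      have := symbD oU aU (symbD oU aU Sd1 ST) ST.
      by apply: symb_ext => // u _ _; rewrite !fctE subrK.
    exact: (symbM oU aU Sd SS).
  have := @symb_sum _ _ _ e oU aU _ (index_enum 'I_3) xpredT M 3 _ (fun l _ => H l).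
  apply: symb_ext => // u _ _; rewrite rE QE fct_sumE -sumrB; apply: eq_bigr => l _.
  by rewrite !fctE subr_sqr.
- by have [c _] := CrE 0%N.
Qed.

End patch.

Section lower_bound.
Context {R : realType} (a : R) (r : R * R -> 'rV[R]_3).
Hypotheses (a0 : 0 < a) (r_patch : regular_patch a r).
Local Notation Q := (fundamental_form r).

Lemma near_square : \forall u \near (0 : R * R), square a u.
Proof.
apply/nbhs_ballP; exists a => // u; rewrite -ball_normE /= sub0r normrN => ua.
exact: ltW.
Qed.

Lemma fundamental_form_lower : exists2 c : R, 0 < c & forall u, c * `|u| ^+ 2 <= Q u.
Proof.
have := @fundamental_form_gt0 _ _ _ a0 r_patch; rewrite fundamental_form_qform => H.
exact: qform_lower.
Qed.

Lemma sqdist_gt0 u : square a u -> u != 0 -> 0 < enorm (r u) ^+ 2.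
Proof.
move=> su u0; rewrite enorm2; apply: dot_gt0; apply: contra u0 => /eqP ru0.
apply/eqP; apply: (patch_inj r_patch); rewrite ?inE//; first exact: square0.
by rewrite ru0 (patch0 r_patch).
Qed.

(** Near the origin [Q] dominates the cubic difference. On the rest of the square the distance has a
    positive minimum, by compactness and injectivity of the patch. *)
Lemma sqdist_lower : exists2 c : R, 0 < c & forall u, square a u -> c * `|u| ^+ 2 <= enorm (r u) ^+ 2.
Proof.
have [cQ cQ0 HQ] := fundamental_form_lower.
have [U [oU aU _ SD cU]] := symb_sqdist_sub_form a0 r_patch.
have [[A HA] _] := SD (1, 0) 0%N (or_introl erefl).
(* For [|u| <= de] the cubic error is at most half of the lower bound for [Q]. *)
pose de := cQ / 2 / (`|A| + 1).
have A1 : 0 < `|A| + 1 by rewrite ltr_wpDl.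
have de0 : 0 < de by rewrite !divr_gt0.
have near0 u : square a u -> `|u| <= de -> cQ / 2 * `|u| ^+ 2 <= enorm (r u) ^+ 2.
  move=> su ude; have [->|u0] := eqVneq u 0.
    by rewrite normr0 expr0n mulr0 sqr_ge0.
  have H1 := HQ u; have := HA u su u0; rewrite ler_norml => /andP[H2 _].
  have H3 : A * `|u| ^ 3 <= cQ / 2 * `|u| ^+ 2.
    rewrite -exprnP exprS mulrA ler_wpM2r ?exprn_ge0//.
    rewrite (@le_trans _ _ ((`|A| + 1) * de))//; last by rewrite /de mulrC divfK ?gt_eqF.
    rewrite (@le_trans _ _ (`|A| * `|u|)) ?ler_wpM2r ?ler_norm//.
    by rewrite ler_pM// lerDl.
  by move: H1 H2 H3; move: (`|u| ^+ 2) (A * _) (Q u) (enorm _ ^+ 2) => p q t v; lra.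
pose K := square a `&` [set u : R * R | de <= `|u|].
have [[k0 Kk0]|K0] := pselect (K !=set0); last first.
  exists (cQ / 2); first by rewrite divr_gt0.
  move=> u su; apply: near0 => //; rewrite leNgt; apply/negP => /ltW ud.
  by apply: K0; exists u.
have cK : compact K.
  apply: compact_closedI; first exact: compact_square.
  rewrite (_ : [set u : R * R | _] = Num.norm @^-1` [set x | de <= x])//.
  apply: closed_comp; last exact: closed_ge.
  by move=> u _; exact: norm_continuous.
have [|c Kc Hc] := @compact_EVT_min _ R (fun u => enorm (r u) ^+ 2) _ (ex_intro _ k0 Kk0) cK.
  apply: continuous_in_subspaceT => u; rewrite inE => -[su _].
  by apply: cU; rewrite inE; exact: aU.
move: Kc; rewrite inE => -[sc dc].
have c0 : c != 0 by rewrite -normr_gt0 (lt_le_trans de0).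
have mc := sqdist_gt0 sc c0.
exists (Num.min (cQ / 2) (enorm (r c) ^+ 2 / a ^+ 2)).
  by rewrite lt_min !divr_gt0// exprn_gt0.
move=> u su; have [ud|ud] := leP `|u| de.
  by rewrite (le_trans _ (near0 u su ud))// ler_wpM2r ?exprn_ge0// ge_min lexx.
rewrite (@le_trans _ _ (enorm (r c) ^+ 2)) ?Hc//; last by rewrite inE; split=> //; exact: ltW.
rewrite (@le_trans _ _ (enorm (r c) ^+ 2 / a ^+ 2 * a ^+ 2))//.
  rewrite (@le_trans _ _ (enorm (r c) ^+ 2 / a ^+ 2 * `|u| ^+ 2))//.
    by rewrite ler_wpM2r ?exprn_ge0// ge_min lexx orbT.
  have ua : `|u| <= a := su.
  apply: ler_wpM2l; first by rewrite divr_ge0 ?sqr_ge0.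
  by rewrite lerXn2r ?nnegrE ?normr_ge0 ?(ltW a0).
by rewrite divfK// expf_neq0// gt_eqF.
Qed.

End lower_bound.

(** * Taylor remainder of a product, sorted by total degree *)

Section product_taylor.
Context {R : realType} (a : R) (U : set (R * R)) (e : R * R).
Hypotheses (a0 : 0 < a) (oU : open U) (aU : square a `<=` U) (he : e = (1, 0) \/ e = (0, 1)).
Implicit Types (f g : R * R -> R).

Lemma symb_smooth f M : Cn_on M U f -> symb (square a) U e M 0 f.
Proof.
move=> Cf; have := symb_taylor he a0 oU aU (leqnn M) (leq0n M) Cf.
apply: symb_ext => // u _ _; by rewrite !fctE /taylor_poly big_ord0 subr0.
Qed.

(** With [F] and [G] the Taylor polynomials, the difference is [(f - F) g + F (g - G)] plus the part
    of [F G] of total degree at least [D]. Each piece has order [D]. *)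
Lemma symb_product_taylor f g M D : (forall n, Cn_on n U f) -> (forall n, Cn_on n U g) ->
  symb (square a) U e M D%:Z (fun u => f u * g u -
    \sum_(0 <= d < D) \sum_(0 <= i < d.+1) taylor_term f i u * taylor_term g (d - i) u).
Proof.
move=> Cf Cg.
have Tf := symb_taylor he a0 oU aU (leq_maxl M D) (leq_maxr M D) (Cf (maxn M D)).
have Tg := symb_taylor he a0 oU aU (leq_maxl M D) (leq_maxr M D) (Cg (maxn M D)).
have H0 : symb (square a) U e M 0 (taylor_poly f D).
  rewrite taylor_polyE; apply: symb_sum => // i _.
  by apply: (symb_le (b := a) _ _ (symb_taylor_term e oU aU M f i)).
have S1 := symbM oU aU Tf (symb_smooth (Cg M)).
have S2 := symbM oU aU H0 Tg.
rewrite addr0 in S1; rewrite add0r in S2.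
have S3 : symb (square a) U e M D%:Z (\sum_(0 <= i < D) \sum_(D - i <= j < D) taylor_term f i * taylor_term g j).
  rewrite !big_seq; apply: symb_sum => // i; rewrite mem_index_iota => /andP[_ iD].
  rewrite big_seq; apply: symb_sum => // j; rewrite mem_index_iota => /andP[ij jD].
  have := symbM oU aU (symb_taylor_term e oU aU M f i) (symb_taylor_term e oU aU M g j).
  by apply: (symb_le (b := a)) => //; lia.
have := symbD oU aU (symbD oU aU S1 S2) S3.
apply: symb_ext => // u _ _; rewrite -(sum_triangle (fun i j => taylor_term f i u * taylor_term g j u)) !fctE !fct_sumE.
have -> : \sum_(0 <= i < D) (\sum_(D - i <= j < D) taylor_term f i * taylor_term g j) u =
  taylor_poly f D u * taylor_poly g D u - \sum_(0 <= i < D) \sum_(0 <= j < D - i) taylor_term f i u * taylor_term g j u.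
  have TE h : taylor_poly h D u = \sum_(0 <= i < D) taylor_term h i u by rewrite big_mkord.
  rewrite !TE mulr_suml -sumrB; apply: eq_bigr => i _.
  rewrite mulr_sumr fct_sumE.
  rewrite [X in X - _](@big_cat_nat _ _ _ (D - i)) ?leq_subr//=.
  rewrite [RHS]addrC addKr; by apply: eq_bigr => j _; rewrite fctE.
ring.
Qed.

End product_taylor.

(** * Homogeneous expansion of the density *)

(* Homogeneous of degree d - 2m - 1; the coefficient Ctilde m k is the quadrature
   error of density_term m (2(m + k - 1)) cut off by eta(h u). *)
Definition density_term {R : realType} (r : R * R -> 'rV[R]_3) (P : R * R -> R) (m d : nat) (u : R * R) : R :=
  gbinom (- 2^-1) m * \sum_(rho < d.+1) \sum_(s < d.+1 | (rho + s == d)%N && (3 * m <= rho)%N)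
    (q_term r m rho u * taylor_term P s u / fundamental_form r u `^ (m%:R + 2^-1)).

Section density_terms.
Context {R : realType} (a : R) (r : R * R -> 'rV[R]_3) (P : R * R -> R).
Hypotheses (a0 : 0 < a) (r_patch : regular_patch a r).
Local Notation Q := (fundamental_form r).
Local Notation T := (density_term r P).

(** Writes every denominator as an odd power of [Q^(-1/2)], so that a single fractional power enters
    the symbol calculus. *)
Lemma powR_half_odd (x : R) m : (x `^ (m%:R + 2^-1))^-1 = (x `^ (- 2^-1)) ^+ (2 * m).+1.
Proof.
rewrite -powRN -powR_mulrn ?powR_ge0// -powRrM; congr (_ `^ _).
by rewrite -[(2 * m).+1%:R]natr1 natrM; field.
Qed.

Lemma fundamental_formZ (t : R) u : Q (t *: u) = t ^+ 2 * Q u.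
Proof. by rewrite fundamental_form_qform; exact: qformZ. Qed.

Lemma fundamental_form_at0 : Q 0 = 0.
Proof. by rewrite -(scale0r (0 : R * R)) fundamental_formZ expr0n mul0r. Qed.

Lemma fundamental_form_ge0 u : 0 <= Q u.
Proof.
have [->|u0] := eqVneq u 0; first by rewrite fundamental_form_at0.
exact/ltW/(fundamental_form_gt0 a0 r_patch).
Qed.

Lemma q_term_eq0 m k u : (k < 3 * m)%N -> q_term r m k u = 0.
Proof.
move=> km; have [U [oU aU CD SD _]] := symb_sqdist_sub_form a0 r_patch.
rewrite /q_term; apply: (taylor_term_eq0 (n := (3 * m)%N) a0 oU aU) km => //.
  have := Cn_onX oU m (CD (3 * m)%N).
  by apply: Cn_on_ext => // v _; rewrite exprfctE.
have [[A HA] _] := symbX oU aU m (SD (1, 0) 0%N (or_introl erefl)).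
by exists A => v sv v0; have := HA v sv v0; rewrite exprfctE.
Qed.

Lemma density_termE m d u : T m d u =
  gbinom (- 2^-1) m * ((\sum_(0 <= i < d.+1) q_term r m i u * taylor_term P (d - i) u) *
    (Q u `^ (- 2^-1)) ^+ (2 * m).+1).
Proof.
rewrite /density_term; congr (_ * _); rewrite big_mkord mulr_suml; apply: eq_bigr => i _.
have [mi|im] := leqP (3 * m) i; last first.
  by rewrite q_term_eq0// !mul0r big_pred0// => s; rewrite andbF.
have di : (d - i < d.+1)%N by rewrite ltnS leq_subr.
rewrite (big_pred1 (Ordinal di)) ?powR_half_odd// => s.
rewrite andbT -[RHS]val_eqE /=; have := ltn_ord i; lia.
Qed.

(** For [d = 2 (m + k - 1)] the hypothesis reads [2k - 2 < m]; this is why the sum in [Ccoef] stops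
    at [2k - 2]. *)
Lemma density_term_eq0 m d u : (d < 3 * m)%N -> T m d u = 0.
Proof.
move=> dm; rewrite density_termE big_nat_cond big1 ?mul0r ?mulr0// => i.
by rewrite andbT => /andP[_ id]; rewrite q_term_eq0 ?mul0r//; lia.
Qed.

(** A convention rather than a limit: a nonzero power of 0 is 0, and so is the inverse of 0. *)
Lemma density_term_at0 m d : T m d 0 = 0.
Proof.
rewrite density_termE fundamental_form_at0; by rewrite powRN powR0 ?invr_eq0 ?pnatr_eq0// invr0 expr0n !mulr0.
Qed.

Lemma density_termZ m d (h : R) u : 0 < h ->
  T m d (h *: u) * h ^+ (2 * m).+1 = h ^+ d * T m d u.
Proof.
move=> h0; rewrite !density_termE fundamental_formZ.
have hn : h ^+ (2 * m).+1 != 0 by rewrite expf_neq0// gt_eqF.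
rewrite powRM ?sqr_ge0//; last exact: fundamental_form_ge0.
have -> : (h ^+ 2) `^ (- 2^-1) = h^-1.
  by rewrite -powR_mulrn ?(ltW h0)// -powRrM mulrN divff ?pnatr_eq0// powRN powRr1// ltW.
rewrite exprMn exprVn.
have -> : \sum_(0 <= i < d.+1) q_term r m i (h *: u) * taylor_term P (d - i) (h *: u) =
   h ^+ d * \sum_(0 <= i < d.+1) q_term r m i u * taylor_term P (d - i) u.
  rewrite mulr_sumr; apply: eq_big_nat => i /andP[_ id].
  by rewrite /q_term !taylor_termZ mulrACA -exprD subnKC.
move: (gbinom _ _) (\sum_(_ <= _ < _) _) (h ^+ d) (Q u `^ _ ^+ _) (h ^+ _) hn => x y z t p pn.
by field.
Qed.

Lemma density_termN m d u : T m d (- u) = (-1) ^+ d * T m d u.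
Proof.
rewrite -[- u]scaleN1r !density_termE fundamental_formZ sqrrN expr1n mul1r.
have -> : \sum_(0 <= i < d.+1) q_term r m i (-1 *: u) * taylor_term P (d - i) (-1 *: u) =
   (-1) ^+ d * \sum_(0 <= i < d.+1) q_term r m i u * taylor_term P (d - i) u.
  rewrite mulr_sumr; apply: eq_big_nat => i /andP[_ id].
  by rewrite /q_term !taylor_termZ mulrACA -exprD subnKC.
by move: (_ ^+ (2 * m).+1) (gbinom _ _) (\sum_(_ <= _ < _) _) => x y z; ring.
Qed.

Lemma symb_form_invsqrt (B V : set (R * R)) e M : open V -> B `<=` V ->
  symb B V e M (-1) (fun u => Q u `^ (- 2^-1)).
Proof.
move=> oV BV; have [c c0 Hc] := fundamental_form_lower a0 r_patch.
apply: (symb_invsqrt oV BV c0) => //.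
- by move=> u _; exact: (fundamental_form_gt0 a0 r_patch).
- by rewrite fundamental_form_qform; exact: symb_qform.
Qed.

Lemma symb_density_term e M m d : symb setT setT e M (d%:Z - (2 * m).+1%:Z) (T m d).
Proof.
have o := @openT (R * R)%type; have TT : [set: R * R] `<=` setT by [].
have Sw := symbX o TT (2 * m).+1 (symb_form_invsqrt e M o TT).
have SS : symb setT setT e M d%:Z (\sum_(0 <= i < d.+1) q_term r m i * taylor_term P (d - i)).
  rewrite big_seq; apply: symb_sum => // i; rewrite mem_index_iota => /andP[_ id].
  have := symbM o TT (symb_taylor_term e o TT M (fun u => (enorm (r u) ^+ 2 - Q u) ^+ m) i)
    (symb_taylor_term e o TT M P (d - i)).
  by rewrite -PoszD subnKC.
have := symbZ o TT (gbinom (- 2^-1) m) (symbM o TT SS Sw).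
rewrite mulN1r; apply: symb_ext => // u _ _.
rewrite density_termE -[LHS]/(_ * (_ * _)) fct_sumE exprfctE.
by congr (_ * (_ * _)); apply: eq_bigr.
Qed.

Lemma Cn_on_taylor_term n (U : set (R * R)) (f : R * R -> R) k : open U -> Cn_on n U (taylor_term f k).
Proof.
move=> o.
have := Cn_on_sum o (index_enum 'I_k.+1) (fun i : 'I_k.+1 =>
  Cn_onM o (Cn_onM o (Cn_on_cst o n (partial i (k - i) f (0, 0) / (i`! * (k - i)`!)%:R))
  (Cn_onX o i (Cn_on_fst o n))) (Cn_onX o (k - i) (Cn_on_snd o n))).
apply: Cn_on_ext => // u _; rewrite /taylor_term fct_sumE; apply: eq_bigr => i _.
by rewrite -[LHS]/(_ * (fst ^+ i) u * (snd ^+ (k - i)) u) !exprfctE.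
Qed.

Lemma continuous_density_term m d u : u != 0 -> {for u, continuous (T m d)}.
Proof.
move=> u0; rewrite (_ : T m d = fun u => gbinom (- 2^-1) m * ((\sum_(0 <= i < d.+1) q_term r m i u * taylor_term P (d - i) u) *
    (Q u `^ (- 2^-1)) ^+ (2 * m).+1)); last by apply/funext => v; exact: density_termE.
apply: cvgM; first exact: cvg_cst.
apply: cvgM.
  have o := @openT (R * R)%type.
  have [+ _] := Cn_on_sum o (index_iota 0 d.+1) (fun i =>
    Cn_onM o (Cn_on_taylor_term 0 (fun u => (enorm (r u) ^+ 2 - Q u) ^+ m) i o)
     (Cn_on_taylor_term 0 P (d - i) o)).
  move=> /(_ u); rewrite inE => /(_ Logic.I); rewrite (_ : (\sum_(_ <- _ | _) _) = fun u =>
     \sum_(0 <= i < d.+1) q_term r m i u * taylor_term P (d - i) u)//.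
  by apply/funext => v; rewrite fct_sumE.
apply: (@continuous_comp _ _ _ (fun u => Q u `^ (- 2^-1)) (fun x => x ^+ (2 * m).+1)); last exact: exprn_continuous.
apply: (@continuous_comp _ _ _ Q (fun x => x `^ (- 2^-1))).
  rewrite fundamental_form_qform; exact: continuous_qform.
have Qu := fundamental_form_gt0 a0 r_patch u0.
by apply/differentiable_continuous/derivable1_diffP/ex_derive; exact: is_derive1_powR.
Qed.

End density_terms.

(** * Expansion of [P / r] with a remainder of prescribed order *)

Section expansion.
Context {R : realType} (a : R) (r : R * R -> 'rV[R]_3) (P : R * R -> R).
Hypotheses (a0 : 0 < a) (r_patch : regular_patch a r) (P_smooth : smooth_on (square a) P).
Local Notation Q := (fundamental_form r).
Local Notation T := (density_term r P).
Let Dl u := enorm (r u) ^+ 2 - Q u.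
Let w u := Q u `^ (- 2^-1).
(** The relative error [(r^2 - Q) / Q], of order 1; off the origin of the square,
    [1 / r = w (1 + x)^(-1/2)]. *)
Let x u := Dl u * w u ^+ 2.

Lemma powR_sqr_invsqrt (t : R) : 0 <= t -> (t ^+ 2) `^ (- 2^-1) = t^-1.
Proof.
by move=> t0; rewrite -powR_mulrn// -powRrM mulrN divff ?pnatr_eq0// powRN powRr1.
Qed.

Lemma enorm_ge0 d (y : 'rV[R]_d) : 0 <= enorm y.
Proof. exact: sqrtr_ge0. Qed.

Lemma relative_sqdist u : u != 0 -> 1 + x u = enorm (r u) ^+ 2 / Q u.
Proof.
move=> u0; have Qu := fundamental_form_gt0 a0 r_patch u0.
rewrite /x /w -powR_mulrn ?powR_ge0// -powRrM mulNr mulVf ?pnatr_eq0// powRN powRr1 ?(ltW Qu)//.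
by rewrite mulrBl divff ?gt_eqF// addrC subrK.
Qed.

Lemma density_term_sum N m u : \sum_(j < N) T m (2 * m + j) u =
  gbinom (- 2^-1) m * (\sum_(0 <= d < 2 * m + N) \sum_(0 <= i < d.+1)
    q_term r m i u * taylor_term P (d - i) u) * w u ^+ (2 * m).+1.
Proof.
rewrite -mulrA mulr_suml mulr_sumr; transitivity (\sum_(0 <= d < 2 * m + N) T m d u); last first.
  by apply: eq_bigr => d _; rewrite (density_termE _ a0 r_patch).
rewrite (@big_cat_nat _ _ _ (2 * m)) ?leq_addr//= [X in _ = X + _]big_nat_cond [X in _ = X + _]big1 ?add0r; last first.
  by move=> d; rewrite andbT => /andP[_ dm]; rewrite (density_term_eq0 _ a0 r_patch)//; lia.
rewrite -[X in \sum_(X <= _ < _) _]add0n big_addn addKn big_mkord.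
by apply: eq_bigr => j _; rewrite addnC.
Qed.

(** Two truncations are separated: that of the binomial series and, for each [m], that of the Taylor
    expansion of [Dl^m P]. Stopping the latter at degree [2m + N] leaves order [N - 1] after
    multiplication by [w^(2m+1)], the order of the former. *)
Lemma density_expansionE N u : u != 0 -> 0 < enorm (r u) ^+ 2 ->
  P u / enorm (r u) - \sum_(m < N) \sum_(j < N) T m (2 * m + j) u =
  P u * (w u * binom_rem (- 2^-1) N (x u)) +
  \sum_(m < N) gbinom (- 2^-1) m * ((Dl u ^+ m * P u - \sum_(0 <= d < 2 * m + N) \sum_(0 <= i < d.+1)
    q_term r m i u * taylor_term P (d - i) u) * w u ^+ (2 * m).+1).
Proof.
move=> u0 ru; have Qu := fundamental_form_gt0 a0 r_patch u0.
have -> : (enorm (r u))^-1 = w u * (1 + x u) `^ (- 2^-1).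
  rewrite -powR_sqr_invsqrt ?enorm_ge0// -powRM ?(ltW Qu)//; last first.
    by rewrite relative_sqdist// divr_ge0 ?(ltW Qu)// sqr_ge0.
  by rewrite relative_sqdist// mulrCA divff ?gt_eqF// mulr1.
under eq_bigr do rewrite density_term_sum.
rewrite /binom_rem mulrBr mulrBr -addrA; congr (_ + _).
rewrite !mulr_sumr -!sumrN -big_split /=; apply: eq_bigr => m _.
have -> : x u ^+ m = Dl u ^+ m * w u ^+ (2 * m) by rewrite /x exprMn exprM.
by rewrite exprS; move: (gbinom _ _) (Dl u ^+ m) (w u ^+ (2 * m)) (w u) (\sum_(_ <= _ < _) _) => p q s t v; ring.
Qed.

Lemma density_expansion N : exists V, [/\ open V, square a `<=` V,
  (forall u, V u -> u != 0 -> {for u, continuous (fun u => P u / enorm (r u))}) &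
  forall e M, e = (1, 0) \/ e = (0, 1) -> symb (square a) V e M (N%:Z - 1)
    (fun u => P u / enorm (r u) - \sum_(m < N) \sum_(j < N) T m (2 * m + j) u)].
Proof.
have [c c0 Hc] := sqdist_lower a0 r_patch.
have [U1 [oU1 aU1 CD1 SD1 cU1]] := symb_sqdist_sub_form a0 r_patch.
have [U2 [oU2 aU2 CP2]] := P_smooth.
pose U := U1 `&` U2.
have oU : open U by exact: openI.
have aU : square a `<=` U by move=> u su; split; [exact: aU1|exact: aU2].
have CD n : Cn_on n U Dl by apply: Cn_onS (CD1 n) => u [].
have CP n : Cn_on n U P by apply: Cn_onS (CP2 n) => u [].
(* The extension of [r] beyond the square might vanish away from the origin; such points are
   removed. At the origin the set stays open because it contains the whole square. *)
pose V := [set u | U u /\ (u = 0 \/ 0 < enorm (r u) ^+ 2)].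
have VU : V `<=` U by move=> u [].
have aV : square a `<=` V.
  move=> u su; split; first exact: aU.
  by have [|u0] := eqVneq u 0; [left|right; exact: (sqdist_gt0 a0 r_patch)].
have V0 u : V u -> u != 0 -> 0 < enorm (r u) ^+ 2.
  by move=> [_ [->|//]]; rewrite eqxx.
have oV : open V.
  rewrite openE => u [Uu [->|ru]].
    exact: (filterS aV (near_square a0)).
  have nU : \forall v \near u, U v by exact: (open_nbhs_nbhs (conj oU Uu)).
  have nr : \forall v \near u, 0 < enorm (r v) ^+ 2.
    have /(_ u) := cU1; rewrite inE => /(_ (proj1 Uu)) cu.
    exact: (cu [set y | 0 < y] (lt_nbhsr ru)).
  by apply: filterS2 nU nr => v Uv rv; split=> //; right.
exists V; split => //.
  move=> u Vu u0; apply: cvgM.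
    have [+ _] := CP 0%N; move=> /(_ u); rewrite inE; apply; exact: VU.
  have : {for u, continuous (fun u => (enorm (r u))^-1)}; last by [].
  have -> : (fun u => (enorm (r u))^-1) = (fun y : R => (Num.sqrt y)^-1) \o (fun u => enorm (r u) ^+ 2).
    by apply/funext => v /=; rewrite enorm2.
  apply: continuous_comp.
    by have /(_ u) := cU1; rewrite inE; apply; exact: (proj1 (VU _ Vu)).
  apply: cvgV; first by rewrite gt_eqF// sqrtr_gt0 V0.
  exact: sqrt_continuous.
move=> e M he.
have SD M' : symb (square a) V e M' 3 Dl.
  by apply: symbS (SD1 e M' he) => // u /VU[].
have Sw := symb_form_invsqrt a0 r_patch e M oV aV.
have Sx : symb (square a) V e M 1 x.
  have := symbM oV aV (SD M) (symbX oV aV 2 Sw).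
  by apply: symb_ext => // u _ _; rewrite -[LHS]/(Dl u * (w ^+ 2) u) exprfctE.
have SP : symb (square a) V e M 0 P.
  by apply: symbS (symb_smooth a0 oU aU he (CP M)).
have Sb : symb (square a) V e M N%:Z (fun u => binom_rem (- 2^-1) N (x u)).
  have [[A HA] _] := symbW (leq0n M) Sx.
  have [[B HB] _] : symb (square a) V e 0 2 Q by rewrite fundamental_form_qform; exact: symb_qform.
  have B1 : 0 < `|B| + 1 by rewrite ltr_wpDl.
  (* From below, [1 + x = r^2 / Q] is bounded by the ratio of the quadratic bounds for [r^2] and
     [Q]; from above, [|x| <= |A| |u| <= |A| a]. *)
  apply: (@symb_binom_rem _ _ _ e oV aV M N _ x (Num.min (c / (`|B| + 1)) 1) (1 + `|A| * a)) => //.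
  - by rewrite lt_min divr_gt0//= ltr01.
  - by rewrite ge_min lexx orbT.
  - by rewrite lerDl mulr_ge0// ltW.
  - by exists a.
  - move=> u Vu u0; rewrite relative_sqdist// divr_gt0 ?V0//.
    exact: (fundamental_form_gt0 a0 r_patch).
  - move=> u su u0; apply/andP; split; last first.
      rewrite lerD2l (le_trans (ler_norm _))// (le_trans (HA u su u0))// expr1z.
      have ua : `|u| <= a := su.
      apply: (@le_trans _ _ (`|A| * `|u|)); first by rewrite ler_wpM2r ?ler_norm.
      by rewrite ler_wpM2l.
    have Qu := fundamental_form_gt0 a0 r_patch u0.
    rewrite relative_sqdist// ge_min; apply/orP; left.
    have nu : 0 < `|u| by rewrite normr_gt0.
    rewrite ler_pdivlMr// (le_trans _ (Hc u su))// mulrAC ler_pdivrMr// -mulrA ler_wpM2l ?(ltW c0)//.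
    rewrite (le_trans (ler_norm _))// (le_trans (HB u su u0))// -exprnP mulrC ler_wpM2l ?exprn_ge0//.
    by rewrite (le_trans (ler_norm _))// lerDl.
have S1 := symbM oV aV SP (symbM oV aV Sw Sb).
have S2 : symb (square a) V e M (N%:Z - 1) (\sum_(m < N) (gbinom (- 2^-1) m \*o
   ((fun u => Dl u ^+ m * P u - \sum_(0 <= d < 2 * m + N) \sum_(0 <= i < d.+1)
    q_term r m i u * taylor_term P (d - i) u) * (w ^+ (2 * m).+1)))).
  apply: symb_sum => // m _; apply: symbZ => //.
  have CDm n : Cn_on n U (fun u => Dl u ^+ m).
    by have := Cn_onX oU m (CD n); apply: Cn_on_ext => // v _; rewrite exprfctE.
  have H1 := symbS (@subset_refl _ _) VU (symb_product_taylor a0 oU aU he M (2 * m + N) CDm CP).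
  have := symbM oV aV H1 (symbX oV aV (2 * m).+1 Sw).
  rewrite (_ : (2 * m + N)%:Z + -1 * (2 * m).+1%:Z = N%:Z - 1)//; lia.
rewrite add0r addrC in S1.
have := symbD oV aV S1 S2; apply: symb_ext => // u Vu u0.
rewrite density_expansionE ?V0// -[LHS]/(_ + _); congr (_ + _).
rewrite fct_sumE; apply: eq_bigr => m _.
by rewrite -[LHS]/(_ * (_ * (w ^+ (2 * m).+1) u)) exprfctE.
Qed.

End expansion.

(** * The coefficients and the error bound *)

Section limits.
Context {R : realType}.

(** The Cauchy estimate survives the passage to the limit in the smaller argument [g], which gives
    convergence together with its rate. *)
Lemma cvg_at_right0_rate (F : R -> R) (D : R) (p : nat) : (0 < p)%N ->
  (forall h g, 0 < g -> g <= h -> `|F h - F g| <= D * h ^+ p) ->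
  cvg (F h @[h --> 0^'+]) /\ (forall h, 0 < h -> `|F h - lim (F h @[h --> 0^'+])| <= D * h ^+ p).
Proof.
move=> p0 HF.
have D0 : 0 <= D.
  by have := HF 1 1 ltr01 (lexx _); rewrite subrr normr0 expr1n mulr1.
have cF : cvg (F h @[h --> 0^'+]).
  apply: cauchy_cvg; apply: cauchy_exP => e e0.
  pose h := Num.min 1 (e / (D + 1)).
  have D1 : 0 < D + 1 by rewrite ltr_wpDl.
  have h0 : 0 < h by rewrite lt_min ltr01 divr_gt0.
  exists (F h).
  suff : \forall g \near (0 : R)^'+, `|F h - F g| < e by [].
  near=> g.
  have gh : `|F h - F g| <= D * h ^+ p.
    by apply: HF; near: g; [exact: nbhs_right_gt|exact: nbhs_right_le].
  apply: (le_lt_trans gh).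
  apply: (@le_lt_trans _ _ (D * h)).
    apply: ler_wpM2l => //; case: p p0 {HF gh} => // p _; rewrite exprS ler_piMr ?(ltW h0)//.
    by rewrite exprn_ile1 ?(ltW h0)// ge_min lexx.
  apply: (@lt_le_trans _ _ ((D + 1) * h)); first by rewrite ltr_pM2r// ltrDl.
  by rewrite mulrC -ler_pdivlMr// ge_min lexx orbT.
split=> // h h0; apply/ler_addgt0Pr => e e0.
have := cF => /cvgrPdist_lt/(_ e e0) H.
have [g [Hg1 [g0 gh]]] : exists g, `|lim (F h @[h --> 0^'+]) - F g| < e /\ (0 < g /\ g <= h).
  apply: (@filter_ex _ (at_right (0 : R))); near=> g; split; first by near: g; exact: H.
  by split; near: g; [exact: nbhs_right_gt|exact: nbhs_right_le].
rewrite (_ : F h - _ = (F h - F g) + (F g - lim (F h @[h --> 0^'+]))); last by rewrite addrA subrK.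
by rewrite (le_trans (ler_normD _ _))// lerD ?HF// distrC ltW.
Unshelve. all: end_near. Qed.

End limits.

(** * Symbol properties of the cutoff *)

Section cutoff.
Context {R : realType} (a : R) (K : nat) (eta : R * R -> R).
Hypotheses (a0 : 0 < a) (K_ge1 : (1 <= K)%N) (eta_C4K : Cn_on (4 * K) setT eta)
  (eta_supp : closure [set u | eta u <> 0] `<=` square a) (eta0 : eta (0, 0) = 1)
  (eta_flat : forall alpha beta : nat,
      (0 < alpha + beta <= 2 * K)%N -> partial alpha beta eta (0, 0) = 0).
Local Notation mR2 := (measurableTypeR R * measurableTypeR R)%type.
Local Notation mu2 := (@lebesgue2 R).

Lemma cutoff_outside v : ~ square a v -> eta v = 0.
Proof.
move=> nv; apply/eqP/negPn/negP => /eqP ev; apply: nv; apply: eta_supp.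
exact: subset_closure.
Qed.

Lemma cutoff_scale_outside h (u : R * R) : 0 < h -> a / h < `|u| -> eta (h *: u) = 0.
Proof.
move=> h0 hu; apply: cutoff_outside; rewrite /square /= normrZ gtr0_norm// => H.
by move: hu; rewrite ltr_pdivrMr// mulrC ltNge H.
Qed.

Lemma continuous_cutoff : continuous eta.
Proof.
move=> u; case: (4 * K)%N eta_C4K => [|n] [c _]; by apply: c; rewrite inE.
Qed.

Lemma symb_cutoff e M : e = (1, 0) \/ e = (0, 1) -> (M <= 4 * K)%N -> symb setT setT e M 0 eta.
Proof.
move=> he MK; apply: (symb_extend (a := a)); first exact: cutoff_outside.
by apply: (symb_smooth a0 openT (@subsetT _ _) he); apply: Cn_onW eta_C4K.
Qed.

(** Outside the square [|u| >= a], so the constant is at most [|c| / a^s] times [|u|^s]; this needs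
    [s >= 0]. The derivatives vanish there and fall under [symb_extend]. *)
Lemma symb_extend_cst (c : R) (e : R * R) M (s : nat) f : (forall v, ~ square a v -> f v = c) ->
  symb (square a) setT e M s%:Z f -> symb setT setT e M s%:Z f.
Proof.
move=> fc Sf; have [[A HA] _] := symbW (leq0n M) Sf.
have ? : exists A0 : R, forall u : R * R, True -> u != 0 -> `|f u| <= A0 * `|u| ^ s%:Z.
  have as0 : 0 < a ^+ s by rewrite exprn_gt0.
  exists (`|A| + `|c| / a ^+ s) => u _ u0; have [su|nsu] := pselect (square a u).
    rewrite (le_trans (HA u su u0))// ler_wpM2r ?exprz_ge0//.
    by rewrite (le_trans (ler_norm _))// lerDl divr_ge0// ltW.
  have au : a <= `|u| by rewrite leNgt; apply/negP => /ltW.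
  rewrite fc// (@le_trans _ _ (`|c| / a ^+ s * `|u| ^ s%:Z))//.
    rewrite mulrAC ler_pdivlMr// ler_wpM2l// -exprnP.
    by rewrite lerXn2r ?nnegrE ?(ltW a0).
  by rewrite ler_wpM2r ?exprz_ge0// lerDr.
case: M Sf => [|M] /= [_ Hf]; split => //.
case: Hf => df Hf; split => //; apply: (symb_extend (a := a)) Hf => v nv.
have : is_derive v e f 0.
  apply: (near_eq_is_derive _ (is_derive_cst c v e)).
  by apply: filterS (near_squareC nv) => z nz; rewrite fc.
by move=> D; exact: (@derive_val _ _ _ _ _ _ _ D).
Qed.

(** Flatness makes the Taylor polynomial of [eta] below degree [t] the constant 1, so [eta - 1] is a
    Taylor remainder of order [t]. *)
Lemma symb_cutoff_sub1 e M t : e = (1, 0) \/ e = (0, 1) -> (M <= 4 * K)%N -> (0 < t <= (2 * K).+1)%N ->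
  symb setT setT e M t%:Z (eta - cst 1).
Proof.
move=> he MK /andP[t0 tK]; apply: (@symb_extend_cst (-1)).
  by move=> v nv; rewrite !fctE cutoff_outside// sub0r.
rewrite (_ : cst 1 = taylor_poly eta t).
  by apply: (symb_taylor he a0 openT (@subsetT _ _) MK _ eta_C4K); lia.
apply/funext => u; rewrite /taylor_poly; case: t t0 tK => // t _ tK.
rewrite big_ord_recl big1 ?addr0.
  by rewrite /taylor_term big_ord1 /partial /= eta0 !expr0 !mulr1 divr1.
move=> i _; rewrite lift0 /taylor_term big1// => j _.
rewrite eta_flat ?mul0r// subnKC; first by have := ltn_ord i; lia.
by rewrite -ltnS.
Qed.

Lemma integrable_cutoff (g : R * R -> R) (h : R) (e : R * R) (s : int) : 0 < h -> (forall u, u != 0 -> {for u, continuous g}) -> g 0 = 0 ->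
  -1 <= s -> symb setT setT e 0 s g ->
  measurable_fun setT (fun u : mR2 => g u * eta (h *: u)) /\
  mu2.-integrable setT (EFin \o (fun u : mR2 => g u * eta (h *: u))).
Proof.
move=> h0 cg g0 s1 Sg.
have m : measurable_fun setT (fun u : mR2 => g u * eta (h *: u)).
  apply: measurable_fun_continuous_off0 => u u0; apply: cvgM; first exact: cg.
  apply: (@continuous_comp _ _ _ (fun u : R * R => h *: u) eta).
    exact: scaler_continuous.
  exact: continuous_cutoff.
split=> //.
have [[B HB] _] := symb_cutoff (or_introl erefl) (leq0n _).
have b0 : 0 < a / h by rewrite divr_gt0.
have S1 : symb (square (a / h)) setT e 0 (-1) g.
  apply: (symb_le (b := a / h) _ s1 (symbS _ (@subset_refl _ _) Sg)) => //.
have [[A HA] _] := S1.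
apply: (integrable_inv_norm (a := a / h) (A := `|A| * `|B|)) => //.
- by rewrite g0 mul0r.
- move=> u su u0; rewrite normrM mulrAC; apply: ler_pM => //.
    by rewrite (le_trans (HA u su u0))// exprN1 ler_wpM2r ?invr_ge0// ler_norm.
  rewrite (le_trans (HB _ Logic.I _))//; first by rewrite scaler_eq0 negb_or gt_eqF.
  by rewrite expr0z mulr1 ler_norm.
- move=> u nu; rewrite cutoff_scale_outside ?mulr0// ltNge; apply/negP => H; exact: nu.
Qed.

End cutoff.

Section quad_error_extra.
Context {R : realType}.
Local Notation mR2 := (measurableTypeR R * measurableTypeR R)%type.
Local Notation mu2 := (@lebesgue2 R).

Lemma quad_error0 : quad_error (fun _ : R * R => 0) = 0.
Proof. by rewrite /quad_error /Rintegral integral0 /= fsbig1 ?subrr. Qed.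

Lemma quad_errorD (f g : R * R -> R) (n : nat) :
  mu2.-integrable setT (EFin \o (f : mR2 -> R)) -> mu2.-integrable setT (EFin \o (g : mR2 -> R)) ->
  f 0 = 0 -> g 0 = 0 -> (forall u, n%:R < `|u| -> f u = 0) -> (forall u, n%:R < `|u| -> g u = 0) ->
  quad_error (fun u => f u + g u) = quad_error f + quad_error g.
Proof.
move=> If Ig f0 g0 fn gn.
have := @quad_error_sum R _ [:: true; false] (fun b => if b then f else g) n _ _ _.
rewrite (_ : (fun u => _) = fun u => f u + g u); last first.
  by apply/funext => u; rewrite !big_cons big_nil addr0.
by move=> ->; rewrite ?big_cons ?big_nil ?addr0//; case.
Qed.

Lemma sum_even_terms (F : nat -> R) K : (forall j, odd j -> F j = 0) ->
  \sum_(j < 2 * K) F j = \sum_(1 <= k < K.+1) F (2 * k - 2)%N.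
Proof.
move=> F0; elim: K => [|K IH]; first by rewrite big_ord0 big_nil.
rewrite big_nat_recr//= -IH (_ : (2 * K.+1 = (2 * K).+2)%N); last by lia.
rewrite !big_ord_recr /= (F0 (2 * K).+1) ?addr0; last by rewrite /= mul2n odd_double.
by rewrite !subSS subn0.
Qed.

End quad_error_extra.

(** * Convergence of the coefficients, with a rate *)

Section coefficients.
Context {R : realType} (a : R) (r : R * R -> 'rV[R]_3) (P eta : R * R -> R) (K : nat).
Hypotheses (a0 : 0 < a) (r_patch : regular_patch a r) (K_ge1 : (1 <= K)%N)
  (eta_C4K : Cn_on (4 * K) setT eta)
  (eta_supp : closure [set u | eta u <> 0] `<=` square a) (eta0 : eta (0, 0) = 1)
  (eta_even : forall u, eta u = eta (- u))
  (eta_flat : forall alpha beta : nat,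
      (0 < alpha + beta <= 2 * K)%N -> partial alpha beta eta (0, 0) = 0).
Local Notation mR2 := (measurableTypeR R * measurableTypeR R)%type.
Local Notation mu2 := (@lebesgue2 R).
Local Notation Q := (fundamental_form r).
Local Notation T := (density_term r P).
Let piece m rho s (u : R * R) : R := q_term r m rho u * taylor_term P s u / Q u `^ (m%:R + 2^-1).

Lemma pieceE m rho s u : piece m rho s u =
  q_term r m rho u * taylor_term P s u * (Q u `^ (- 2^-1)) ^+ (2 * m).+1.
Proof. by rewrite /piece powR_half_odd. Qed.

Lemma piece_at0 m rho s : piece m rho s 0 = 0.
Proof.
rewrite pieceE fundamental_form_at0 powRN powR0 ?invr_eq0 ?pnatr_eq0// invr0 expr0n.
exact: mulr0.
Qed.

Lemma symb_piece e M m rho s : symb setT setT e M ((rho + s)%N%:Z - (2 * m).+1%:Z) (piece m rho s).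
Proof.
have o := @openT (R * R)%type; have TT : [set: R * R] `<=` setT by [].
have Sw := symbX o TT (2 * m).+1 (symb_form_invsqrt a0 r_patch e M o TT).
have Sq : symb setT setT e M rho%:Z (q_term r m rho) by exact: symb_taylor_term.
have := symbM o TT (symbM o TT Sq (symb_taylor_term e o TT M P s)) Sw.
rewrite mulN1r; apply: symb_ext => // u _ _.
by rewrite pieceE -[LHS]/(_ * _) exprfctE.
Qed.

Lemma continuous_piece m rho s u : u != 0 -> {for u, continuous (piece m rho s)}.
Proof.
move=> u0; rewrite (_ : piece m rho s = fun u => q_term r m rho u * taylor_term P s u *
  (Q u `^ (- 2^-1)) ^+ (2 * m).+1); last by apply/funext => v; exact: pieceE.
have o := @openT (R * R)%type.
have ct (f : R * R -> R) k : continuous (taylor_term f k).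
  by have [c _] := Cn_on_taylor_term 0 f k o; move=> v; apply: c; rewrite inE.
apply: cvgM; first by apply: cvgM; exact: ct.
apply: (@continuous_comp _ _ _ (fun u => Q u `^ (- 2^-1)) (fun x => x ^+ (2 * m).+1)); last exact: exprn_continuous.
apply: (@continuous_comp _ _ _ Q (fun x => x `^ (- 2^-1))).
  rewrite fundamental_form_qform; exact: continuous_qform.
have Qu := fundamental_form_gt0 a0 r_patch u0.
by apply/differentiable_continuous/derivable1_diffP/ex_derive; exact: is_derive1_powR.
Qed.

Lemma Ctilde_quad_error m k h : 0 < h ->
  Ctilde r P eta m k h = quad_error (fun u => T m (2 * (m + k - 1)) u * eta (h *: u)).
Proof.
move=> h0; rewrite /Ctilde; set d := (2 * (m + k - 1))%N.
have [n Hn] := scaled_support (cutoff_outside eta_supp) h0.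
(* Extension by zero off the index condition turns the constrained sum into a full double sum, to
   which linearity applies. *)
pose F (rho s : 'I_d.+1) (u : R * R) : R :=
  if (rho + s == d)%N && (3 * m <= rho)%N then piece m rho s u * eta (h *: u) else 0.
have iF rho s : mu2.-integrable setT (EFin \o (F rho s : mR2 -> R)).
  have [c|c] := boolP ((rho + s == d)%N && (3 * m <= rho)%N); last first.
    by rewrite (_ : F rho s = cst 0); [exact: integrable0|apply/funext => u; rewrite /F (negbTE c)].
  rewrite (_ : F rho s = fun u => piece m rho s u * eta (h *: u)); last by apply/funext => u; rewrite /F c.
  move: c => /andP[/eqP rs mr].
  apply: (proj2 (integrable_cutoff a0 eta_C4K eta_supp h0 (@continuous_piece m rho s) (piece_at0 _ _ _) _ (symb_piece (1, 0) 0 m rho s))).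
  (* A nonempty constraint gives [3m <= rho <= d], so the order [d - 2m - 1] is at least
     [m - 1 >= -1], as integrability in the plane requires. *)
  by rewrite rs; have := leq_trans mr (ltn_ord rho : rho <= d)%N; lia.
have F0 rho s : F rho s 0 = 0 by rewrite /F piece_at0 mul0r if_same.
have Fn rho s u : n%:R < `|u| -> F rho s u = 0.
  by move=> nu; rewrite /F Hn// mulr0 if_same.
have iS rho := proj1 (Rintegral_sum (index_enum 'I_d.+1) (iF rho)).
have iSS := proj1 (Rintegral_sum (index_enum 'I_d.+1) iS).
rewrite (_ : (fun u => T m d u * eta (h *: u)) =
    fun u => gbinom (- 2^-1) m * \sum_(rho < d.+1) \sum_(s < d.+1) F rho s u); last first.
  apply/funext => u; rewrite /density_term -mulrA mulr_suml; congr (_ * _).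
  apply: eq_bigr => rho _; rewrite mulr_suml big_mkcond; apply: eq_bigr => s _.
  by rewrite /F; case: ifP.
rewrite quad_errorZ//; congr (_ * _).
rewrite (@quad_error_sum _ _ _ (fun (rho : 'I_d.+1) u => \sum_(s < d.+1) F rho s u) n)//; last 2 first.
- by move=> rho; rewrite big1.
- by move=> rho u nu; rewrite big1// => s _; rewrite Fn.
apply: eq_bigr => rho _.
rewrite (@quad_error_sum _ _ _ (F rho) n)//; last by move=> s u; exact: Fn.
rewrite big_mkcond; apply: eq_bigr => s _; rewrite /F; case: ifP => // _.
rewrite /quad_error /Rintegral integral0 /= fsbig1 ?subrr//.
Qed.

Lemma integrable_density_cutoff m j h : 0 < h ->
  measurable_fun setT (fun u : mR2 => T m (2 * m + j) u * eta (h *: u)) /\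
  mu2.-integrable setT (EFin \o (fun u : mR2 => T m (2 * m + j) u * eta (h *: u))).
Proof.
move=> h0.
apply: (integrable_cutoff a0 eta_C4K eta_supp h0 _ _ _ (symb_density_term P a0 r_patch (1, 0) 0 m (2 * m + j))).
- by move=> u; exact: (continuous_density_term a0 r_patch).
- exact: (density_term_at0 P a0 r_patch).
- lia.
Qed.

Lemma quad_error_density_odd m j h : 0 < h -> odd j ->
  quad_error (fun u => T m (2 * m + j) u * eta (h *: u)) = 0.
Proof.
move=> h0 oj; apply: quad_error_odd; first exact: (proj2 (integrable_density_cutoff _ _ h0)).
move=> u; rewrite (density_termN _ a0 r_patch) scalerN -eta_even -signr_odd oddD mul2n odd_double oj /=.
by rewrite expr1 mulN1r mulNr.
Qed.

Lemma density_term_rescale m j (h : R) u : 0 < h ->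
  T m (2 * m + j) u = h * h ^- j * T m (2 * m + j) (h *: u).
Proof.
move=> h0; have hj : h ^+ j != 0 by rewrite expf_neq0// gt_eqF.
have hm : h ^+ (2 * m) != 0 by rewrite expf_neq0// gt_eqF.
have := density_termZ P a0 r_patch m (2 * m + j) u h0.
rewrite exprS exprD => E.
apply: (mulfI (mulf_neq0 hm hj)); rewrite -E.
move: (T _ _ _) (h ^+ (2 * m)) (h ^+ j) hj => x y z z0.
by field.
Qed.

(** In the difference of the two cutoffs the constant 1 cancels, leaving dilates of
    [Psi = T (eta - 1)]. Of the flatness just order [t] is spent, so that [Psi] has order
    [(j - 1) + t = 2K - 1] for every [k]. *)
Lemma Ctilde_rate m k : (1 <= k <= K)%N -> exists D : R, forall h g, 0 < g -> g <= h ->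
  `|Ctilde r P eta m k h - Ctilde r P eta m k g| <= D * h ^+ (2 * K - 2 * k + 2).
Proof.
move=> /andP[k1 kK]; pose j := (2 * k - 2)%N; pose t := (2 * K - 2 * k + 2)%N.
have dE : (2 * (m + k - 1) = 2 * m + j)%N by rewrite /j; lia.
pose s := (2 * K - 1)%N.
have jts : s.+1 = (j + t)%N by rewrite /j /t /s; lia.
have s0 : (0 < s)%N by rewrite /s; lia.
pose Psi : R * R -> R := T m (2 * m + j) * (eta - cst 1).
have SPsi (e : R * R) : e = (1, 0) \/ e = (0, 1) -> exists A, symbA e s.+3 s%:Z A Psi.
  move=> he; apply: symb_symbA.
  have S1 : symb setT setT e s.+3 t%:Z (eta - cst 1).
    by apply: (symb_cutoff_sub1 a0 K_ge1 eta_C4K eta_supp eta0 eta_flat he); rewrite /t; lia.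
  have := symbM (@openT _) (@subset_refl _ _) (symb_density_term P a0 r_patch e s.+3 m (2 * m + j)) S1.
  by rewrite (_ : _ - _ + t%:Z = s%:Z)// /t /j /s; lia.
have [A1 HA1] := SPsi _ (or_introl erefl); have [A2 HA2] := SPsi _ (or_intror erefl).
pose A := `|A1| + `|A2|.
have HA (e : R * R) : e = (1, 0) \/ e = (0, 1) -> symbA e s.+3 s%:Z A Psi.
  case=> ->; [apply: symbA_le HA1|apply: symbA_le HA2];
  by rewrite (le_trans (ler_norm _))// /A ?lerDl ?lerDr.
have A0 : 0 <= A by rewrite addr_ge0.
have [C C0 HC] := trapezoid (R := R) s0.
exists (C * (A + A)) => h g g0 gh; have h0 : 0 < h by exact: lt_le_trans gh.
pose f u := T m (2 * m + j) u * eta (h *: u) - T m (2 * m + j) u * eta (g *: u).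
have [mh ih] := integrable_density_cutoff m j h0.
have [mg ig] := integrable_density_cutoff m j g0.
have [n1 Hn1] := scaled_support (cutoff_outside eta_supp) h0; have [n2 Hn2] := scaled_support (cutoff_outside eta_supp) g0.
have EB : Ctilde r P eta m k h - Ctilde r P eta m k g = quad_error f.
  rewrite !Ctilde_quad_error// dE.
  rewrite (_ : f = fun u => T m (2 * m + j) u * eta (h *: u) + -1 * (T m (2 * m + j) u * eta (g *: u))); last first.
    by apply/funext => u; rewrite /f mulN1r.
  rewrite (quad_errorD (n := (n1 + n2)%N) ih (integrableZl measurableT (-1) ig)).
  - by rewrite quad_errorZ// mulN1r.
  - by rewrite (density_term_at0 P a0 r_patch) mul0r.
  - by rewrite (density_term_at0 P a0 r_patch) mul0r mulr0.
  - by move=> u nu; rewrite Hn1 ?mulr0//; apply: le_lt_trans nu; rewrite natrD lerDl.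
  - by move=> u nu; rewrite Hn2 ?mulr0//; apply: le_lt_trans nu; rewrite natrD lerDr.
rewrite EB.
(* Homogeneity of degree [j - 1] costs [l^(1-j)] and dilation of [Psi] gains [l^s]; by [jts] the
   product is [l^t], at most [h^t]. *)
have scaled (l : R) (e : R * R) : 0 < l -> l <= h -> e = (1, 0) \/ e = (0, 1) ->
    symbA e s.+3 s%:Z (A * h ^+ t) ((l * l ^- j) \*: (fun u => Psi (l *: u))).
  move=> l0 lh he; have := symbAZ (l * l ^- j) (symbA_scale l0 (HA e he)).
  apply: symbA_le.
  have lj : l ^+ j != 0 by rewrite expf_neq0// gt_eqF.
  rewrite ger0_norm; last by rewrite divr_ge0 ?exprn_ge0// ltW.
  have -> : l * l ^- j * (A * l ^ s%:Z) = A * l ^+ t.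
    have -> : l ^ s%:Z = l ^+ s by [].
    have E : l * l ^+ s = l ^+ j * l ^+ t.
      by rewrite -exprS -exprD jts.
    have -> : l / l ^+ j * (A * l ^+ s) = A * (l * l ^+ s) / l ^+ j.
      by move: (l ^- j) (l ^+ s) => y z; ring.
    by rewrite E [l ^+ j * _]mulrC mulrA mulfK.
  by rewrite ler_wpM2l// lerXn2r ?nnegrE// ltW.
have Hs : symbol_bound s.+3 s (A * h ^+ t + A * h ^+ t) f.
  have f0 : f 0 = 0 by rewrite /f (density_term_at0 P a0 r_patch) !mul0r subrr.
  apply: (symbA_symbol_bound s0 f0).
  move=> e he; have := symbAB (scaled h e h0 (lexx h) he) (scaled g e g0 gh he).
  apply: symbA_ext => u u0.
  rewrite -[LHS]/(h * h ^- j * (T m (2 * m + j) (h *: u) * (eta (h *: u) - 1)) - g * g ^- j * (T m (2 * m + j) (g *: u) * (eta (g *: u) - 1))).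
  rewrite (mulrA (h / h ^+ j)) (mulrA (g / g ^+ j)) -(density_term_rescale m j u h0) -(density_term_rescale m j u g0) /f.
  move: (T _ _ _) (eta _) (eta _) => y z1 z2.
  by ring.
have mf : measurable_fun setT (f : mR2 -> R) by exact: measurable_funB.
have fn u : (n1 + n2)%:R < `|u| -> f u = 0.
  move=> nu; rewrite /f Hn1 ?Hn2 ?mulr0 ?subrr//; apply: le_lt_trans nu; by rewrite natrD ?lerDl ?lerDr.
by rewrite (le_trans (HC f _ _ Hs mf fn))// -mulrDl mulrA.
Qed.

Lemma Ctilde_cvg m k : (1 <= k <= K)%N ->
  cvg (Ctilde r P eta m k h @[h --> 0^'+]) /\
  exists D : R, forall h, 0 < h -> `|Ctilde r P eta m k h - Cm r P eta m k| <= D * h ^+ (2 * K - 2 * k + 2).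
Proof.
move=> kK; have [D HD] := Ctilde_rate m kK.
by have [|? ?] := cvg_at_right0_rate _ HD; [lia|split => //; exists D].
Qed.

End coefficients.

(** * Assembly of the asymptotic expansion *)

Section asymptotics.
Context {R : realType} (a : R) (r : R * R -> 'rV[R]_3) (P eta : R * R -> R) (K : nat).
Hypotheses (a0 : 0 < a) (r_patch : regular_patch a r) (P_smooth : smooth_on (square a) P) (K_ge1 : (1 <= K)%N)
  (eta_C4K : Cn_on (4 * K) setT eta)
  (eta_supp : closure [set u | eta u <> 0] `<=` square a) (eta0 : eta (0, 0) = 1)
  (eta_even : forall u, eta u = eta (- u))
  (eta_flat : forall alpha beta : nat,
      (0 < alpha + beta <= 2 * K)%N -> partial alpha beta eta (0, 0) = 0).
Local Notation mR2 := (measurableTypeR R * measurableTypeR R)%type.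
Local Notation mu2 := (@lebesgue2 R).
Local Notation T := (density_term r P).
Let g (u : R * R) : R := P u * eta u / enorm (r u).
Let rem (u : R * R) : R := g u - \sum_(m < 2 * K) \sum_(j < 2 * K) T m (2 * m + j) u * eta u.
Let s := (2 * K - 1)%N.

Lemma integrand_at0 : g 0 = 0.
Proof.
rewrite /g (_ : r 0 = 0); last exact: (patch0 r_patch).
rewrite (_ : enorm 0 = 0) ?invr0 ?mulr0//.
by rewrite /enorm /dot big1 ?sqrtr0// => l _; rewrite mxE mulr0.
Qed.

Lemma rem_at0 : rem 0 = 0.
Proof.
rewrite /rem integrand_at0 big1 ?subrr// => m _; rewrite big1// => j _.
by rewrite (density_term_at0 P a0 r_patch) mul0r.
Qed.

Lemma integrand_outside u : ~ square a u -> g u = 0.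
Proof. by move=> nu; rewrite /g (cutoff_outside eta_supp nu) mulr0 mul0r. Qed.

Lemma rem_outside u : ~ square a u -> rem u = 0.
Proof.
move=> nu; rewrite /rem integrand_outside// big1 ?subrr// => m _; rewrite big1// => j _.
by rewrite (cutoff_outside eta_supp nu) mulr0.
Qed.

Lemma measurable_integrand : measurable_fun setT (g : mR2 -> R).
Proof.
(* Only the neighbourhood and the continuity of [P / r] are used here, so any truncation order will
   do. *)
have [V [oV aV cV _]] := density_expansion a0 r_patch P_smooth 0.
apply: measurable_fun_continuous_off0 => u u0.
have [su|nu] := pselect (square a u).
  rewrite (_ : g = (fun u => P u / enorm (r u)) * eta); last first.
    by apply/funext => v; rewrite /g !fctE mulrAC.
  by apply: cvgM; [exact: (cV u (aV _ su) u0)|exact: (continuous_cutoff eta_C4K)].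
have H : \forall v \near u, cst (0 : R) v = g v.
  by apply: filterS (near_squareC nu) => v nv; rewrite integrand_outside.
have gu := integrand_outside nu.
suff : g @ u --> (0 : R) by rewrite -gu.
apply: cvg_trans (near_eq_cvg H) _; exact: cvg_cst.
Qed.

Lemma symb_rem e : e = (1, 0) \/ e = (0, 1) -> symb setT setT e s.+3 s%:Z rem.
Proof.
move=> he; have [V [oV aV _ SV]] := density_expansion a0 r_patch P_smooth (2 * K).
have o := @openT (R * R)%type; have TT : [set: R * R] `<=` setT by [].
(* Here the [2K + 2] derivatives of the cutoff are drawn from its class [4K], using [K >= 1]. *)
have MK : (s.+3 <= 4 * K)%N by rewrite /s; lia.
have := symbM_support oV aV (cutoff_outside eta_supp) (SV e s.+3 he) (symb_cutoff a0 eta_C4K eta_supp he MK).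
rewrite (_ : (2 * K)%:Z - 1 + 0 = s%:Z); last by rewrite /s; lia.
apply: symb_ext => // u _ _.
rewrite -[LHS]/((_ - _) * eta u) mulrBl mulrAC mulr_suml /rem; congr (_ - _).
by apply: eq_bigr => m _; rewrite mulr_suml.
Qed.

Lemma measurable_rem : measurable_fun setT (rem : mR2 -> R).
Proof.
apply: measurable_funB; first exact: measurable_integrand.
apply: measurable_sum => m; apply: measurable_sum => j.
have [+ _] := integrable_density_cutoff P a0 r_patch K_ge1 eta_C4K eta_supp m j ltr01.
by under eq_fun do rewrite scale1r.
Qed.

Lemma quad_error_rem : exists D : R, forall h, 0 < h -> `|quad_error (fun u => rem (h *: u))| <= D * h ^+ s /\
  mu2.-integrable setT (EFin \o (fun u : mR2 => rem (h *: u))).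
Proof.
have s0 : (0 < s)%N by rewrite /s; lia.
have [A1 HA1] := symb_symbA (symb_rem (or_introl erefl)).
have [A2 HA2] := symb_symbA (symb_rem (or_intror erefl)).
pose A := `|A1| + `|A2|.
have HA (e : R * R) : e = (1, 0) \/ e = (0, 1) -> symbA e s.+3 s%:Z A rem.
  case=> ->; [apply: symbA_le HA1|apply: symbA_le HA2];
  by rewrite (le_trans (ler_norm _))// /A ?lerDl ?lerDr.
have [C C0 HC] := trapezoid (R := R) s0.
exists (C * A) => h h0.
have f0 : (fun u => rem (h *: u)) 0 = 0 by rewrite scaler0 rem_at0.
have Hs : symbol_bound s.+3 s (A * h ^+ s) (fun u => rem (h *: u)).
  by apply: (symbA_symbol_bound s0 f0) => e he; exact: (symbA_scale h0 (HA e he)).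
have [n fn] := scaled_support rem_outside h0.
have mf : measurable_fun setT (fun u : mR2 => rem (h *: u)).
  have mh : measurable_fun setT (fun u : mR2 => (h *: u : mR2)).
    have := measurable_affine2 h (0 : R * R).
    by rewrite (_ : affine2 h 0 = fun u : mR2 => (h *: u : mR2))//; apply/funext => u; rewrite /affine2 /= !addr0.
  exact: (measurableT_comp measurable_rem mh).
split; first by rewrite (le_trans (HC _ _ _ Hs mf fn))// mulrA.
have [Hb _ _] := Hs.
have A0 : 0 <= A * h ^+ s by rewrite mulr_ge0 ?addr_ge0 ?exprn_ge0// ltW.
apply: (@integrable_bounded_support R _ (square n%:R) (A * h ^+ s * n%:R ^+ s)) => //.
- exact: measurable_square.
- by rewrite lebesgue2_square// ltry.
- move=> u su; rewrite (le_trans (Hb u))// ler_wpM2l//; by apply: lerXn2r; rewrite ?nnegrE.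
- by move=> u nu; apply: fn; rewrite ltNge; apply/negP => H; exact: nu.
Qed.


Lemma integral_square_integrand h : 0 < h ->
  \int[mu2]_(u in square a) g u = h ^+ 2 * \int[mu2]_u g (h *: u).
Proof.
move=> h0; rewrite Rintegral_mkcond.
have -> : g \_ (square a) = g.
  apply/funext => u; rewrite patchE; case: ifPn => // nu; rewrite integrand_outside//.
  by move=> /mem_set su; rewrite su in nu.
have hn : h != 0 by rewrite gt_eqF.
rewrite (Rintegral_affine (0 : R * R) hn measurable_integrand); congr (_ * _).
by apply: eq_Rintegral => u _; rewrite /affine2 /= !addr0.
Qed.

Lemma step_gt0 N : 0 < step a N.
Proof. by rewrite divr_gt0// ltr_wpDl. Qed.

(** The first omitted points have [|i| >= N + 1], and [a (N + 1) / (N + 1/2) > a] puts them outside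
    the square, where the integrand vanishes. *)
Lemma punctured_sum_lattice N : punctured_sum r (fun u => P u * eta u) N (step a N) =
  step a N ^+ 2 * \sum_(i \in [set i : int * int | i <> (0, 0)]) g (step a N *: lattice_point R i).
Proof.
have h0 := step_gt0 N; set h := step a N in h0 *.
rewrite mulr_fsumr /punctured_sum.
under eq_fsbigr do rewrite mulrC.
apply: fsbig_widen => [i [] //|i [/= i0 iN]].
suff E : g (h *: lattice_point R i) = 0.
  by rewrite /= -[X in _ * X]/(g (h *: lattice_point R i)) E mulr0.
apply: integrand_outside; rewrite /square /= normrZ gtr0_norm// norm_lattice_point.
have {}iN : (N%:Z < Num.max `|i.1| `|i.2|)%R.
  by rewrite ltNge; apply/negP => H; exact: iN.
apply/negP; rewrite -ltNge; have {}iN : N%:R + 1 <= (Num.max `|i.1| `|i.2|)%:~R :> R.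
  rewrite natr1 -[N.+1%:R]/(N.+1%:Z%:~R) ler_int.
  by move: (Num.max _ _) iN => z; lia.
apply: (@lt_le_trans _ _ (h * (N%:R + 1))); last by rewrite ler_wpM2l// ltW.
have N2 : 0 < N%:R + 2^-1 :> R by rewrite ltr_wpDl.
rewrite /h /step mulrAC ltr_pdivlMr// ltr_pM2l// ltrD2l invf_lt1//.
by rewrite ltr1n.
Qed.

(** Terms with odd [j] vanish by parity. For [j = 2k - 2] the area factor [h^2] and homogeneity of
    degree [j - 1] give [h^(2k-1)], with [Ctilde m k h] as coefficient. *)
Lemma quad_error_integrand h : 0 < h -> h ^+ 2 * quad_error (fun u => g (h *: u)) =
  h ^+ 2 * quad_error (fun u => rem (h *: u)) +
  \sum_(1 <= k < K.+1) (\sum_(0 <= m < (2 * k - 2).+1) Ctilde r P eta m k h) * h ^+ (2 * k - 1).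
Proof.
move=> h0; have [D HD] := quad_error_rem; have [_ irem] := HD h h0.
have [n0 Hn0] := scaled_support (cutoff_outside eta_supp) h0.
pose F m j (u : R * R) := h ^+ j / h * (T m (2 * m + j) u * eta (h *: u)).
have iT m j := proj2 (integrable_density_cutoff P a0 r_patch K_ge1 eta_C4K eta_supp m j h0).
have iF m j : mu2.-integrable setT (EFin \o (F m j : mR2 -> R)).
  exact: (integrableZl measurableT (h ^+ j / h) (iT m j)).
have F0 m j : F m j 0 = 0 by rewrite /F (density_term_at0 P a0 r_patch) mul0r mulr0.
have Fn m j u : n0%:R < `|u| -> F m j u = 0 by move=> nu; rewrite /F Hn0// !mulr0.
have iS m := proj1 (Rintegral_sum (index_enum 'I_(2 * K)) (fun j : 'I_(2 * K) => iF m j)).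
have iSS := proj1 (Rintegral_sum (index_enum 'I_(2 * K)) (fun m : 'I_(2 * K) => iS m)).
have [n1 remn] := scaled_support rem_outside h0.
have -> : (fun u => g (h *: u)) = fun u => rem (h *: u) + \sum_(m < 2 * K) \sum_(j < 2 * K) F m j u.
  apply/funext => u; rewrite /rem -[LHS](subrK (\sum_(m < 2 * K) \sum_(j < 2 * K) T m (2 * m + j) (h *: u) * eta (h *: u))).
  congr (_ + _); apply: eq_bigr => m _; apply: eq_bigr => j _.
  rewrite /F mulrA (density_term_rescale P a0 r_patch m j u h0).
  have hn : h != 0 by rewrite gt_eqF.
  have hj : h ^+ j != 0 by rewrite expf_neq0.
  by move: (T _ _ _) (eta _) (h ^+ j) hj => y z t tn; field; rewrite hn tn.
rewrite (quad_errorD (n := (n0 + n1)%N))//; first last.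
- move=> u nu; rewrite big1// => m _; rewrite big1// => j _; apply: Fn.
  by apply: le_lt_trans nu; rewrite natrD lerDl.
- by move=> u nu; apply: remn; apply: le_lt_trans nu; rewrite natrD lerDr.
- by rewrite big1// => m _; rewrite big1.
- by rewrite scaler0 rem_at0.
rewrite mulrDr; congr (_ + _).
rewrite (@quad_error_sum _ _ _ (fun (m : 'I_(2 * K)) u => \sum_(j < 2 * K) F m j u) n0)//; last 2 first.
- by move=> m; rewrite big1.
- by move=> m u nu; rewrite big1// => j _; rewrite Fn.
under eq_bigr => m _.
  rewrite (@quad_error_sum _ _ _ (fun (j : 'I_(2 * K)) u => F m j u) n0)//; last by move=> j u; exact: Fn.
  under eq_bigr => j _ do rewrite quad_errorZ//.
  rewrite (sum_even_terms (F := fun j => h ^+ j / h * quad_error (fun u => T m (2 * m + j) u * eta (h *: u)))); last first.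
    by move=> j oj; rewrite (quad_error_density_odd P a0 r_patch K_ge1 eta_C4K eta_supp eta_even)// mulr0.
  over.
rewrite exchange_big mulr_sumr; apply: eq_big_nat => k /andP[k1 kK].
rewrite mulr_sumr mulr_suml -(big_mkord xpredT (fun m => h ^+ 2 * (h ^+ (2 * k - 2) / h * quad_error (fun u => T m (2 * m + (2 * k - 2)) u * eta (h *: u))))).
(* The common range [m < 2K] contains the range of [Ccoef]; beyond it the density terms vanish
   because [d < 3m]. *)
rewrite [LHS](@big_cat_nat _ _ _ (2 * k - 2).+1)//=; last by lia.
rewrite [X in _ + X]big_nat_cond [X in _ + X]big1 ?addr0; last first.
  move=> m; rewrite andbT => /andP[km _].
  rewrite (_ : (fun u => _) = fun _ => 0) ?quad_error0 ?mulr0//.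
  by apply/funext => u; rewrite (density_term_eq0 _ a0 r_patch) ?mul0r//; lia.
apply: eq_bigr => m _.
rewrite (Ctilde_quad_error P a0 r_patch K_ge1 eta_C4K eta_supp m k h0) (_ : 2 * (m + k - 1) = 2 * m + (2 * k - 2))%N; last by lia.
rewrite (_ : 2 * k - 1 = (2 * k - 2).+1)%N ?exprS; last by lia.
have hn : h != 0 by rewrite gt_eqF.
by move: (quad_error _) (h ^+ (2 * k - 2)) => y z; field.
Qed.

Lemma quadrature_error_bound : exists D : R, forall N,
  `|\int[mu2]_(u in square a) (P u * eta u / enorm (r u))
     - (punctured_sum r (fun u => P u * eta u) N (step a N)
        + \sum_(1 <= k < K.+1) Ccoef r P eta k * step a N ^+ (2 * k - 1))| <= D * step a N ^+ (2 * K + 1).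
Proof.
have [D0 HD0] := quad_error_rem.
(* The range condition is placed under the existential so that a constant can be chosen for every
   pair. *)
have /choice[D HD] : forall p : nat * nat, exists D : R, (1 <= p.2 <= K)%N -> forall h, 0 < h ->
    `|Ctilde r P eta p.1 p.2 h - Cm r P eta p.1 p.2| <= D * h ^+ (2 * K - 2 * p.2 + 2).
  move=> [m k] /=; have [kK|nk] := boolP (1 <= k <= K)%N; last by exists 0.
  have [_ [D HD]] := Ctilde_cvg P a0 r_patch K_ge1 eta_C4K eta_supp eta0 eta_flat m kK.
  by exists D.
exists (D0 + \sum_(1 <= k < K.+1) \sum_(0 <= m < (2 * k - 2).+1) D (m, k)) => N.
have h0 := step_gt0 N; rewrite punctured_sum_lattice (integral_square_integrand h0).
move: (step a N) h0 => h h0.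
rewrite opprD addrA -mulrBr -[X in h ^+ 2 * X]/(quad_error (fun u => g (h *: u))).
rewrite quad_error_integrand// -addrA -sumrB mulrDl.
apply: le_trans (ler_normD _ _) _; apply: lerD.
  have [H _] := HD0 h h0; rewrite normrM ger0_norm ?sqr_ge0//.
  apply: le_trans (ler_wpM2l (sqr_ge0 h) H) _.
  rewrite mulrCA -exprD (_ : (2 + s = 2 * K + 1)%N)//; rewrite /s; lia.
rewrite mulr_suml; apply: le_trans (ler_norm_sum _ _ _) _.
rewrite big_nat_cond [leRHS]big_nat_cond; apply: ler_sum => k; rewrite andbT => /andP[k1 kK].
rewrite -mulrBl /Ccoef -sumrB normrM [X in _ * X <= _]ger0_norm ?exprn_ge0 ?(ltW h0)//.
rewrite (_ : (2 * K + 1 = (2 * K - 2 * k + 2) + (2 * k - 1))%N); last by lia.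
rewrite exprD mulrA ler_wpM2r ?exprn_ge0 ?(ltW h0)//.
rewrite mulr_suml; apply: le_trans (ler_norm_sum _ _ _) _.
by apply: ler_sum => m _; apply: (HD (m, k)) => //=; rewrite k1.
Qed.

End asymptotics.

(** The convergence clause certifies that every [lim] entering the coefficients is a genuine limit
    and not a default value. *)
Theorem theorem5 (R : realType) (a : R) (r : R * R -> 'rV[R]_3)
    (P eta : R * R -> R) (K : nat)
    (a_gt0 : 0 < a)
    (r_patch : regular_patch a r)
    (P_smooth : smooth_on (square a) P)
    (K_ge1 : (1 <= K)%N)
    (eta_C4K : Cn_on (4 * K) setT eta)
    (eta_supp : closure [set u | eta u <> 0] `<=` square a)
    (eta0 : eta (0, 0) = 1)
    (eta_even : forall u, eta u = eta (- u))
    (eta_flat : forall alpha beta : nat,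
      (0 < alpha + beta <= 2 * K)%N -> partial alpha beta eta (0, 0) = 0) :
  (forall k m : nat, (1 <= k <= K)%N -> (m <= 2 * k - 2)%N ->
     cvg (Ctilde r P eta m k h @[h --> 0^'+])) /\
  (fun N : nat =>
     \int[@lebesgue2 R]_(u in square a) (P u * eta u / enorm (r u))
     - (punctured_sum r (fun u => P u * eta u) N (step a N)
        + \sum_(1 <= k < K.+1) Ccoef r P eta k * step a N ^+ (2 * k - 1)))
  =O_\oo (fun N : nat => step a N ^+ (2 * K + 1)).
Proof.
split.
  move=> k m kK _.
  exact: (proj1 (Ctilde_cvg P a_gt0 r_patch K_ge1 eta_C4K eta_supp eta0 eta_flat m kK)).
have [D HD] := quadrature_error_bound a_gt0 r_patch P_smooth K_ge1 eta_C4K eta_supp eta0 eta_even eta_flat.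
(* The domination constant has to be positive, and nothing is known about the sign of [D]. *)
apply/eqO_exP; exists (`|D| + 1); first by rewrite ltr_wpDl.
near=> N; have hN : 0 <= step a N ^+ (2 * K + 1) by rewrite exprn_ge0// ltW// step_gt0.
apply: le_trans (HD N) _; rewrite (ger0_norm hN); apply: ler_wpM2r => //.
by rewrite (le_trans (ler_norm _))// lerDl.
Unshelve. all: end_near. Qed.
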